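(* Let $\Omega\subset\mathbb{R}^d$ be a round polyhedron with radius $r>0$, let $g\in C^2(\bar\Omega)$ be $\lambda$-Lipschitz with $\lambda<1$, let $p\in[1,+\infty]$, and let $f\ge0$ with $f\in L^p(\Omega)$. Let $T$ be a Borel selector of $x\mapsto\mathrm{argmin}\{|x-y|+g(y):y\in\partial\Omega\}$. Then the transport density $\sigma$ between $f$ and $T_\#f$ belongs to $L^p(\Omega)$.
   Context: A round polyhedron with radius $r$ is a bounded domain $\Omega\subset\mathbb{R}^d$ whose boundary is composed of finitely many parts of spheres of radius $r$, with $\Omega$ lying outside the corresponding balls: there are distinct centers $b_1,\dots,b_m$ with $B(b_i,r)\cap\Omega=\emptyset$ for all $i$ and $\partial\Omega=\bigcup_{i=1}^m F_i$, where $F_i=\partial\Omega\cap\partial B(b_i,r)$. The function $f$ is identified with the measure $f\,dx$. A Borel selector is a Borel map $T:\bar\Omega\to\partial\Omega$ such that $T(x)\in\mathrm{argmin}\{|x-y|+g(y):y\in\partial\Omega\}$ for every $x\in\bar\Omega$. The transport density $\sigma$ between $f$ and $T_\#f$ is the positive measure on $\bar\Omega$ defined by $$\langle\sigma,\phi\rangle=\int_{\Omega}\int_0^1|x-T(x)|\,\phi\big((1-t)x+tT(x)\big)\,f(x)\,dt\,dx\qquad\text{for all }\phi\in C(\bar\Omega).$$ ''$\sigma\in L^p(\Omega)$'' means that $\sigma$ is absolutely continuous with respect to Lebesgue measure with density in $L^p(\Omega)$. *)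

(* Defs.v *)
From HB Require Import structures.
From mathcomp Require Import all_boot all_order all_algebra.
From mathcomp Require Import all_classical all_reals all_analysis.
From mathcomp Require Import measurable_realfun.

Set Implicit Arguments.
Unset Strict Implicit.
Unset Printing Implicit Defensive.
Import Order.TTheory GRing.Theory Num.Theory.
Import numFieldNormedType.Exports.

Local Open Scope classical_set_scope.
Local Open Scope ring_scope.

(* The library topology of ['rV[R]_n] comes from the max norm, so the Borel
   sets are the usual ones; Euclidean lengths use [enorm] below. *)
Section borel_rV.
Context {R : realType} {n : nat}.

Let rV0 : (<<s @open 'rV[R]_n >>) set0.
Proof. exact: sigma_algebra0. Qed.

Let rVC (A : set 'rV[R]_n) : (<<s open >>) A -> (<<s open >>) (~` A).
Proof. exact: sigma_algebraC. Qed.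

Let rVU (F : (set 'rV[R]_n)^nat) :
  (forall i, (<<s open >>) (F i)) -> (<<s open >>) (\bigcup_i F i).
Proof. exact: sigma_algebra_bigcup. Qed.

HB.instance Definition _ := @isMeasurable.Build (sigma_display (@open 'rV[R]_n))
  'rV[R]_n (<<s open >>) rV0 rVC rVU.

End borel_rV.

Section borel_rV_theory.
Context {R : realType} {n : nat}.
Implicit Types U : set 'rV[R]_n.

Lemma open_measurable_rV U : open U -> measurable U.
Proof. exact: sub_sigma_algebra. Qed.

Lemma measurable_coord_rV (i : 'I_n) :
  measurable_fun setT (fun v : 'rV[R]_n => v ord0 i).
Proof.
apply: (measurability _ (RGenOInfty.measurableE R)).
move=> _ [_ [a ->] <-]; rewrite setTI; apply: open_measurable_rV.
apply: open_comp; last exact: interval_open.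
by move=> v _; exact: coord_continuous.
Qed.

Definition rat_box (qk : 'rV[rat]_n * nat) : set 'rV[R]_n :=
  [set v | forall i, ball (ratr (qk.1 ord0 i) : R) qk.2.+1%:R^-1 (v ord0 i)].

Lemma open_bigcup_rat_box U : open U ->
  U = \bigcup_(qk in [set qk | rat_box qk `<=` U]) rat_box qk.
Proof.
move=> oU; apply/seteqP; split=> [v Uv|v [qk /= + vqk]]; last exact.
have /nbhs_ballP[e /= e0 ev] : nbhs v U by exact: open_nbhs_nbhs.
have [k ke] : exists k : nat, k.+1%:R^-1 + k.+1%:R^-1 < e.
  have [k /= _ hk] := near_infty_natSinv_lt (PosNum (divr_gt0 e0 (ltr0Sn _ 1))).
  exists k; have := hk k (leqnn k); rewrite /= => h.
  by rewrite [ltRHS]splitr ltrD.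
have k0 : (0 : R) < k.+1%:R^-1 by rewrite invr_gt0.
have /choice[q qv] : forall i : 'I_n, exists q : rat,
    ball (v ord0 i) k.+1%:R^-1 (ratr q : R).
  move=> i.
  have bi0 : ball (v ord0 i) k.+1%:R^-1 !=set0.
    by exists (v ord0 i); exact: ballxx.
  have [y [/= hb [q _ qE]]] := dense_rat bi0 (ball_open _ _).
  exists q; rewrite qE; exact: hb.
exists (\row_i q i, k) => [w /= wqk|i /=]; last by rewrite mxE; exact/ball_sym.
apply: ev; split=> // i j; rewrite ord1 {i}.
apply: le_ball (ltW ke) _ _; apply: ball_triangle (qv j) _.
by have := wqk j; rewrite mxE.
Qed.

End borel_rV_theory.

Lemma measurable_fun_rVP (R : realType) n d (T : measurableType d)
    (f : T -> 'rV[R]_n) :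
  (forall i, measurable_fun setT (fun t => f t ord0 i)) -> measurable_fun setT f.
Proof.
move=> mf; apply: (measurability (@open 'rV[R]_n)) => //.
move=> _ [U oU <-]; rewrite setTI (open_bigcup_rat_box oU) preimage_bigcup.
rewrite bigcup_mkcond; apply: countable_bigcupT_measurable => [|[q k]].
  exact: countableP.
case: ifP => // _.
have -> : f @^-1` rat_box (q, k) =
    \bigcap_(i in [set: 'I_n])
      ((fun t => f t ord0 i) @^-1` ball (ratr (q ord0 i) : R) k.+1%:R^-1).
  by apply/seteqP; split=> t /= h i; [move=> _|]; exact: h.
apply: fin_bigcap_measurable => // i _; rewrite -[X in measurable X]setTI.
by apply: mf => //; exact: measurable_ball.
Qed.


Section lebesgue_rV.
Context {R : realType}.

Definition consrv n (xv : R * 'rV[R]_n) : 'rV[R]_n.+1 := row_mx xv.1%:M xv.2.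

Definition unconsrv n (v : 'rV[R]_n.+1) : R * 'rV[R]_n :=
  (v ord0 ord0, \row_i v ord0 (lift ord0 i)).

Lemma consrv0 n (xv : R * 'rV[R]_n) : consrv xv ord0 ord0 = xv.1.
Proof.
rewrite /consrv mxE; case: splitP => [j _|j //].
by rewrite !ord1 mxE eqxx mulr1n.
Qed.

Lemma consrv_lift n (xv : R * 'rV[R]_n) i :
  consrv xv ord0 (lift ord0 i) = xv.2 ord0 i.
Proof.
rewrite /consrv mxE; case: splitP => [[[]]//|j].
by rewrite lift0 add1n => -[] /ord_inj ->.
Qed.

Lemma consrvK n : cancel (@consrv n) (@unconsrv n).
Proof.
move=> [x v]; rewrite /unconsrv consrv0; congr pair.
by apply/rowP => i; rewrite mxE consrv_lift.
Qed.

Lemma measurable_consrv n : measurable_fun setT (@consrv n).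
Proof.
apply: measurable_fun_rVP => i; case: (unliftP ord0 i) => [j|] ->.
  under eq_fun do rewrite consrv_lift.
  exact: (measurableT_comp (measurable_coord_rV j) measurable_snd).
by under eq_fun do rewrite consrv0; exact: measurable_fst.
Qed.

Lemma measurable_unconsrv n : measurable_fun setT (@unconsrv n).
Proof.
apply/measurable_fun_pairP; split; first exact: measurable_coord_rV.
apply: measurable_fun_rVP => i.
have -> : (fun v : 'rV[R]_n.+1 => (snd \o unconsrv (n:=n)) v ord0 i) =
    (fun v => v ord0 (lift ord0 i)).
  by apply/funext => v /=; rewrite mxE.
exact: measurable_coord_rV.
Qed.

Section lebesgue_cons.
Variables (n : nat) (mu : {sigma_finite_measure set 'rV[R]_n -> \bar R}).

Definition lebesgue_cons : set 'rV[R]_n.+1 -> \bar R :=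
  pushforward (lebesgue_measure \x mu)%E (@consrv n).

Let lebesgue_cons0 : lebesgue_cons set0 = 0%E.
Proof. by rewrite /lebesgue_cons /pushforward preimage_set0 measure0. Qed.

Let lebesgue_cons_ge0 A : (0 <= lebesgue_cons A)%E.
Proof. exact: (measure_ge0 (lebesgue_measure \x mu)%E). Qed.

Let lebesgue_cons_sigma_additive : semi_sigma_additive lebesgue_cons.
Proof.
by apply: measure_semi_sigma_additive => //; exact: measurable_consrv.
Qed.

HB.instance Definition _ := isMeasure.Build _ _ _ lebesgue_cons
  lebesgue_cons0 lebesgue_cons_ge0 lebesgue_cons_sigma_additive.

Let lebesgue_cons_sigma_finite : sigma_finite setT lebesgue_cons.
Proof.
have /sigma_finiteP[F [TF ndF Foo]] := sigma_finiteT (@lebesgue_measure R).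
have /sigma_finiteP[G [TG ndG Goo]] := sigma_finiteT mu.
exists (fun k => @unconsrv n @^-1` (F k `*` G k)).
  apply/esym; rewrite -subTset => v _.
  have [k _ Fk] : (\bigcup_i F i) (unconsrv v).1 by rewrite -TF.
  have [l _ Gl] : (\bigcup_i G i) (unconsrv v).2 by rewrite -TG.
  exists (maxn k l) => //; split.
    by move: Fk; apply/subsetPset/ndF/leq_maxl.
  by move: Gl; apply/subsetPset/ndG/leq_maxr.
move=> k; have [mF Fk] := Foo k; have [mG Gk] := Goo k; split.
  rewrite -[X in measurable X]setTI; apply: measurable_unconsrv => //.
  exact: measurableX.
rewrite /lebesgue_cons /pushforward -comp_preimage.
rewrite (_ : _ \o _ = id); last by apply/funext => x; exact: consrvK.
by rewrite preimage_id product_measure1E// lte_mul_pinfty// ge0_fin_numE.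
Qed.

HB.instance Definition _ := Measure_isSigmaFinite.Build _ _ _ lebesgue_cons
  lebesgue_cons_sigma_finite.

End lebesgue_cons.

Fixpoint lebesgue_rV n : {sigma_finite_measure set 'rV[R]_n -> \bar R} :=
  match n with
  | 0 => [the {sigma_finite_measure set 'rV[R]_0 -> \bar R} of \d_(0 : 'rV[R]_0)]
  | n.+1 => [the {sigma_finite_measure set 'rV[R]_n.+1 -> \bar R} of
             lebesgue_cons (lebesgue_rV n)]
  end.

Lemma lebesgue_rV_box n (A : 'I_n -> set R) : (forall i, measurable (A i)) ->
  lebesgue_rV n [set v | forall i, A i (v ord0 i)] =
  (\prod_(i < n) lebesgue_measure (A i))%E.
Proof.
elim: n A => [A _|n IHn A mA] /=.
  rewrite big_ord0 diracE (_ : _ \in _ = true)//; apply/mem_set => /= -[]//.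
rewrite /lebesgue_cons /pushforward big_ord_recl.
set B := [set v : 'rV[R]_n | forall i, A (lift ord0 i) (v ord0 i)].
rewrite (_ : _ @^-1` _ = A ord0 `*` B); last first.
  apply/seteqP; split=> [xv /= h|xv /= [h0 hB] i].
    split=> [|i]; first by have := h ord0; rewrite consrv0.
    by have := h (lift ord0 i); rewrite consrv_lift.
  by case: (unliftP ord0 i) => [j|] ->; rewrite ?consrv_lift ?consrv0.
have mB : measurable B.
  have -> : B = \bigcap_(i in [set: 'I_n])
      ((fun v : 'rV[R]_n => v ord0 i) @^-1` A (lift ord0 i)).
    by apply/seteqP; split=> t /= h i; [move=> _|]; exact: h.
  apply: fin_bigcap_measurable => // i _; rewrite -[X in measurable X]setTI.
  exact: measurable_coord_rV.
transitivity (lebesgue_measure (A ord0) * lebesgue_rV n B)%E; last first.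
  by congr (_ * _)%E; exact: IHn.
by apply: product_measure1E => //; exact: mA.
Qed.

End lebesgue_rV.

Section geometry.
Context {R : realType} {d : nat}.
Implicit Types (A Omega : set 'rV[R]_d) (b x : 'rV[R]_d).

Definition enorm x : R := Num.sqrt (\sum_(i < d) x ord0 i ^+ 2).

Definition eball b (r : R) : set 'rV[R]_d := [set x | enorm (x - b) < r].

Definition boundary A : set 'rV[R]_d := closure A `\` interior A.

Definition domain Omega := [/\ open Omega, connected Omega & Omega !=set0].

Definition round_polyhedron (r : R) Omega :=
  [/\ domain Omega, bounded_set Omega &
    exists (m : nat) (b : 'I_m -> 'rV[R]_d),
      [/\ injective b,
          forall i, eball (b i) r `&` Omega = set0 &
          boundary Omega =
            \bigcup_(i in [set: 'I_m])
              (boundary Omega `&` boundary (eball (b i) r))]].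

End geometry.

Section regularity.
Context {R : realType} {d : nat}.
Implicit Types (Omega : set 'rV[R]_d) (g : 'rV[R]_d -> R).

Definition elipschitz_on (lambda : R) Omega g :=
  forall x y, Omega x -> Omega y -> `|g x - g y| <= lambda * enorm (x - y).

Definition partial (i : 'I_d) g : 'rV[R]_d -> R := 'D_(delta_mx ord0 i) g.

Definition has_partial (i : 'I_d) Omega g :=
  forall x, Omega x -> derivable g x (delta_mx ord0 i).

Definition extends_to_closure Omega (h : 'rV[R]_d -> R) :=
  exists2 k : 'rV[R]_d -> R,
    {within closure Omega, continuous k} & forall x, Omega x -> k x = h x.

(* The convention for C^2 up to the boundary is that derivatives of order at
   most 2 in the open set extend continuously to the closure; no extension of
   [g] itself to a neighbourhood of the closure is required. *)
Definition C2_closure Omega g :=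
  [/\ {within closure Omega, continuous g},
      forall i, has_partial i Omega g /\ extends_to_closure Omega (partial i g) &
      forall i j, has_partial j Omega (partial i g) /\
        extends_to_closure Omega (partial j (partial i g))].

End regularity.

Section transport.
Context {R : realType} {d : nat}.
Implicit Types (Omega : set 'rV[R]_d) (f g : 'rV[R]_d -> R)
  (T : 'rV[R]_d -> 'rV[R]_d) (sigma : {measure set 'rV[R]_d -> \bar R}).

Local Notation leb := (lebesgue_rV (R := R) d).

Definition Lp_on (p : \bar R) Omega f := f \_ Omega \in Lfun leb p.

Definition argmin_boundary Omega g x : set 'rV[R]_d :=
  [set y | boundary Omega y /\ forall z, boundary Omega z ->
     enorm (x - y) + g y <= enorm (x - z) + g z].

Definition borel_selector Omega g T :=
  measurable_fun (closure Omega) T /\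
  forall x, closure Omega x -> argmin_boundary Omega g x (T x).

(* A measure on [closure Omega] is encoded as a measure on the whole space
   that vanishes outside [closure Omega]. For an admissible [T] the segments
   from [x] to [T x] stay in [closure Omega] as soon as [g] is Lipschitz with
   constant less than 1, so [phi] is not evaluated elsewhere. *)
Definition transport_density Omega f T sigma :=
  sigma (~` closure Omega) = 0%E /\
  forall phi : 'rV[R]_d -> R, {within closure Omega, continuous phi} ->
    (\int[sigma]_(x in closure Omega) (phi x)%:E =
     \int[leb]_(x in Omega) \int[lebesgue_measure]_(t in `[0%R, 1%R])
       (enorm (x - T x) * phi ((1 - t) *: x + t *: T x) * f x)%:E)%E.

Definition has_density_Lp (p : \bar R) Omega sigma :=
  exists h : 'rV[R]_d -> R,
    [/\ Lp_on p Omega h, forall x, 0 <= h x &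
        forall A, measurable A ->
          sigma A = (\int[leb]_(x in A `&` Omega) (h x)%:E)%E].

End transport.

(* Main.v *)
(** Let [u x] be the minimum of [|x - y| + g y] over the boundary, [e x] the unit
    vector from [T x] to [x], and [s x = |x - T x|]. The segment from [T x] to [x]
    stays in [Omega] and meets the boundary at an angle bounded below, because
    [lambda < 1]; for the same reason [T x] never lies on two of the spheres. Since
    near [T x] the boundary is then a sphere of radius [r] lying on the outside and
    [g] is of class C^2, moving the minimizing segment along that sphere shows that
    [u] is semiconcave on [Omega], with a constant not depending on the distance to
    the boundary. Hence [(e x - e x') . (x - x') <= 2 C |x - x'|^2], and the flow
    [S_h x = x - h (e x)] satisfies [|S_h x - S_h x'|^2 >= |x - x'|^2 / 2] for small
    [h], locally in [x]. Testing on small cubes, the set of [x] with [h < s x] and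
    [S_h x] in [A] has measure at most [K |A|]; this iterates to every [h] because
    [T (S_h x) = T x].

    By Fubini the density transported from the weight 1 is bounded by a constant
    [C]. The cases [p < +oo] follow without interpolation: [f <= a + a^(1-p) f^p]
    for all [a > 0], so the densities satisfy [sigma_f <= a C + a^(1-p) sigma_(f^p)],
    and optimizing in [a] bounds [sigma_f^p] by a multiple of the integrable
    function [sigma_(f^p)]. *)
Require Import Defs.
From HB Require Import structures.
From mathcomp Require Import all_boot all_order all_algebra.
From mathcomp Require Import all_classical all_reals all_analysis.
From mathcomp Require Import measurable_realfun.
From mathcomp Require Import ring lra.
Import Order.TTheory GRing.Theory Num.Theory.
Import numFieldNormedType.Exports.

Set Implicit Arguments.
Unset Strict Implicit.
Unset Printing Implicit Defensive.
Local Open Scope classical_set_scope.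
Local Open Scope ring_scope.

(** * Euclidean inner product and norm *)

Section euclidean.
Context {R : realType} {d : nat}.
Implicit Types (x y z v : 'rV[R]_d) (a : R).

(** The constants must survive as [x] approaches the boundary, although the distance to a point has
    second derivatives of order [1 / s x]. Two choices keep this factor out. For semiconcavity the
    endpoint moves with [x], so that both competing segments stay parallel to [e x] and their
    lengths carry no quadratic remainder. For the linear upper bound on [u], the competitor [T x] is
    used only at a time at most [s x], where the remainder is absorbed. The radius in which second
    differences are tested may depend on [x]: arbitrarily small scales already determine the
    constant on a whole segment. The flow is not shown to be differentiable, so there is no
    Jacobian; expansion alone puts the preimage of a small cube into a cube of comparable side. The
    dimensional factor lost at each step is harmless because the number of steps is bounded.
    Expansion is known only for pairs whose segment lies in [Omega], hence a decomposition into
    countably many convex boxes. Finally [sigma] is given only by its integrals of continuous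
    functions, so it is first compared with an explicit kernel on open sets. *)

Definition dot x y : R := \sum_(i < d) x ord0 i * y ord0 i.

Lemma dotC x y : dot x y = dot y x.
Proof. by apply: eq_bigr => i _; rewrite mulrC. Qed.

Lemma dotDl x y z : dot (x + y) z = dot x z + dot y z.
Proof. by rewrite /dot -big_split; apply: eq_bigr => i _; rewrite mxE mulrDl. Qed.

Lemma dotZl a x y : dot (a *: x) y = a * dot x y.
Proof. by rewrite /dot mulr_sumr; apply: eq_bigr => i _; rewrite mxE mulrA. Qed.

Lemma dotNl x y : dot (- x) y = - dot x y.
Proof. by rewrite -scaleN1r dotZl mulN1r. Qed.

Lemma dotDr x y z : dot x (y + z) = dot x y + dot x z.
Proof. by rewrite dotC dotDl !(dotC x). Qed.

Lemma dotZr a x y : dot x (a *: y) = a * dot x y.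
Proof. by rewrite dotC dotZl dotC. Qed.

Lemma dotNr x y : dot x (- y) = - dot x y.
Proof. by rewrite dotC dotNl dotC. Qed.

Definition dotE := (dotDl, dotDr, dotNl, dotNr, dotZl, dotZr).

Lemma enorm_ge0 x : 0 <= enorm x.
Proof. exact: sqrtr_ge0. Qed.

Lemma sqr_enorm x : enorm x ^+ 2 = dot x x.
Proof.
rewrite /enorm sqr_sqrtr; first by apply: eq_bigr => i _; rewrite expr2.
by apply: sumr_ge0 => i _; rewrite sqr_ge0.
Qed.

Lemma enorm_eq0 x : (enorm x == 0) = (x == 0).
Proof.
apply/eqP/eqP => [x0|->].
  have : \sum_(i < d) x ord0 i * x ord0 i = 0 by rewrite -/(dot x x) -sqr_enorm x0 expr0n.
  move/eqP; rewrite psumr_eq0 => [/allP h|i _]; last by rewrite -expr2 sqr_ge0.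
  apply/rowP => i; rewrite mxE; have := h i; rewrite mem_index_enum => /(_ isT).
  by rewrite mulf_eq0 orbb => /eqP.
by rewrite /enorm big1 ?sqrtr0// => i _; rewrite mxE expr0n.
Qed.

Lemma enorm0 : enorm (0 : 'rV[R]_d) = 0.
Proof. by apply/eqP; rewrite enorm_eq0. Qed.

Lemma enorm_gt0 x : (0 < enorm x) = (x != 0).
Proof. by rewrite lt_def enorm_ge0 enorm_eq0 andbT. Qed.

Lemma enormZ a x : enorm (a *: x) = `|a| * enorm x.
Proof.
apply/eqP; rewrite -(eqrXn2 (n:=2))// ?mulr_ge0 ?enorm_ge0//.
by rewrite exprMn !sqr_enorm !dotE real_normK ?num_real// expr2 mulrA.
Qed.

Lemma enormN x : enorm (- x) = enorm x.
Proof. by rewrite -scaleN1r enormZ normrN normr1 mul1r. Qed.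

Lemma enormB x y : enorm (x - y) = enorm (y - x).
Proof. by rewrite -enormN opprB. Qed.

(** Cauchy-Schwarz, by expanding the square of the norm of [|y| x - |x| y]. *)
Lemma dot_le x y : dot x y <= enorm x * enorm y.
Proof.
have [->|x0] := eqVneq x 0.
  by rewrite enorm0 mul0r /dot big1// => i _; rewrite mxE mul0r.
have [->|y0] := eqVneq y 0.
  by rewrite enorm0 mulr0 /dot big1// => i _; rewrite mxE mulr0.
move: x0 y0; rewrite -!enorm_gt0 => x0 y0.
have := enorm_ge0 (enorm y *: x - enorm x *: y); move=> /(exprn_ge0 2).
rewrite sqr_enorm !dotE -!sqr_enorm (dotC y x).
set a := enorm x; set b := enorm y.
rewrite [leRHS](_ : _ = (2 * (a * b)) * (a * b - dot x y)); last by rewrite /a /b; ring.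
by rewrite pmulr_rge0 ?subr_ge0// !mulr_gt0.
Qed.

Lemma enormD x y : enorm (x + y) <= enorm x + enorm y.
Proof.
rewrite -ler_sqr ?nnegrE ?addr_ge0 ?enorm_ge0// sqrrD !sqr_enorm !dotE (dotC y x).
have := dot_le x y; lra.
Qed.

Lemma enormDB x y z : enorm (x - z) <= enorm (x - y) + enorm (y - z).
Proof. by rewrite -[x - z](subrKA y) enormD. Qed.

(* AM-GM applied to [|x + v|] and [|x|]. *)
Lemma enormD_le_quad x v : x != 0 ->
  enorm (x + v) <= enorm x + dot x v / enorm x + enorm v ^+ 2 / (2 * enorm x).
Proof.
rewrite -enorm_gt0 => x0.
rewrite -(ler_pM2l (x := 2 * enorm x)) ?mulr_gt0//.
have -> : 2 * enorm x * (enorm x + dot x v / enorm x + enorm v ^+ 2 / (2 * enorm x)) =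
   2 * enorm x ^+ 2 + 2 * dot x v + enorm v ^+ 2 by field; rewrite gt_eqF.
have := sqr_ge0 (enorm (x + v) - enorm x); rewrite sqrrB !sqr_enorm !dotE (dotC v x).
lra.
Qed.

Lemma coord_le_enorm x i : `|x ord0 i| <= enorm x.
Proof.
rewrite -ler_sqr ?nnegrE ?enorm_ge0// real_normK ?num_real// sqr_enorm /dot (bigD1 i)//=.
by rewrite expr2 lerDl sumr_ge0// => j _; rewrite -expr2 sqr_ge0.
Qed.

Lemma norm_le_enorm x : `|x| <= enorm x.
Proof.
rewrite (_ : `|x| = mx_norm x)// mx_normrE.
apply/bigmax_leP; split=> [|[i j] _ /=]; first exact: enorm_ge0.
by rewrite ord1 coord_le_enorm.
Qed.

Lemma enorm_le_coords x a :
  0 <= a -> (forall i, `|x ord0 i| <= a) -> enorm x <= d%:R * a.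
Proof.
move=> a0 xa.
have [d0|d0] := posnP d.
  rewrite (_ : x = 0) ?enorm0 ?mulr_ge0//; apply/rowP => i.
  by have := ltn_ord i; rewrite {2}d0.
rewrite -ler_sqr ?nnegrE ?enorm_ge0 ?mulr_ge0// sqr_enorm /dot exprMn.
apply: (@le_trans _ _ (\sum_(i < d) a ^+ 2)).
  apply: ler_sum => i _; rewrite -expr2 -(real_normK (num_real _)).
  by rewrite ler_sqr ?nnegrE.
rewrite sumr_const card_ord -[_ *+ _]mulr_natl; apply: ler_wpM2r; first exact: sqr_ge0.
by rewrite expr2 ler_peMl ?ler1n.
Qed.

Lemma coord_le_norm x i : `|x ord0 i| <= `|x|.
Proof.
rewrite (_ : `|x| = mx_norm x)// mx_normrE.
by apply: (le_bigmax _ (fun p => `|x p.1 p.2|) (ord0, i)).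
Qed.

Lemma enorm_le_norm x : enorm x <= d%:R * `|x|.
Proof. by apply: enorm_le_coords => // i; exact: coord_le_norm. Qed.

(** The topology is that of the max norm, and [enorm] is at most [d] times this norm. *)
Lemma lipschitz_enorm_continuous (f : 'rV[R]_d -> R) (L : R) :
  (forall x y, `|f x - f y| <= L * enorm (x - y)) -> continuous f.
Proof.
move=> fL x; have L0 : 0 < `|L| * d%:R + 1 by rewrite ltr_wpDl ?mulr_ge0.
move=> P /nbhs_ballP[e /= e0 eP]; apply/nbhs_ballP; exists (e / (`|L| * d%:R + 1)).
  by rewrite /= divr_gt0.
move=> y xy; apply: eP; move: xy; rewrite -!ball_normE /= ltr_pdivlMr// => xy.
apply: le_lt_trans (fL _ _) _; apply: le_lt_trans xy.
apply: (@le_trans _ _ (`|L| * (d%:R * `|x - y|))).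
  apply: (@le_trans _ _ (`|L| * enorm (x - y))); first by rewrite ler_wpM2r ?enorm_ge0// ler_norm.
  by rewrite ler_wpM2l// enorm_le_norm.
by rewrite mulrA mulrC ler_wpM2l// lerDl.
Qed.

Lemma enorm_lipschitz x y : `|enorm x - enorm y| <= enorm (x - y).
Proof.
have := enormD (x - y) y; have := enormD (y - x) x; rewrite !subrK (enormB y) ler_norml.
by move=> h1 h2; apply/andP; split; lra.
Qed.

Lemma open_enorm_ball x (U : set 'rV[R]_d) : open U -> U x ->
  exists2 e : R, 0 < e & forall y, enorm (y - x) < e -> U y.
Proof.
move=> oU Ux; have /nbhs_ballP[e /= e0 eU] : nbhs x U by exact: open_nbhs_nbhs.
exists e => // y xy; apply: eU; rewrite -ball_normE /=.
by apply: le_lt_trans xy; rewrite distrC norm_le_enorm.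
Qed.

End euclidean.

(* Otherwise the difference with the parabola would have an interior minimum,
   against the strict bound on its second differences. *)
Lemma midpoint_semiconcave (R : realType) (phi : R -> R) (L C : R) :
  (forall s t, s \in `[0, 1] -> t \in `[0, 1] -> `|phi s - phi t| <= L * `|s - t|) ->
  (forall t, 0 < t < 1 -> exists2 eta, 0 < eta &
     forall h, 0 < h < eta -> phi (t + h) + phi (t - h) - 2 * phi t < 2 * C * h ^+ 2) ->
  forall t, t \in `[0, 1] -> (1 - t) * phi 0 + t * phi 1 - C * (t * (1 - t)) <= phi t.
Proof.
move=> phiL mid.
(* [psi] vanishes at both ends, and [C t (1 - t)] has second differences [- 2 C h^2], so those of
   [psi] at an interior point are negative for small [h]. *)
pose psi t := phi t - ((1 - t) * phi 0 + t * phi 1) + C * (t * (1 - t)).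
have cphi : {within `[0, 1], continuous phi}.
  apply/subspace_continuousP => x x01; apply/cvgrPdist_le => e e0.
  have L1 : 0 < `|L| + 1 by rewrite ltr_wpDl.
  near=> y.
  have y01 : y \in `[0, 1] by near: y; apply: withinT; exact: filter_nbhs.
  apply: le_trans (phiL _ _ x01 y01) _.
  have : `|x - y| <= e / (`|L| + 1).
    by near: y; apply: cvg_within; apply: filterS (nbhsx_ballx x (e / (`|L| + 1)) _) => [z|];
    [rewrite -ball_normE /= => /ltW|rewrite divr_gt0].
  rewrite ler_pdivlMr// mulrC => h; apply: le_trans h; rewrite ler_wpM2r//.
  by rewrite ler_wpDr// ler_norm.
have cpsi : {within `[0, 1], continuous psi}.
  move=> x; apply: cvgD; first (apply: cvgB; first exact: cphi).
    apply: (continuous_subspaceT (f := fun t : R => (1 - t) * phi 0 + t * phi 1)) => y.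
    apply: cvgD; apply: cvgMl; last exact: cvg_id.
    by apply: cvgB; [exact: cvg_cst|exact: cvg_id].
  apply: (continuous_subspaceT (f := fun t : R => C * (t * (1 - t)))) => y.
  apply: cvgMr; apply: cvgM; first exact: cvg_id.
  by apply: cvgB; [exact: cvg_cst|exact: cvg_id].
have [c c01 cmin] := EVT_min (@ler01 R) cpsi.
have psi0 : psi 0 = 0 by rewrite /psi; lra.
have psi1 : psi 1 = 0 by rewrite /psi; lra.
have [cE|[cE|c_int]] : c = 0 \/ c = 1 \/ 0 < c < 1.
- move: c01; rewrite in_itv /= => /andP[]; rewrite le_eqVlt => /orP[/eqP ->|c0]; first by left.
  rewrite le_eqVlt => /orP[/eqP ->|c1]; first by right; left.
  by right; right; rewrite c0.
- by move=> t /cmin; rewrite cE psi0 /psi; lra.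
- by move=> t /cmin; rewrite cE psi1 /psi; lra.
have [eta eta0 heta] := mid c c_int.
move: c_int => /andP[c0 c1].
have [h [h0 he hc hc1]] : exists h : R, [/\ 0 < h, h < eta, h <= c & h <= 1 - c].
  exists (Num.min (eta / 2) (Num.min c (1 - c))).
  rewrite !lt_min !ge_min !lexx !orbT subr_gt0 c0 c1 divr_gt0// gt_min.
  by split=> //; apply/orP; left; lra.
have := heta h; rewrite h0 he => /(_ isT).
have : psi c <= psi (c + h) by apply: cmin; rewrite in_itv /=; apply/andP; split; lra.
have : psi c <= psi (c - h) by apply: cmin; rewrite in_itv /=; apply/andP; split; lra.
rewrite /psi => h1 h2 h3; exfalso.
have : 2 * C * h ^+ 2 = 2 * (C * (c * (1 - c))) - C * ((c + h) * (1 - (c + h)))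
   - C * ((c - h) * (1 - (c - h))) by ring.
lra.
Unshelve. all: by end_near.
Qed.

(** * Second-order bounds on [g] along segments *)

Section C2.
Context {R : realType} {d : nat}.
Implicit Types (f g : 'rV[R]_d -> R) (x z w v : 'rV[R]_d) (Omega : set 'rV[R]_d).

Lemma is_derive_line f w v (t : R) :
  derivable f (w + t *: v) v ->
  is_derive t 1 (fun s : R => f (w + s *: v)) ('D_v f (w + t *: v)).
Proof.
have eqf : (fun h : R => h^-1 *: (f (w + (h *: 1 + t) *: v) - f (w + t *: v))) =
   (fun h : R => h^-1 *: (f (h *: v + (w + t *: v)) - f (w + t *: v))).
  apply/funext => h; congr (_ *: (f _ - _)).
  by rewrite scalerDl (addrCA w) /GRing.scale /= mulr1.
move=> fd; split; first by rewrite /derivable eqf.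
by rewrite /derive eqf.
Qed.

Lemma mvt_line_segment f w v (a b : R) : a <= b ->
  (forall t, a <= t <= b -> derivable f (w + t *: v) v) ->
  exists2 c, a <= c <= b &
    f (w + b *: v) - f (w + a *: v) = 'D_v f (w + c *: v) * (b - a).
Proof.
move=> ab fd.
have fis t : t \in `[a, b] -> is_derive t 1 (fun s : R => f (w + s *: v)) ('D_v f (w + t *: v)).
  by move=> tab; apply: is_derive_line; apply: fd.
have [c cab cE] := @MVT_segment R (fun s : R => f (w + s *: v))
  (fun t => 'D_v f (w + t *: v)) a b ab (fun t tab => fis t (subset_itv_oo_cc tab))
  (derivable_within_continuous (fun t tab => @ex_derive _ _ _ _ _ _ _ (fis t tab))).
by exists c.
Qed.

(** The two conditions on [t] say that it lies between 0 and [a], whatever the sign of [a]. *)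
Lemma mvt_line f w v (a : R) :
  (forall t, `|t| <= `|a| -> 0 <= t * a -> derivable f (w + t *: v) v) ->
  exists c, [/\ `|c| <= `|a|, 0 <= c * a &
    f (w + a *: v) - f w = a * 'D_v f (w + c *: v)].
Proof.
move=> fd; have [a0|a0] := leP 0 a.
  have [t /andP[t0 ta]|c /andP[c0 ca] cE] := @mvt_line_segment f w v 0 a a0.
    by apply: fd; rewrite ?mulr_ge0// !ger0_norm.
  exists c; split; rewrite ?mulr_ge0// ?ger0_norm//.
  by rewrite scale0r addr0 subr0 in cE; rewrite cE mulrC.
have [t /andP[ta t0]|c /andP[ca c0] cE] := @mvt_line_segment f w v a 0 (ltW a0).
  apply: fd; first by rewrite !ler0_norm ?(ltW a0)// lerN2.
  by rewrite mulr_le0 // ltW.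
exists c; split; first by rewrite !ler0_norm ?(ltW a0)// lerN2.
  by rewrite mulr_le0 // ltW.
by rewrite scale0r addr0 sub0r in cE; rewrite -opprB cE; ring.
Qed.

Definition cbox x (rho : R) : set 'rV[R]_d :=
  [set z | forall i, `|z ord0 i - x ord0 i| <= rho].

(** The path from [z] to [z'] changes one coordinate at a time. It stays in the box and calls only
    for derivatives along the axes. *)
Lemma cbox_mvt f x (rho : R) :
  (forall z i, cbox x rho z -> derivable f z (delta_mx ord0 i)) ->
  forall z z', cbox x rho z -> cbox x rho z' ->
  exists2 xi : 'I_d -> 'rV[R]_d, (forall k, cbox x rho (xi k)) &
    f z' - f z = \sum_(k < d) (z' ord0 k - z ord0 k) * partial k f (xi k).
Proof.
move=> fd z z' xz xz'.
pose w k : 'rV[R]_d := \row_i (if (i < k)%N then z' ord0 i else z ord0 i).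
have wS (k : 'I_d) : w k.+1 = w k + (z' ord0 k - z ord0 k) *: delta_mx ord0 k.
  apply/rowP => i; rewrite !mxE eqxx /= ltnS leq_eqVlt -val_eqE /=.
  have [ik|ik|/val_inj ->] := ltngtP i k; rewrite ?mulr0 ?addr0//.
  by rewrite mulr1 addrC subrK.
have step (k : 'I_d) : exists xi, cbox x rho xi /\
    f (w k.+1) - f (w k) = (z' ord0 k - z ord0 k) * partial k f xi.
  rewrite wS; set a := z' ord0 k - z ord0 k.
  have inb t : `|t| <= `|a| -> 0 <= t * a -> cbox x rho (w k + t *: delta_mx ord0 k).
    move=> ta ta0 i; rewrite !mxE eqxx /=.
    have [->|ik] := eqVneq i k; last first.
      by rewrite mulr0 addr0; case: ifP => _; [exact: xz'|exact: xz].
    rewrite ltnn mulr1; have := xz k; have := xz' k.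
    rewrite !ler_norml => /andP[h1 h2] /andP[h3 h4].
    have [a0|a0] := leP 0 a.
      have t0 : 0 <= t.
        move: a0; rewrite le_eqVlt => /orP[/eqP a0|a0]; last by rewrite -(pmulr_lge0 _ a0).
        by move: ta; rewrite -a0 normr0 normr_le0 => /eqP ->.
      rewrite !ger0_norm// in ta; apply/andP; split; rewrite /a in ta; lra.
    have t0 : t <= 0 by rewrite -(nmulr_lge0 _ a0).
    rewrite !ler0_norm ?(ltW a0)// in ta; apply/andP; split; rewrite /a in ta; lra.
  have [t ta ta0|c [ca ca0 cE]] := @mvt_line f (w k) (delta_mx ord0 k) a.
    by apply: fd; apply: inb.
  by exists (w k + c *: delta_mx ord0 k); split; [exact: inb|].
have [xi xiP] := choice step.
exists xi => [k|]; first by have [] := xiP k.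
under eq_bigr => k _ do rewrite -(proj2 (xiP k)).
rewrite -(big_mkord xpredT (fun k => f (w k.+1) - f (w k))) telescope_sumr//.
by congr (f _ - f _); apply/rowP => i; rewrite mxE ?ltn_ord.
Qed.

Lemma cbox_lipschitz f x (rho M delta : R) : 0 <= M ->
  (forall z i, cbox x rho z -> derivable f z (delta_mx ord0 i)) ->
  (forall z i, cbox x rho z -> `|partial i f z| <= M) ->
  forall z z', cbox x rho z -> cbox x rho z' ->
  (forall i, `|z' ord0 i - z ord0 i| <= delta) -> `|f z' - f z| <= d%:R * (delta * M).
Proof.
move=> M0 fd fM z z' xz xz' zz'; have [xi xix ->] := cbox_mvt fd xz xz'.
apply: le_trans (ler_norm_sum _ _ _) _.
apply: (@le_trans _ _ (\sum_(k < d) delta * M)).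
  by apply: ler_sum => k _; rewrite normrM ler_pM// fM.
by rewrite sumr_const card_ord -[_ *+ _]mulr_natl.
Qed.

(** The increments from [x - h] to [x] and from [x] to [x + h] have the same coefficients [h_k]. The
    first derivatives they involve are taken at points whose coordinates differ by at most [2 |h|],
    hence differ by at most [2 d |h| M]; summing over [k] gives the second factor [d]. *)
Lemma second_difference_le Omega g (M : R) : 0 <= M -> open Omega ->
  (forall i, has_partial i Omega g) ->
  (forall i j, has_partial j Omega (partial i g)) ->
  (forall i j z, Omega z -> `|partial j (partial i g) z| <= M) ->
  forall x, Omega x -> exists2 eta, 0 < eta & forall h, enorm h < eta ->
    g (x + h) + g (x - h) - 2 * g x <= 2 * d%:R ^+ 2 * M * enorm h ^+ 2.
Proof.
move=> M0 oO g1 g2 gM x Ox.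
have [e e0 eO] := open_enorm_ball oO Ox.
have d1 : 0 < d%:R + 1 :> R by rewrite ltr_wpDl.
(* A box of half-side [|h|] lies in the Euclidean ball of radius [d |h|]. *)
exists (e / (d%:R + 1)) => [|h]; first by rewrite divr_gt0.
rewrite ltr_pdivlMr// mulrC => he.
have boxO z : cbox x (enorm h) z -> Omega z.
  move=> xz; apply: eO; apply: le_lt_trans he; apply: le_trans (enorm_le_coords (enorm_ge0 h) _) _.
    by move=> i; have := xz i; rewrite !mxE.
  by rewrite ler_wpM2r ?enorm_ge0// lerDl.
have [xx xp xm] : [/\ cbox x (enorm h) x, cbox x (enorm h) (x + h) & cbox x (enorm h) (x - h)].
  split=> i; rewrite ?mxE ?subrr ?normr0 ?enorm_ge0// [X in `|X - _|]addrC addrK ?normrN;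
    exact: coord_le_enorm.
have gd z i : cbox x (enorm h) z -> derivable g z (delta_mx ord0 i) by move=> /boxO /g1.
have [xi xiP xiE] := cbox_mvt gd xx xp.
have [zeta zetaP zetaE] := cbox_mvt gd xm xx.
rewrite (_ : _ - _ = (g (x + h) - g x) - (g x - g (x - h))); last by ring.
rewrite xiE zetaE -sumrB.
apply: (@le_trans _ _ (\sum_(k < d) enorm h * (d%:R * (2 * enorm h * M)))).
  apply: ler_sum => k _; rewrite !mxE.
  rewrite (_ : _ - _ = h ord0 k * (partial k g (xi k) - partial k g (zeta k))); last by ring.
  apply: le_trans (ler_norm _) _; rewrite normrM ler_pM// ?coord_le_enorm//.
  apply: (@cbox_lipschitz _ x (enorm h)) => // [z i /boxO|z i /boxO /gM//|i]; first exact: g2.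
  have := xiP k i; have := zetaP k i; rewrite !ler_norml => /andP[h1 h2] /andP[h3 h4].
  by apply/andP; split; lra.
by rewrite sumr_const card_ord -[_ *+ _]mulr_natl expr2; lra.
Qed.

Lemma bounded_closure_compact Omega : bounded_set Omega -> compact (closure Omega).
Proof.
move=> [M [_ /(_ (M + 1))]]; rewrite ltrDl ltr01 => /(_ isT) OM.
apply: bounded_closed_compact; last exact: closed_closure.
exists (M + 2); split=> [|N MN x /(_ (ball x 1))]; first exact: num_real.
case=> [|y [/OM /= yM]]; first exact: nbhsx_ballx.
rewrite -ball_normE /= => xy; have := ler_normD (x - y) y; rewrite subrK; lra.
Qed.

Lemma extends_to_closure_bounded Omega (h : 'rV[R]_d -> R) : bounded_set Omega ->
  extends_to_closure Omega h -> exists M : R, forall x, Omega x -> `|h x| <= M.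
Proof.
move=> bO [k kc kh].
have /compact_bounded[M [_ /(_ (M + 1))]] := continuous_compact kc (bounded_closure_compact bO).
rewrite ltrDl ltr01 => /(_ isT) kM.
by exists (M + 1) => x Ox; rewrite -kh//; apply: kM; exists x => //; exact: subset_closure.
Qed.

(** The second derivatives extend continuously to the compact closure, so they are bounded. The
    endpoints may lie on the boundary, where only the Lipschitz bound is at hand; this is why
    [midpoint_semiconcave] asks for second differences at interior times only. *)
Lemma C2_semiconvex Omega g (lam : R) : open Omega -> bounded_set Omega -> C2_closure Omega g ->
  elipschitz_on lam (closure Omega) g ->
  exists2 M, 0 <= M & forall p q, closure Omega p -> closure Omega q ->
    (forall t, 0 < t < 1 -> Omega (p + t *: (q - p))) ->
    forall t, 0 <= t <= 1 ->
    (1 - t) * g p + t * g q <= g (p + t *: (q - p)) + M * enorm (q - p) ^+ 2.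
Proof.
move=> oO bO [_ g1 g2] gL.
have /choice[m mP] (ij : 'I_d * 'I_d) : exists m : R,
    forall z, Omega z -> `|partial ij.2 (partial ij.1 g) z| <= m.
  by apply: extends_to_closure_bounded => //; have [] := g2 ij.1 ij.2.
have [M M0 mM] : exists2 M, 0 <= M & forall i j z, Omega z -> `|partial j (partial i g) z| <= M.
  exists (\sum_ij `|m ij|) => [|i j z Oz]; first exact: sumr_ge0.
  apply: le_trans (mP (i, j) z Oz) _; apply: le_trans (ler_norm _) _.
  by rewrite (bigD1 (i, j))//= lerDl sumr_ge0.
(* The added 1 makes the bound on second differences strict. *)
exists (d%:R ^+ 2 * M + 1) => [|p q cp cq pqO t t01]; first by rewrite addr_ge0// mulr_ge0.
have [<-|pq] := eqVneq p q.
  by rewrite subrr scaler0 addr0 enorm0 expr0n mulr0 addr0; lra.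
rewrite -subr_eq0 -enorm_gt0 enormB in pq.
have segO s : 0 <= s <= 1 -> closure Omega (p + s *: (q - p)).
  move=> /andP[]; rewrite le_eqVlt => /orP[/eqP <- _|s0]; first by rewrite scale0r addr0.
  rewrite le_eqVlt => /orP[/eqP ->|s1]; first by rewrite scale1r addrC subrK.
  by apply: subset_closure; apply: pqO; rewrite s0.
have := @midpoint_semiconcave R (fun s => g (p + s *: (q - p))) (lam * enorm (q - p))
  ((d%:R ^+ 2 * M + 1) * enorm (q - p) ^+ 2).
rewrite /= scale0r addr0 scale1r (addrC p) subrK => semi.
have /semi H : forall s u, s \in `[0, 1] -> u \in `[0, 1] ->
    `|g (p + s *: (q - p)) - g (p + u *: (q - p))| <= lam * enorm (q - p) * `|s - u|.
  move=> s u s01 u01; apply: le_trans (gL _ _ (segO _ s01) (segO _ u01)) _.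
  rewrite opprD addrACA subrr add0r -scalerBl enormZ; lra.
have {}H : (1 - t) * g p + t * g q -
    (d%:R ^+ 2 * M + 1) * enorm (q - p) ^+ 2 * (t * (1 - t)) <= g (p + t *: (q - p)).
  apply: H t01 => s /pqO /(second_difference_le M0 oO _ _ mM)[i|i j|eta eta0 etaP].
  - by have [] := g1 i.
  - by have [] := g2 i j.
  exists (eta / enorm (q - p)) => [|h /andP[h0]]; first by rewrite divr_gt0.
  rewrite ltr_pdivlMr// -{1}(gtr0_norm h0) -enormZ => /etaP.
  rewrite !scalerDl scaleNr !addrA => /le_lt_trans; apply.
  rewrite enormZ exprMn gtr0_norm//.
  have : 0 < h ^+ 2 * enorm (q - p) ^+ 2 by rewrite mulr_gt0// exprn_gt0.
  lra.
suff : (d%:R ^+ 2 * M + 1) * enorm (q - p) ^+ 2 * (t * (1 - t)) <=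
    (d%:R ^+ 2 * M + 1) * enorm (q - p) ^+ 2 * 1 by lra.
rewrite ler_wpM2l ?mulr_ge0 ?addr_ge0 ?mulr_ge0 ?exprn_ge0 ?enorm_ge0//.
by case/andP: t01 => t0 t1; rewrite mulr_ile1//; lra.
Qed.

End C2.

Ltac vec := apply/rowP => ?; rewrite !mxE; ring.

Lemma nbhs_enorm (R : realType) (d : nat) (x : 'rV[R]_d) (B : set 'rV[R]_d) : nbhs x B ->
  exists2 e : R, 0 < e & forall y, enorm (y - x) < e -> B y.
Proof.
move=> /nbhs_ballP[e /= e0 eU]; exists e => // y xy; apply: eU; rewrite -ball_normE /=.
by apply: le_lt_trans xy; rewrite distrC norm_le_enorm.
Qed.

Lemma sqr_enormD (R : realType) (d : nat) (x y : 'rV[R]_d) :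
  enorm (x + y) ^+ 2 = enorm x ^+ 2 + 2 * dot x y + enorm y ^+ 2.
Proof. by rewrite !sqr_enorm !dotE (dotC y x); ring. Qed.

(** * Geometry of the minimizing segments *)

Section rays.
Context {R : realType} {d : nat}.
Variables (Omega : set 'rV[R]_d) (g : 'rV[R]_d -> R) (lam : R).
Hypotheses (oO : open Omega) (lam0 : 0 <= lam) (lam1 : lam < 1)
  (gL : elipschitz_on lam (closure Omega) g).
Implicit Types (x y p v w b e : 'rV[R]_d) (s t r : R).

Lemma boundary_open p : boundary Omega p <-> closure Omega p /\ ~ Omega p.
Proof. by rewrite /boundary (interior_id Omega).1. Qed.

(** [t0] is the infimum of the times spent outside [Omega]. The complement being closed, the infimum
    is attained, and the limit of the earlier points lies in the closure. *)
Lemma first_boundary_point p v t : 0 <= t -> Omega p -> ~ Omega (p + t *: v) ->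
  exists t0 : R, [/\ 0 < t0, t0 <= t, boundary Omega (p + t0 *: v) &
    forall s, 0 <= s -> s < t0 -> Omega (p + s *: v)].
Proof.
move=> t0 Op nOt.
pose S : set R := [set s | 0 <= s /\ ~ Omega (p + s *: v)].
have hS : has_inf S by split; [exists t|exists 0 => s []].
have [u uE] : exists u : R, u = inf S by exists (inf S).
have uS s : 0 <= s -> s < u -> Omega (p + s *: v).
  move=> s0 su; apply: contrapT => nO; move: su; rewrite ltNge => /negP; apply.
  by rewrite uE; apply: ge_inf => //; case: hS.
have ut : u <= t by rewrite uE; apply: ge_inf => //; case: hS.
have u0 : 0 <= u by rewrite uE; apply: lb_le_inf; [case: hS|move=> s []].
have v0 : 0 < enorm v + 1 by rewrite ltr_wpDl ?enorm_ge0.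
have nOu : ~ Omega (p + u *: v).
  move=> /(open_enorm_ball oO)[e e0 eO].
  have [s [s0 nO]] := inf_adherent (divr_gt0 e0 v0) hS; rewrite -uE => su.
  apply: nO; have [/uS|us] := ltP s u; first exact.
  apply: eO; rewrite opprD addrACA subrr add0r -scalerBl enormZ ger0_norm ?subr_ge0//.
  have : (s - u) * (enorm v + 1) < e by rewrite -ltr_pdivlMr// ltrBlDl.
  by apply: le_lt_trans; rewrite ler_wpM2l ?subr_ge0// lerDl.
have {}u0 : 0 < u.
  by move: u0; rewrite le_eqVlt => /orP[/eqP u0|//]; move: nOu; rewrite -u0 scale0r addr0.
exists u; split=> //; apply/boundary_open; split=> // B /nbhs_enorm[e e0 eB].
have [s [s0 su se]] : exists s : R, [/\ 0 <= s, s < u & u - s < e / (enorm v + 1)].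
  exists (Num.max 0 (u - e / (enorm v + 1) / 2)).
  have h : 0 < e / (enorm v + 1) by rewrite divr_gt0.
  rewrite le_max lexx gt_max u0; split=> //; first by lra.
  by rewrite ltrBlDl -ltrBlDr lt_max; apply/orP; right; lra.
exists (p + s *: v); split; first exact: uS.
apply: eB; rewrite opprD addrACA subrr add0r -scalerBl enormZ distrC.
rewrite gtr0_norm ?subr_gt0//; rewrite ltr_pdivlMr// in se.
by apply: le_lt_trans se; rewrite ler_wpM2l ?subr_ge0 ?(ltW su)// lerDl.
Qed.

(** Minimality can thus be tested with any point outside [Omega]: the first boundary point on the
    segment from [x] to [w] saves length at rate 1 with respect to [w], while its distance to [y]
    costs at most the rate [lam]. *)
Lemma argmin_outside x y w : Omega x -> argmin_boundary Omega g x y -> ~ Omega w ->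
  enorm (x - y) <= enorm (x - w) + lam * enorm (w - y).
Proof.
move=> Ox [yb ymin] nw.
have [|t [t0 t1 tb _]] := @first_boundary_point x (w - x) 1 ler01 Ox.
  by rewrite scale1r addrC subrK.
have [w' w'E] : exists w', w' = x + t *: (w - x) by eexists.
rewrite -w'E in tb.
have := ymin _ tb.
move: yb tb => /boundary_open[yc _] /boundary_open[wc _].
have := gL wc yc; rewrite ler_norml => /andP[_].
have -> : enorm (x - w') = t * enorm (x - w).
  rewrite (_ : x - w' = t *: (x - w)); last by rewrite w'E; vec.
  by rewrite enormZ gtr0_norm.
have : enorm (w' - y) <= (1 - t) * enorm (x - w) + enorm (w - y).
  apply: le_trans (enormDB _ w _) _; rewrite lerD2r.
  rewrite (_ : w' - w = (1 - t) *: (x - w)); last by rewrite w'E; vec.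
  by rewrite enormZ ger0_norm ?subr_ge0.
move=> /(ler_wpM2l lam0) h1 h2 h3.
have : 0 <= (1 - t) * (1 - lam) * enorm (x - w).
  by rewrite mulr_ge0 ?mulr_ge0 ?enorm_ge0 ?subr_ge0 ?(ltW lam1).
lra.
Qed.

Definition optimal_ray x y s e :=
  [/\ Omega x, argmin_boundary Omega g x y, 0 < s, dot e e = 1 & x = y + s *: e].

Lemma optimal_rayP x y : Omega x -> argmin_boundary Omega g x y ->
  optimal_ray x y (enorm (x - y)) ((enorm (x - y))^-1 *: (x - y)).
Proof.
move=> Ox xy; have xy0 : 0 < enorm (x - y).
  rewrite enorm_gt0 subr_eq0; apply/eqP => xyE; case: xy => /boundary_open[_ ny] _.
  by rewrite -xyE in ny.
split=> //; last by rewrite scalerA divff ?gt_eqF// scale1r addrC subrK.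
by rewrite dotZl dotZr -sqr_enorm; field; rewrite gt_eqF.
Qed.

Lemma enorm_unit e : dot e e = 1 -> enorm e = 1.
Proof. by rewrite -sqr_enorm => /eqP; rewrite sqrp_eq1 ?enorm_ge0// => /eqP. Qed.

Lemma optimal_ray_enorm x y s e : optimal_ray x y s e -> enorm (x - y) = s.
Proof.
by move=> [_ _ s0 /enorm_unit e1 ->]; rewrite addrC addKr enormZ e1 mulr1 gtr0_norm.
Qed.

(** If [y + t e] were outside, [argmin_outside] would give [s <= s - t + lam t]. *)
Lemma optimal_ray_interior x y s e : optimal_ray x y s e ->
  forall t, 0 < t <= s -> Omega (y + t *: e).
Proof.
move=> re t /andP[t0 ts]; have sE := optimal_ray_enorm re.
move: re => [Ox xy s0 /enorm_unit e1 xE]; apply: contrapT => nO.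
have := argmin_outside Ox xy nO.
rewrite sE (_ : x - _ = (s - t) *: e); last by rewrite xE; vec.
rewrite (_ : _ - y = t *: e); last by vec.
rewrite !enormZ e1 (gtr0_norm t0) ger0_norm ?subr_ge0//.
have : 0 < (1 - lam) * t by rewrite mulr_gt0// subr_gt0.
lra.
Qed.

(* If [e] had a small component along [y - b] one could leave [y] into the
   ball in a direction close to [e], shortening the path at a rate above [lam]. *)
Lemma optimal_ray_transversal x y s e b r : 0 < r -> optimal_ray x y s e ->
  eball b r `&` Omega = set0 -> enorm (y - b) = r ->
  (1 - lam) / 2 * r <= dot e (y - b).
Proof.
move=> r0 re bO yb; have sE := optimal_ray_enorm re.
move: re => [Ox xy s0 e1 xE]; rewrite leNgt; apply/negP => klt.
have [c cE] : exists c : R, c = (1 - lam) / 2 by eexists.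
rewrite -cE in klt.
have c0 : 0 < c by rewrite cE divr_gt0 ?subr_gt0.
have [N NE] : exists N, N = y - b by eexists.
rewrite -NE in yb klt.
have NN : dot N N = r ^+ 2 by rewrite -sqr_enorm yb.
(* Tilting [e] towards the center by a vector of length [c] makes the product with [N] negative. *)
have [v vE] : exists v, v = e - (c / r) *: N by eexists.
have evE : dot e v = 1 - c / r * dot e N by rewrite vE !dotE e1; ring.
have NvE : dot N v = dot e N - c * r.
  by rewrite vE !dotE NN (dotC N e); field; rewrite gt_eqF.
have ev : 1 - c ^+ 2 < dot e v.
  rewrite evE ltrD2l ltrN2 expr2 -mulrA ltr_pM2l// mulrC.
  by rewrite ltr_pdivrMr// mulrC.
have vn : enorm v <= 1 + c.
  rewrite vE; apply: le_trans (enormD _ _) _.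
  by rewrite enormN enormZ yb (enorm_unit e1) gtr0_norm ?divr_gt0// divfK ?gt_eqF.
have V0 := enorm_ge0 v.
have V1 : 0 < enorm v ^+ 2 + 1 by rewrite ltr_wpDl ?sqr_ge0.
have [beta betaE] : exists beta : R, beta = c * r - dot e N by eexists.
have beta0 : 0 < beta by rewrite betaE subr_gt0.
have gam0 : 0 < c * (1 + c) by rewrite mulr_gt0// ltr_wpDr// ltW.
(* The first bound puts [y + de v] into the ball, the second controls the quadratic term of the
   distance to [x]. Since [lam = 1 - 2 c], minimality divided by [de (1 + c)] would then read
   [1 - c < 1 - 3 c / 2]. *)
have [de [de0 de1 de2]] : exists de : R, [/\ 0 < de, de * enorm v ^+ 2 < beta &
    de * enorm v ^+ 2 < s * (c * (1 + c))].
  exists (Num.min beta (s * (c * (1 + c))) / (enorm v ^+ 2 + 1)).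
  have m0 : 0 < Num.min beta (s * (c * (1 + c))) by rewrite lt_min beta0 mulr_gt0.
  have : Num.min beta (s * (c * (1 + c))) / (enorm v ^+ 2 + 1) * enorm v ^+ 2 <
      Num.min beta (s * (c * (1 + c))).
    by rewrite mulrAC ltr_pdivrMr// ltr_pM2l// ltrDl.
  by rewrite lt_min => /andP[]; split=> //; rewrite divr_gt0.
have nw : ~ Omega (y + de *: v).
  move=> Ow; suff : (eball b r `&` Omega) (y + de *: v) by rewrite bO.
  split=> //; rewrite /eball /= -ltr_sqr ?nnegrE ?enorm_ge0 ?(ltW r0)//.
  rewrite (_ : _ - b = N + de *: v); last by rewrite NE; vec.
  rewrite sqr_enorm !dotE (dotC v N) NN NvE -sqr_enorm.
  have : 0 < de * (beta - de * enorm v ^+ 2) by rewrite mulr_gt0// subr_gt0.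
  have : 0 < de * beta by rewrite mulr_gt0.
  rewrite betaE; lra.
have := argmin_outside Ox xy nw.
rewrite sE (_ : x - _ = s *: e + (- de) *: v); last by rewrite xE; vec.
rewrite (_ : _ - y = de *: v); last by vec.
have se0 : s *: e != 0 by rewrite -enorm_gt0 enormZ (enorm_unit e1) mulr1 gtr0_norm.
have := enormD_le_quad ((- de) *: v) se0.
rewrite !enormZ (enorm_unit e1) !mulr1 !dotE (gtr0_norm s0) normrN (gtr0_norm de0).
have -> : s * (- de * dot e v) / s = - de * dot e v by field; rewrite gt_eqF.
have -> : (de * enorm v) ^+ 2 / (2 * s) = de * ((de * enorm v ^+ 2) / s) / 2.
  by field; rewrite gt_eqF.
have : de * ((de * enorm v ^+ 2) / s) < de * (c * (1 + c)).
  by rewrite ltr_pM2l// ltr_pdivrMr// [ltRHS]mulrC.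
have := ltr_pM2l de0 (1 - c ^+ 2) (dot e v); rewrite ev.
have : lam * (de * enorm v) <= lam * (de * (1 + c)) by rewrite !ler_wpM2l// ltW.
have lamE : lam = 1 - 2 * c by rewrite cE; lra.
have : 0 < de * (c * (1 + c)) by rewrite mulr_gt0.
rewrite {2}lamE; lra.
Qed.

Section corner.
Variables (M r : R).
Hypotheses (r0 : 0 < r) (M0 : 0 <= M).
Hypothesis gM : forall p q, closure Omega p -> closure Omega q ->
    (forall t, 0 < t < 1 -> Omega (p + t *: (q - p))) ->
    forall t, 0 <= t <= 1 ->
    (1 - t) * g p + t * g q <= g (p + t *: (q - p)) + M * enorm (q - p) ^+ 2.

(* Near a corner the two faces are reached from [y + eps e], moving along the
   segment between the centers, within a distance [O(eps)]; averaging the two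
   competitors loses only [O(eps^2)], less than the gain [(1 - lam) eps]. *)
Lemma optimal_ray_not_corner x y s e b1 b2 : optimal_ray x y s e ->
  eball b1 r `&` Omega = set0 -> eball b2 r `&` Omega = set0 ->
  enorm (y - b1) = r -> enorm (y - b2) = r -> b1 = b2.
Proof.
move=> re b1O b2O yb1 yb2; apply/eqP; apply/negPn/negP => b12.
have sE := optimal_ray_enorm re; have rayO := optimal_ray_interior re.
move: re => [Ox xy s0 e1 xE]; have en1 := enorm_unit e1.
have [m mE] : exists m, m = b2 - b1 by eexists.
have m0 : 0 < enorm m by rewrite enorm_gt0 mE subr_eq0 eq_sym.
(* As [y] is equidistant from the centers, [y - b2] has product [- mu] with [m], and [y - b1] has
   product [- mu] with [- m]: each of the two directions enters the corresponding ball. *)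
have [mu muE] : exists mu : R, mu = enorm m ^+ 2 / 2 by eexists.
have mu0 : 0 < mu by rewrite muE divr_gt0// exprn_gt0.
have N2 : dot (y - b2) m = - mu.
  have : enorm (y - b1) ^+ 2 = enorm (y - b2) ^+ 2 by rewrite yb1 yb2.
  rewrite (_ : y - b1 = (y - b2) + m); last by rewrite mE; vec.
  by rewrite muE !sqr_enorm !dotE (dotC m y) (dotC m b2); lra.
have N1 : dot (y - b1) (- m) = - mu.
  rewrite (_ : y - b1 = (y - b2) + m); last by rewrite mE; vec.
  by rewrite dotDl !dotNr N2 -sqr_enorm muE; lra.
(* With this [L] the vector [z = e + L u] has product at most [r - (r + 1) = - 1] with the radius at
   [y], so that [y + eps z] is in the ball as soon as [eps |z|^2 < 2]. *)
have [L LE] : exists L : R, L = (r + 1) / mu by eexists.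
have L0 : 0 < L by rewrite LE divr_gt0// addr_gt0.
(* [K eps^2] collects the quadratic losses: the first term comes from the distances to [x], the
   second from [gM] on a segment of length at most [2 L eps |m|]. *)
have [K KE] : exists K : R, K = L ^+ 2 * enorm m ^+ 2 / s + 4 * M * L ^+ 2 * enorm m ^+ 2 by eexists.
have K0 : 0 <= K by rewrite KE addr_ge0 ?divr_ge0 ?mulr_ge0 ?sqr_ge0// ltW.
have [eps [eps0 eps1 eps2 eps3]] : exists eps : R, [/\ 0 < eps, eps <= s / 2,
    eps * (1 + L * enorm m) ^+ 2 < 2 & eps * K < 1 - lam].
  have h1 : 0 < (1 + L * enorm m) ^+ 2 by rewrite exprn_gt0// addr_gt0// mulr_gt0.
  have h2 : 0 < K + 1 by rewrite ltr_wpDl.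
  exists (Num.min (s / 2) (Num.min (1 / (1 + L * enorm m) ^+ 2) ((1 - lam) / (K + 1)))).
  rewrite !lt_min !divr_gt0 ?subr_gt0// ge_min lexx; split=> //.
    apply: (@le_lt_trans _ _ 1); last by rewrite ltr1n.
    by rewrite -ler_pdivlMr// !ge_min lexx !orbT.
  apply: (@le_lt_trans _ _ ((1 - lam) / (K + 1) * K)).
    by rewrite ler_wpM2r// !ge_min lexx !orbT.
  by rewrite mulrAC ltr_pdivrMr// ltr_pM2l ?subr_gt0// ltrDl.
have [p0 p0E] : exists p0, p0 = y + eps *: e by eexists.
have Op0 : Omega p0 by rewrite p0E; apply: rayO; rewrite eps0 /=; lra.
have hit b u : eball b r `&` Omega = set0 -> enorm (y - b) = r -> enorm u = enorm m ->
    dot (y - b) u = - mu -> exists t : R, [/\ 0 < t, t <= L * eps,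
      boundary Omega (p0 + t *: u) & forall s, 0 <= s -> s < t -> Omega (p0 + s *: u)].
  move=> bO yb um Nu; apply: first_boundary_point => //; first by rewrite mulr_ge0 ?ltW.
  move=> Ow; suff : (eball b r `&` Omega) (p0 + (L * eps) *: u) by rewrite bO.
  split=> //; rewrite /eball /= -ltr_sqr ?nnegrE ?enorm_ge0 ?(ltW r0)//.
  have [z zE] : exists z, z = e + L *: u by eexists.
  rewrite (_ : _ - b = (y - b) + eps *: z); last by rewrite zE p0E; vec.
  rewrite sqr_enormD dotZr enormZ gtr0_norm// yb.
  have zn : enorm z <= 1 + L * enorm m.
    by rewrite zE; apply: le_trans (enormD _ _) _; rewrite en1 enormZ um gtr0_norm.
  have zn2 : enorm z ^+ 2 <= (1 + L * enorm m) ^+ 2.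
    by rewrite ler_sqr ?nnegrE ?enorm_ge0// addr_ge0// mulr_ge0 ?enorm_ge0// ltW.
  have : dot (y - b) z <= - 1.
    rewrite zE dotDr dotZr Nu; have := dot_le (y - b) e; rewrite en1 yb.
    have -> : L * - mu = - (r + 1) by rewrite LE; field; rewrite gt_eqF.
    lra.
  move=> /(ler_wpM2l (ltW eps0)); have := ler_wpM2l (ltW eps0) zn2.
  move=> h1; have {h1} : eps * (eps * enorm z ^+ 2) < eps * 2.
    by rewrite ltr_pM2l//; apply: le_lt_trans h1 eps2.
  by move=> h1 h2; lra.
have [t1 [t10 t1L t1b t1O]] := hit b2 m b2O yb2 erefl N2.
have [t2 [t20 t2L t2b t2O]] := hit b1 (- m) b1O yb1 (enormN m) N1.
have t12 : 0 < t1 + t2 by rewrite addr_gt0.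
(* The weights for which [al p1 + (1 - al) p2 = p0]; the terms linear in [m] cancel in the
   average. *)
have [al [al0 al1 alE]] : exists al : R, [/\ 0 <= al, 0 <= 1 - al & al * (t1 + t2) = t2].
  exists (t2 / (t1 + t2)); rewrite divfK ?gt_eqF// divr_ge0 ?(ltW t20) ?(ltW t12)//.
  by rewrite subr_ge0 ler_pdivrMr// mul1r lerDr ltW.
move: (xy) => [yb ymin].
have := ymin _ t1b; have := ymin _ t2b; rewrite sE.
(* Used with [k] equal to 1 and -1; [eps <= s / 2] gives [2 (s - eps) >= s]. *)
have dist t k : 0 < t -> t <= L * eps -> enorm (x - (p0 + t *: (k *: m))) <=
   (s - eps) - t * (k * dot e m) + k ^+ 2 * (L ^+ 2 * eps ^+ 2 * enorm m ^+ 2 / s).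
  move=> t0 tL; have se : 0 < s - eps by lra.
  rewrite (_ : x - _ = (s - eps) *: e + (- (t * k)) *: m); last by rewrite xE p0E; vec.
  have se0 : (s - eps) *: e != 0 by rewrite -enorm_gt0 enormZ en1 mulr1 gtr0_norm.
  apply: le_trans (enormD_le_quad _ se0) _.
  rewrite !enormZ en1 !mulr1 !dotE (gtr0_norm se).
  have -> : (s - eps) * (- (t * k) * dot e m) / (s - eps) = - (t * (k * dot e m)).
    by field; rewrite gt_eqF.
  rewrite lerD2l exprMn real_normK ?num_real// sqrrN exprMn.
  rewrite [leLHS](_ : _ = k ^+ 2 * (t ^+ 2 * enorm m ^+ 2 * (2 * (s - eps))^-1)); last by ring.
  apply: ler_wpM2l; first exact: sqr_ge0.
  apply: ler_pM; [by rewrite mulr_ge0 ?sqr_ge0|by rewrite invr_ge0 mulr_ge0 ?(ltW se)| |].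
    apply: ler_wpM2r; first exact: sqr_ge0.
    by rewrite -exprMn ler_sqr ?nnegrE ?(ltW t0) ?mulr_ge0 ?(ltW L0) ?(ltW eps0).
  by rewrite lef_pV2 ?posrE ?mulr_gt0//; lra.
have := dist t1 1 t10 t1L; have := dist t2 (- 1) t20 t2L.
rewrite scaleN1r scale1r.
have [p1 p1E] : exists p1, p1 = p0 + t1 *: m by eexists.
have [p2 p2E] : exists p2, p2 = p0 + t2 *: (- m) by eexists.
rewrite -p1E -p2E.
have [c1 n1] : closure Omega p1 /\ ~ Omega p1 by apply/boundary_open; rewrite p1E.
have [c2 n2] : closure Omega p2 /\ ~ Omega p2 by apply/boundary_open; rewrite p2E.
have segE t : p2 + t *: (p1 - p2) = p0 + (t * (t1 + t2) - t2) *: m.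
  by rewrite p1E p2E; vec.
have seg t : 0 < t < 1 -> Omega (p2 + t *: (p1 - p2)).
  move=> /andP[u0 u1]; rewrite segE.
  have : 0 < t * (t1 + t2) by rewrite mulr_gt0.
  have : 0 < (1 - t) * (t1 + t2) by rewrite mulr_gt0// subr_gt0.
  set q := t * (t1 + t2); rewrite mulrBl mul1r -/q => h1 h2.
  have [h|h] := leP 0 (q - t2); first by apply: t1O => //; lra.
  rewrite (_ : _ *: m = (t2 - q) *: (- m)); last by vec.
  by apply: t2O; lra.
have al01 : 0 <= al <= 1 by rewrite al0 -subr_ge0.
have := gM c2 c1 seg al01; rewrite segE alE subrr scale0r addr0.
have : enorm (p1 - p2) ^+ 2 <= 4 * L ^+ 2 * eps ^+ 2 * enorm m ^+ 2.
  rewrite (_ : p1 - p2 = (t1 + t2) *: m); last by rewrite p1E p2E; vec.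
  rewrite enormZ gtr0_norm// exprMn ler_wpM2r ?sqr_ge0//.
  rewrite (_ : 4 * _ * _ = (2 * (L * eps)) ^+ 2); last by ring.
  by rewrite ler_sqr ?nnegrE ?mulr_ge0 ?(ltW t12) ?(ltW L0) ?(ltW eps0)//; lra.
move=> /(ler_wpM2l M0) hM hg hd2 hd1 hm2 hm1.
have gp0 : g p0 <= g y + lam * eps.
  have yc : closure Omega y by case: yb.
  have := gL (subset_closure Op0) yc; rewrite ler_norml => /andP[_].
  rewrite (_ : p0 - y = eps *: e); last by rewrite p0E; vec.
  by rewrite enormZ en1 mulr1 gtr0_norm// lerBlDl.
have H1 := ler_wpM2l al0 (le_trans hm1 (lerD hd1 (lexx (g p1)))).
have H2 := ler_wpM2l al1 (le_trans hm2 (lerD hd2 (lexx (g p2)))).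
have HE : al * (t1 * dot e m) = (1 - al) * (t2 * dot e m).
  have : al * t1 = (1 - al) * t2 by lra.
  by rewrite !mulrA => ->.
have HK : eps * (eps * K) < eps * (1 - lam) by rewrite ltr_pM2l.
have HKE : eps * (eps * K) = L ^+ 2 * eps ^+ 2 * enorm m ^+ 2 / s
    + M * (4 * L ^+ 2 * eps ^+ 2 * enorm m ^+ 2) by rewrite KE; ring.
rewrite HKE in HK.
move: H1 H2 HK; set Q := _ / s; set P := M * (4 * _ * _ * _) in hM *.
move: Q P hM {b1O b2O hit hd1 hd2 HKE} => Q P hM H1 H2 HK; lra.
Qed.

End corner.
End rays.

(** * Second-order comparison at the end of a ray *)

Section semiconcavity.
Context {R : realType} {d : nat}.
Variables (Omega : set 'rV[R]_d) (g : 'rV[R]_d -> R) (lam : R).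
Hypotheses (oO : open Omega) (lam0 : 0 <= lam) (lam1 : lam < 1)
  (gL : elipschitz_on lam (closure Omega) g).
Implicit Types (x y p v w b e : 'rV[R]_d) (s t : R).
Variables (M r : R).
Hypotheses (r0 : 0 < r) (M0 : 0 <= M).
Hypothesis gM : forall p q, closure Omega p -> closure Omega q ->
    (forall t, 0 < t < 1 -> Omega (p + t *: (q - p))) ->
    forall t, 0 <= t <= 1 ->
    (1 - t) * g p + t * g q <= g (p + t *: (q - p)) + M * enorm (q - p) ^+ 2.

(* [x + h] and [x - h] are joined to the boundary in the direction [e], so that
   the competitors differ from [y] by the part [v] of [h] tangent to the sphere
   along [e], corrected by [O(|h|^2)] along [e] to meet the boundary. *)
Lemma optimal_ray_competitors : exists2 C, 0 < C &
  forall x y s e b (eta0 : R), optimal_ray Omega g x y s e ->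
  eball b r `&` Omega = set0 -> enorm (y - b) = r -> 0 < eta0 ->
  (forall z, boundary Omega z -> enorm (z - y) < eta0 -> enorm (z - b) = r) ->
  exists2 eta : R, 0 < eta & forall h, enorm h < eta -> exists y1 y2,
    [/\ boundary Omega y1, boundary Omega y2 &
    enorm (x + h - y1) + g y1 + (enorm (x - h - y2) + g y2) <=
      2 * (s + g y) + C * enorm h ^+ 2].
Proof.
have [c cE] : exists c : R, c = (1 - lam) / 2 by eexists.
have c0 : 0 < c by rewrite cE divr_gt0 ?subr_gt0.
(* Transversality gives [|a| <= |h| / c] for the component [a] below, so that [|v| <= A |h|]. *)
have [A AE] : exists A : R, A = 1 + c^-1 by eexists.
have A0 : 0 < A by rewrite AE addr_gt0 ?invr_gt0.
(* Descending by [B |h|^2] along [- e] must reach the ball: the gain [2 (B - 1) |h|^2 c r] has to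
   exceed the square of a displacement of length at most [(A + 1) |h|]. *)
have [B BE] : exists B : R, B = 1 + ((A + 1) ^+ 2 + 1) / (2 * (c * r)) by eexists.
have cr0 : 0 < c * r by rewrite mulr_gt0.
have B1 : 0 < B - 1 by rewrite BE addrAC subrr add0r divr_gt0 ?mulr_gt0// ltr_wpDl ?sqr_ge0.
have B0 : 0 < B by lra.
have C0 : 0 < 4 * B + 8 * M * A ^+ 2 + 2.
  have : 0 <= 8 * M * A ^+ 2 by rewrite mulr_ge0 ?sqr_ge0 ?mulr_ge0.
  lra.
(* [4 B] pays for the two descents and the variation of [g] along them, [8 M A^2] for [gM] on the
   segment from [q - v] to [q + v], and the last 2 for the lift [ka]. *)
exists (4 * B + 8 * M * A ^+ 2 + 2) => // x y s e b eta0 re bO yb eta00 loc.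
have tr := optimal_ray_transversal oO lam0 lam1 gL r0 re bO yb.
have rayO := optimal_ray_interior oO lam0 lam1 gL re.
move: re => [Ox xy s0 e1 xE]; have en1 := enorm_unit e1.
rewrite -cE in tr.
have [N NE] : exists N, N = y - b by eexists.
have [k kE] : exists k : R, k = dot e N by eexists.
rewrite -NE -kE in tr; rewrite -NE in yb.
have k0 : 0 < k by apply: lt_le_trans tr.
have [eta [eta00' eta1 eta2 eta3 eta4]] : exists eta : R,
    [/\ 0 < eta, eta <= 1, (A + 1) * eta <= eta0, (A + 1) * eta <= s & (B - 1) * eta <= 1].
  have A1 : 0 < A + 1 by rewrite addr_gt0.
  exists (Num.min (Num.min 1 (B - 1)^-1) (Num.min (eta0 / (A + 1)) (s / (A + 1)))).
  rewrite !lt_min !divr_gt0// invr_gt0 B1 ltr01 !ge_min lexx.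
  split=> //; rewrite mulrC -ler_pdivlMr// ?div1r; by rewrite !ge_min lexx ?orbT.
exists eta => // h heta.
have [->|h0] := eqVneq h 0.
  exists y, y; split; try by case: xy.
  rewrite subr0 addr0 enorm0 expr0n mulr0 addr0 (_ : x - y = s *: e); last by rewrite xE; vec.
  rewrite enormZ en1 mulr1.
  by rewrite gtr0_norm//; lra.
have hn : 0 < enorm h by rewrite enorm_gt0.
(* The base point is lifted to [y + ka e], so that tangential displacements stay in [Omega] at a
   cost of order [|h|^2]. *)
have [ka kaE] : exists ka : R, ka = enorm h ^+ 2 by eexists.
have ka0 : 0 < ka by rewrite kaE exprn_gt0.
have kah : ka <= enorm h.
  by rewrite kaE expr2 ler_piMl ?(ltW hn)//; lra.
have kas : ka <= s by have := mulr_gt0 A0 eta00'; lra.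
(* The coefficient for which [v = h - a e] is tangent to the sphere at [y]. *)
have [a aE] : exists a : R, a = dot h N / k by eexists.
have an : `|a| <= enorm h / c.
  rewrite aE normrM normfV (gtr0_norm k0) ler_pdivrMr//.
  apply: (@le_trans _ _ (enorm h * r)).
    rewrite ler_norml lerNl -dotNl -{1}(enormN h) -yb.
    by rewrite !dot_le.
  by rewrite -mulrA ler_pM2l// ler_pdivlMl.
have [v vE] : exists v, v = h - a *: e by eexists.
have vN : dot N v = 0.
  by rewrite vE dotDr dotNr dotZr (dotC N h) (dotC N e) -kE aE divfK ?subrr// gt_eqF.
have vn : enorm v <= A * enorm h.
  rewrite vE; apply: le_trans (enormD _ _) _; rewrite enormN enormZ en1 mulr1 AE mulrDl mul1r.
  by rewrite lerD2l mulrC.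
(* An exit point close to [y] would lie on the sphere, by [loc], but its squared distance to [b] is
   [r^2 + 2 ka k + |w|^2]. *)
have tang u t : 0 <= t -> t <= 1 -> dot N u = 0 -> enorm u <= A * enorm h ->
    Omega (y + ka *: e + t *: u).
  move=> t0 t1 uN un; apply: contrapT => nO.
  have Oq : Omega (y + ka *: e) by apply: rayO; rewrite ka0 kas.
  have [t2 [t20 t2t zb _]] := first_boundary_point oO t0 Oq nO.
  have [w wE] : exists w, w = ka *: e + t2 *: u by eexists.
  have wn : enorm w < eta0.
    rewrite wE; apply: le_lt_trans (enormD _ _) _.
    rewrite !enormZ en1 mulr1 (gtr0_norm ka0) (gtr0_norm t20).
    have : t2 * enorm u <= 1 * (A * enorm h) by rewrite ler_pM ?enorm_ge0 ?(ltW t20)//; lra.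
    have : (A + 1) * enorm h < (A + 1) * eta by rewrite ltr_pM2l// addr_gt0.
    lra.
  have zE : y + ka *: e + t2 *: u - y = w by rewrite wE; vec.
  have := loc _ zb; rewrite zE => /(_ wn).
  rewrite (_ : _ - b = N + w); last by rewrite NE wE; vec.
  move=> /(congr1 (fun u => u ^+ 2)); rewrite sqr_enormD yb.
  rewrite {1}wE dotDr !dotZr uN mulr0 addr0 (dotC N) -kE.
  have : 0 < ka * k by rewrite mulr_gt0.
  by have := sqr_ge0 (enorm w); lra.
have down u : dot N u = 0 -> enorm u <= A * enorm h -> exists t, [/\ 0 < t, t <= B * ka &
    boundary Omega (y + ka *: e + u + t *: (- e))].
  move=> uN un; have Oq := tang u 1 ler01 (lexx 1) uN un; rewrite scale1r in Oq.
  have nO : ~ Omega (y + ka *: e + u + (B * ka) *: (- e)).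
    move=> Ow; suff : (eball b r `&` Omega) (y + ka *: e + u + (B * ka) *: (- e)) by rewrite bO.
    split=> //; rewrite /eball /= -ltr_sqr ?nnegrE ?enorm_ge0 ?(ltW r0)//.
    have [z zE] : exists z, z = u - ((B - 1) * ka) *: e by eexists.
    rewrite (_ : _ - b = N + z); last by rewrite zE NE; vec.
    rewrite sqr_enormD yb {1}zE dotDr dotNr dotZr uN (dotC N) -kE.
    have zn : enorm z <= (A + 1) * enorm h.
      rewrite zE; apply: le_trans (enormD _ _) _; rewrite enormN enormZ en1 mulr1.
      rewrite gtr0_norm ?mulr_gt0// kaE.
      have : (B - 1) * enorm h ^+ 2 <= enorm h.
        rewrite expr2 mulrA ler_piMl ?(ltW hn)//; apply: le_trans eta4.
        by rewrite ler_pM2l// ltW.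
      lra.
    have : enorm z ^+ 2 <= (A + 1) ^+ 2 * ka.
      by rewrite kaE -exprMn ler_sqr ?nnegrE ?enorm_ge0 ?mulr_ge0 ?enorm_ge0// addr_ge0// ltW.
    have : (B - 1) * ka * (c * r) <= (B - 1) * ka * k by rewrite ler_pM2l// mulr_gt0.
    have : (B - 1) * ka * (c * r) = ((A + 1) ^+ 2 + 1) * ka / 2.
      by rewrite BE; field; rewrite !gt_eqF.
    by move: ((A + 1) ^+ 2) {bO} => W; lra.
  have Bka0 : 0 <= B * ka by rewrite mulr_ge0 ?(ltW B0) ?(ltW ka0).
  by have [t [t0 tB tb _]] := first_boundary_point oO Bka0 Oq nO; exists t.
have v'N : dot N (- v) = 0 by rewrite dotNr vN oppr0.
have v'n : enorm (- v) <= A * enorm h by rewrite enormN.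
have [t1 [t10 t1B t1b]] := down v vN vn.
have [t2 [t20 t2B t2b]] := down (- v) v'N v'n.
exists (y + ka *: e + v + t1 *: (- e)), (y + ka *: e + (- v) + t2 *: (- e)); split=> //.
have an' : `|a| + ka <= s.
  have : (A + 1) * enorm h <= s by apply: le_trans eta3; rewrite ler_pM2l ?addr_gt0// ltW.
  by rewrite AE; move: an; rewrite [_ / c]mulrC; lra.
have [a1 a2] : a <= `|a| /\ - a <= `|a| by rewrite ler_norm -normrN ler_norm.
(* Both differences are multiples of [e]: the lengths are exact, without a remainder in [1 / s], and
   [a] cancels in their sum. *)
rewrite (_ : x + h - _ = (s + a - ka + t1) *: e); last by rewrite vE xE; vec.
rewrite (_ : x - h - _ = (s - a - ka + t2) *: e); last by rewrite vE xE; vec.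
rewrite !enormZ en1 !mulr1 !ger0_norm; try by lra.
have [q qE] : exists q, q = y + ka *: e by eexists.
rewrite -qE in t1b t2b *.
have q1O : Omega (q + v) by have := tang v 1 ler01 (lexx 1) vN vn; rewrite scale1r qE.
have q2O : Omega (q - v) by have := tang (- v) 1 ler01 (lexx 1) v'N v'n; rewrite scale1r qE.
have yc : closure Omega y by case: xy => -[].
have g0 : g q <= g y + lam * ka.
  have qO : Omega q by rewrite qE; apply: rayO; rewrite ka0 kas.
  have := gL (subset_closure qO) yc; rewrite ler_norml => /andP[_].
  rewrite (_ : q - y = ka *: e); last by rewrite qE; vec.
  by rewrite enormZ en1 mulr1 gtr0_norm// lerBlDl.
have gdown p t : Omega p -> 0 < t -> boundary Omega (p + t *: (- e)) ->
    g (p + t *: (- e)) <= g p + lam * t.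
  move=> pO t0 [pc _]; have := gL pc (subset_closure pO); rewrite ler_norml => /andP[_].
  rewrite (_ : _ - p = t *: (- e)); last by vec.
  by rewrite enormZ enormN en1 mulr1 gtr0_norm// lerBlDl.
have h1 := gdown _ _ q1O t10 t1b; have h2 := gdown _ _ q2O t20 t2b.
have seg t : 0 < t < 1 -> Omega (q - v + t *: (q + v - (q - v))).
  move=> /andP[u0 u1].
  have [ht|ht] := leP (1 / 2) t.
    have -> : q - v + t *: (q + v - (q - v)) = y + ka *: e + (2 * t - 1) *: v.
      by rewrite qE; vec.
    by apply: tang => //; lra.
  have -> : q - v + t *: (q + v - (q - v)) = y + ka *: e + (1 - 2 * t) *: (- v).
    by rewrite qE; vec.
  by apply: tang => //; lra.
have half : 0 <= (1 / 2 : R) <= 1 by apply/andP; split; lra.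
have := gM (subset_closure q2O) (subset_closure q1O) seg half.
rewrite (_ : q - v + _ *: _ = q); last by apply/rowP => i; rewrite !mxE; field.
rewrite (_ : q + v - (q - v) = 2 *: v); last by vec.
rewrite enormZ ger0_norm// exprMn.
have : enorm v ^+ 2 <= A ^+ 2 * ka.
  by rewrite kaE -exprMn ler_sqr ?nnegrE ?enorm_ge0 ?mulr_ge0 ?enorm_ge0// ltW.
move=> /(ler_wpM2l M0) h3 h4; rewrite -kaE.
have h5 : lam * t1 <= B * ka.
  apply: le_trans t1B; rewrite ler_piMl ?(ltW t10)// ltW//.
have h6 : lam * t2 <= B * ka.
  apply: le_trans t2B; rewrite ler_piMl ?(ltW t20)// ltW//.
have h7 : lam * ka <= ka by rewrite ler_piMl ?(ltW ka0)// ltW.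
have -> : (4 * B + 8 * M * A ^+ 2 + 2) * ka =
  4 * (B * ka) + 8 * (M * (A ^+ 2 * ka)) + 2 * ka by ring.
move: {bO loc tang down gdown} h3 h4 => h3 h4; lra.
Qed.

End semiconcavity.

(** * Balls, closures and spheres *)

Section spheres.
Context {R : realType} {d : nat}.
Implicit Types (b x z : 'rV[R]_d).

Lemma eball_open b (r : R) : open (eball b r).
Proof.
have -> : eball b r = (fun x => enorm (x - b)) @^-1` [set t : R | t < r] by [].
apply: open_comp; last exact: open_lt.
move=> x _; apply: (@lipschitz_enorm_continuous _ _ _ 1) => y z; rewrite mul1r.
by apply: le_trans (enorm_lipschitz _ _) _; rewrite opprB addrA subrK.
Qed.

Lemma closure_enormP (A : set 'rV[R]_d) z :
  closure A z -> forall e : R, 0 < e -> exists2 a, A a & enorm (a - z) < e.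
Proof.
move=> cA e e0; have [|a [Aa az]] := cA (eball z e); last by exists a.
by apply: open_nbhs_nbhs; split; [exact: eball_open|rewrite /eball /= subrr enorm0].
Qed.

Lemma boundary_eball b (r : R) z : boundary (eball b r) z -> enorm (z - b) = r.
Proof.
move=> [cz]; rewrite (interior_id _).1; last exact: eball_open.
move=> /negP; rewrite -leNgt => rz; apply/eqP; rewrite eq_le rz andbT.
apply/ler_addgt0Pr => e e0; have [a ab az] := closure_enormP cz e0.
apply: le_trans (enormDB z a b) _; rewrite enormB addrC; apply: lerD; exact: ltW.
Qed.

End spheres.

(** * The value function and the flow along the rays *)

Section flow.
Context {R : realType} {d : nat}.
Variables (Omega : set 'rV[R]_d) (g : 'rV[R]_d -> R) (lam r : R)
  (T : 'rV[R]_d -> 'rV[R]_d).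
Hypotheses (r0 : 0 < r) (rp : round_polyhedron r Omega) (gC2 : C2_closure Omega g)
  (gL : elipschitz_on lam (closure Omega) g) (lam1 : lam < 1)
  (Tsel : forall x, Omega x -> argmin_boundary Omega g x (T x)).
Implicit Types (x z : 'rV[R]_d) (h t : R).

Definition len x := enorm (x - T x).
Definition dir x : 'rV[R]_d := (len x)^-1 *: (x - T x).
Definition flow h x : 'rV[R]_d := x - h *: dir x.
Let u x := len x + g (T x).

Let oO : open Omega. Proof. by case: rp => -[]. Qed.

Let TO x : Omega x -> ~ Omega (T x).
Proof. by move=> /Tsel[/(boundary_open oO)[]]. Qed.

(** The Lipschitz inequality is applied to two distinct points of the closure, [x] and [T x]. *)
Lemma lipschitz_ge0 : 0 <= lam.
Proof.
have [[_ _ [x Ox]] _ _] := rp; have [Tb _] := Tsel Ox.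
have := gL (subset_closure Ox) (proj1 Tb); move=> /(le_trans (normr_ge0 _)).
rewrite pmulr_lge0// enorm_gt0 subr_eq0; apply/eqP => xT.
by apply: (TO Ox); rewrite -xT.
Qed.
Let lam0 := lipschitz_ge0.

Lemma dir_ray x : Omega x -> optimal_ray Omega g x (T x) (len x) (dir x).
Proof. by move=> Ox; apply: optimal_rayP (Tsel Ox). Qed.

Lemma len_gt0 x : Omega x -> 0 < len x.
Proof. by move=> /dir_ray[]. Qed.

Let semi := C2_semiconvex oO (let: And3 _ h _ := rp in h) gC2 gL.

(** [T x] lies on exactly one of the finitely many spheres, so the others stay at a positive
    distance; [eta] is the least of these distances, capped by 1. *)
Lemma single_face x : Omega x -> exists b, [/\ eball b r `&` Omega = set0,
  enorm (T x - b) = r & exists2 eta : R, 0 < eta &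
  forall z, boundary Omega z -> enorm (z - T x) < eta -> enorm (z - b) = r].
Proof.
move=> Ox; have [M M0 gM] := semi.
have [_ _ [m [b [binj bO bE]]]] := rp.
have faces z : boundary Omega z -> exists i, enorm (z - b i) = r.
  by rewrite bE => -[i _ [_ /boundary_eball zi]]; exists i.
have [i Ti] := faces _ (proj1 (Tsel Ox)).
exists (b i); split=> //.
have /choice[eta etaP] (j : 'I_m) : exists e : R, 0 < e /\
    (j != i -> forall z, enorm (z - T x) < e -> enorm (z - b j) != r).
  have [->|ji] := eqVneq j i; first by exists 1.
  have Tj : enorm (T x - b j) != r.
    apply/eqP => Tj; move/negP: ji; apply; apply/eqP/binj.
    exact: (optimal_ray_not_corner oO lam0 lam1 gL r0 M0 gM (dir_ray Ox) (bO j) (bO i) Tj Ti).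
  exists `|enorm (T x - b j) - r|; rewrite normr_gt0 subr_eq0; split=> // _ z.
  apply: contraTN => /eqP <-; rewrite -leNgt distrC.
  apply: le_trans (enorm_lipschitz _ _) _.
  by rewrite opprB addrA subrK.
exists (\big[Order.min/1]_j eta j) => [|z zb zT].
  by apply/bigmin_gtP; split=> // j _; have [] := etaP j.
have [j zj] := faces _ zb.
have [<-//|ji] := eqVneq j i.
have [_ /(_ ji z)] := etaP j; rewrite zj eqxx => H; exfalso.
by have : false by apply: H; apply: lt_le_trans zT _; apply: bigmin_le_cond.
Qed.

Lemma value_le x y : Omega x -> boundary Omega y -> u x <= enorm (x - y) + g y.
Proof. by move=> Ox yb; have [_] := Tsel Ox; exact. Qed.

(** [optimal_ray_competitors] bounds [u] from above at [x + h] and [x - h], while [u x] is attained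
    at [T x]. Only [eta] depends on [x]. *)
Lemma value_semiconcave : exists2 C, 0 < C & forall x, Omega x ->
  exists2 eta, 0 < eta & forall h : 'rV[R]_d, enorm h < eta ->
    u (x + h) + u (x - h) - 2 * u x <= C * enorm h ^+ 2.
Proof.
have [M M0 gM] := semi.
have [C C0 CP] := optimal_ray_competitors oO lam0 lam1 gL r0 M0 gM.
exists C => // x Ox; have [b [bO Tb [e0 e00 loc]]] := single_face Ox.
have [eta eta0 etaP] := CP _ _ _ _ _ _ (dir_ray Ox) bO Tb e00 loc.
have [eps eps0 epsO] := open_enorm_ball oO Ox.
exists (Num.min eta eps) => [|h]; first by rewrite lt_min eta0.
rewrite lt_min => /andP[/etaP[y1 [y2 [y1b y2b H]]] he].
have O1 : Omega (x + h) by apply: epsO; rewrite addrAC subrr add0r.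
have O2 : Omega (x - h) by apply: epsO; rewrite addrAC subrr add0r enormN.
have := value_le O1 y1b; have := value_le O2 y2b; 
have uE : u x = len x + g (T x) by [].
rewrite uE; lra.
Qed.

Lemma value_lipschitz x z : Omega x -> Omega z -> `|u x - u z| <= enorm (x - z).
Proof.
have half x' z' : Omega x' -> Omega z' -> u x' <= enorm (x' - z') + u z'.
  move=> Ox Oz; apply: le_trans (value_le Ox (proj1 (Tsel Oz))) _.
  by rewrite /u addrA lerD2r enormDB.
move=> Ox Oz; have := half _ _ Ox Oz; have := half _ _ Oz Ox; rewrite (enormB z).
by rewrite ler_norml => h1 h2; apply/andP; split; lra.
Qed.

(** [dir x] acts as a supergradient: near [x], the competitor [T x] bounds [u] by a distance
    function with gradient [dir x], and semiconcavity along the segment carries this bound to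
    [z]. *)
Lemma value_le_linear : exists2 C, 0 < C & forall x z,
  (forall t, 0 <= t <= 1 -> Omega (x + t *: (z - x))) ->
  u z - u x <= dot (dir x) (z - x) + C * enorm (z - x) ^+ 2.
Proof.
have [C C0 CP] := value_semiconcave.
exists (C + 1) => [|x z seg]; first by rewrite addr_gt0.
have [->|xz] := eqVneq x z.
  by rewrite !subrr enorm0 expr0n mulr0 addr0 /dot big1// => i _; rewrite !mxE mulr0.
have [v vE] : exists v, v = z - x by eexists.
have v0 : 0 < enorm v by rewrite vE enorm_gt0 subr_eq0 eq_sym.
have zE : z = x + 1 *: v by rewrite scale1r vE addrC subrK.
rewrite -vE in seg *.
have Ox : Omega x by have := seg 0; rewrite scale0r addr0 lexx ler01 => /(_ isT).
have := @midpoint_semiconcave R (fun t => u (x + t *: v)) (enorm v) (C * enorm v ^+ 2).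
move=> mid.
have {mid}H t : t \in `[0, 1] -> (1 - t) * u (x + 0 *: v) + t * u (x + 1 *: v)
    - C * enorm v ^+ 2 * (t * (1 - t)) <= u (x + t *: v).
  apply: mid => [s t' s01 t01|t' /andP[t0 t1]].
    apply: le_trans (value_lipschitz (seg _ s01) (seg _ t01)) _.
    by rewrite opprD addrACA subrr add0r -scalerBl enormZ mulrC.
  have [|eta eta0 etaP] := CP (x + t' *: v); first by apply: seg; rewrite !ltW.
  exists (eta / enorm v) => [|h /andP[h0]]; first by rewrite divr_gt0.
  rewrite ltr_pdivlMr// -{1}(gtr0_norm h0) -enormZ => /etaP.
  rewrite !scalerDl scaleNr !addrA => /le_lt_trans; apply.
  rewrite enormZ exprMn gtr0_norm//.
  have : 0 < C * (h ^+ 2 * enorm v ^+ 2) by rewrite !mulr_gt0// exprn_gt0.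
  lra.
rewrite scale0r addr0 -zE in H.
have lx := len_gt0 Ox.
(* With [t <= len x] the remainder [(t |v|)^2 / (2 len x)] is at most [t |v|^2], which removes the
   dependence on [len x] after division by [t]. *)
have [t [t0 t1 tl]] : exists t, [/\ 0 < t, t <= 1 & t <= len x].
  by exists (Num.min 1 (len x)); rewrite lt_min ltr01 lx !ge_min !lexx orbT.
have t01 : t \in `[0, 1] by rewrite in_itv /= (ltW t0).
have Ot : Omega (x + t *: v) by apply: seg; rewrite (ltW t0).
have := value_le Ot (proj1 (Tsel Ox)); rewrite addrAC => vl.
have xT : x - T x != 0 by rewrite -enorm_gt0.
have := enormD_le_quad (t *: v) xT; rewrite -/(len x).
rewrite enormZ gtr0_norm// dotZr => q.
have dE : dot (dir x) v = dot (x - T x) v / len x by rewrite /dir dotZl mulrC.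
have q2 : (t * enorm v) ^+ 2 / (2 * len x) <= t * enorm v ^+ 2.
  rewrite ler_pdivrMr ?mulr_gt0//.
  rewrite (_ : (t * _) ^+ 2 = t * enorm v ^+ 2 * t); last by ring.
  rewrite ler_pM2l ?mulr_gt0 ?exprn_gt0//; lra.
have q3 : t * dot (x - T x) v / len x = t * dot (dir x) v by rewrite dE; ring.
have := H t t01; rewrite q3 in q.
have q4 : 0 <= C * enorm v ^+ 2 * (t * t) by rewrite !mulr_ge0 ?enorm_ge0 ?(ltW C0) ?(ltW t0).
move=> h1; rewrite -(ler_pM2l t0).
move: vl h1 q; rewrite /u; lra.
Qed.

(** In the sum of [value_le_linear] for the two orders of the points the values of [u] cancel. The
    square [h^2 |dir x - dir z|^2] is dropped. *)
Lemma flow_expansion : exists2 C, 0 < C & forall x z h, 0 <= h ->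
  (forall t, 0 <= t <= 1 -> Omega (x + t *: (z - x))) ->
  (1 - C * h) * enorm (x - z) ^+ 2 <= enorm (flow h x - flow h z) ^+ 2.
Proof.
have [C C0 CP] := value_le_linear; exists (4 * C) => [|x z h h0 seg].
  by rewrite mulr_gt0.
have seg' t : 0 <= t <= 1 -> Omega (z + t *: (x - z)).
  move=> /andP[t0 t1]; rewrite (_ : _ + _ = x + (1 - t) *: (z - x)); last by vec.
  by apply: seg; apply/andP; split; lra.
have := CP _ _ seg; have := CP _ _ seg'.
rewrite -(enormN (x - z)) opprB -[x - z]opprB dotNr => h1 h2.
have [v vE] : exists v, v = z - x by eexists.
have [w wE] : exists w, w = dir x - dir z by eexists.
rewrite (_ : flow h x - flow h z = - v + (- h) *: w); last first.
  by rewrite vE wE /flow; vec.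
rewrite -vE in h1 h2 *.
rewrite sqr_enormD enormN dotNl dotZr.
have wv : dot v w = dot (dir x) v - dot (dir z) v by rewrite wE dotC dotDl dotNl.
have := sqr_ge0 (enorm (- h *: w)).
have : 0 <= h * (dot v w + 2 * (C * enorm v ^+ 2)).
  by rewrite mulr_ge0// wv; lra.
lra.
Qed.

Lemma flowE h x : Omega x -> flow h x = T x + (len x - h) *: dir x.
Proof. by rewrite /flow => /dir_ray[_ _ _ _ {1}->]; vec. Qed.

Lemma flow_interior h x : Omega x -> h < len x -> 0 <= h -> Omega (flow h x).
Proof.
move=> Ox hx h0; rewrite flowE//.
apply: (optimal_ray_interior oO lam0 lam1 gL (dir_ray Ox)).
by rewrite subr_gt0 hx lerBlDr lerDl.
Qed.

(* A minimizer at a point of the open segment realizes equality in the triangle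
   inequality, so it lies on the same line; both open segments being in [Omega],
   it is the same endpoint. *)
Lemma flow_selector h x : Omega x -> h < len x -> 0 <= h -> T (flow h x) = T x.
Proof.
move=> Ox hx; rewrite le_eqVlt => /orP[/eqP <-|h0].
  by rewrite /flow scale0r subr0.
have Oz := flow_interior Ox hx (ltW h0).
have re := dir_ray Ox; have [_ _ s0 e1 xE] := re; have en1 := enorm_unit e1.
have [z zE] : exists z, z = flow h x by eexists.
rewrite -zE in Oz *.
have zE' : z = T x + (len x - h) *: dir x by rewrite zE flowE.
have [w wE] : exists w, w = z - T z by eexists.
have xz : x - T z = h *: dir x + w by rewrite wE zE /flow; vec.
have [_ zmin] := Tsel Oz; have [_ xmin] := Tsel Ox.
have := zmin _ (proj1 (Tsel Ox)); have := xmin _ (proj1 (Tsel Oz)).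
rewrite -/(len x) -wE xz (_ : z - T x = (len x - h) *: dir x); last by rewrite zE'; vec.
rewrite enormZ en1 mulr1 gtr0_norm ?subr_gt0//.
move=> h1 h2.
have h3 : h + enorm w <= enorm (h *: dir x + w) by lra.
have ew : enorm w <= dot (dir x) w.
  rewrite -(ler_pM2l h0).
  have : (h + enorm w) ^+ 2 <= enorm (h *: dir x + w) ^+ 2.
    by rewrite ler_sqr ?nnegrE ?addr_ge0 ?enorm_ge0 ?(ltW h0).
  by rewrite sqr_enormD enormZ en1 mulr1 gtr0_norm// dotZl; lra.
have wdir : w = enorm w *: dir x.
  apply/eqP; rewrite -subr_eq0 -enorm_eq0 -sqrf_eq0 eq_le sqr_ge0 andbT.
  rewrite -scaleNr sqr_enormD enormZ en1 mulr1 dotZr (dotC w) normrN ger0_norm ?enorm_ge0//.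
  have := ler_wpM2l (enorm_ge0 w) ew; lra.
have TzE : T z = T x + (len x - h - enorm w) *: dir x.
  rewrite (_ : T z = z - w); last by rewrite wE; vec.
  by rewrite {1}wdir zE'; vec.
have [lt|gt|eq] := ltgtP (enorm w) (len x - h).
- exfalso; apply: (TO Oz); rewrite TzE.
  apply: (optimal_ray_interior oO lam0 lam1 gL re).
  by rewrite subr_gt0 lt /=; have := enorm_ge0 w; lra.
- exfalso; apply: (TO Ox).
  have rz : optimal_ray Omega g z (T z) (enorm w) (dir x).
    by split=> //; [exact: Tsel|lra|rewrite TzE zE'; vec].
  have -> : T x = T z + (enorm w - (len x - h)) *: dir x by rewrite TzE; vec.
  apply: (optimal_ray_interior oO lam0 lam1 gL rz).
  by rewrite subr_gt0 gt /=; lra.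
- by rewrite TzE eq subrr scale0r addr0.
Qed.

Lemma flow_len h x : Omega x -> h < len x -> 0 <= h -> len (flow h x) = len x - h.
Proof.
move=> Ox hx h0; rewrite /len flow_selector// -/(len x) flowE// addrAC subrr add0r enormZ.
have [_ _ _ /enorm_unit -> _] := dir_ray Ox.
by rewrite mulr1 gtr0_norm// subr_gt0.
Qed.

Lemma flow_dir h x : Omega x -> h < len x -> 0 <= h -> dir (flow h x) = dir x.
Proof.
move=> Ox hx h0; rewrite {1}/dir flow_len// flow_selector// flowE// addrAC subrr add0r.
by rewrite scalerA mulVf ?scale1r// gt_eqF// subr_gt0.
Qed.

End flow.

(** * Measure-theoretic tools *)

Section measure_tools.
Context {R : realType}.
Local Open Scope ereal_scope.

Lemma measure_of_sigma_additive d (X : measurableType d) (mu : set X -> \bar R) :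
  mu set0 = 0 -> (forall A, 0 <= mu A) -> semi_sigma_additive mu ->
  exists nu : {measure set X -> \bar R}, forall A, nu A = mu A.
Proof.
move=> mu0 mup mus; pose M := isMeasure.Build _ _ _ mu mu0 mup mus.
by pose nu : {measure set X -> \bar R} := HB.pack mu M; exists nu.
Qed.

Lemma nonincreasing_measure_lt d (X : measurableType d) (m : {measure set X -> \bar R})
    (F : (set X)^nat) (e : \bar R) : m setT < +oo -> (forall n, measurable (F n)) ->
  (forall n k, (n <= k)%N -> F k `<=` F n) -> m (\bigcap_n F n) < e -> exists n, m (F n) < e.
Proof.
move=> moo mF dF mFe.
have cvF : (m \o F) x @[x --> \oo] --> m (\bigcap_n F n).
  apply: nonincreasing_cvg_mu => //; first apply: le_lt_trans moo.
  - by apply: le_measure; rewrite ?inE.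
  - exact: bigcap_measurableType.
  - by move=> n k nk; apply/subsetPset/dF.
have /cvF[N _ NP] : nbhs (m (\bigcap_n F n)) [set y | y < e].
  by apply: open_nbhs_nbhs; split=> //; exact: open_ereal_lt_ereal.
by exists N; exact: (NP N (leqnn N)).
Qed.

End measure_tools.

(** * Regularity of finite Borel measures *)

Section regularity.
Context {R : realType} {d : nat}.
Implicit Types A C U : set 'rV[R]_d.
Local Open Scope ereal_scope.

Lemma closed_measurable_rV C : closed C -> measurable C.
Proof.
by move=> /closed_openC/open_measurable_rV/measurableC; rewrite setCK.
Qed.

Definition inner_approx U (n : nat) : set 'rV[R]_d :=
  [set x | forall y, ~ U y -> (n.+1%:R^-1 <= enorm (x - y))%R].

Lemma inner_approx_closed U n : closed (inner_approx U n).
Proof.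
have -> : inner_approx U n = \bigcap_(y in ~` U) ~` eball y n.+1%:R^-1.
  apply/seteqP; split=> x /= H y Uy; last by rewrite leNgt; apply/negP/H.
  by apply/negP; rewrite -leNgt; exact: H.
by apply: closed_bigI => y _; apply: open_closedC; exact: eball_open.
Qed.

Lemma inner_approx_sub U n : inner_approx U n `<=` U.
Proof.
move=> x H; apply: contrapT => /H; rewrite subrr enorm0 leNgt invr_gt0 ltr0Sn//.
Qed.

Lemma inner_approx_mono U n k : (n <= k)%N -> inner_approx U n `<=` inner_approx U k.
Proof.
by move=> nk x H y /H; apply: le_trans; rewrite lef_pV2 ?posrE// ler_nat.
Qed.

Lemma bigcup_inner_approx U : open U -> \bigcup_n inner_approx U n = U.
Proof.
move=> oU; apply/seteqP; split=> [x [n _]|x Ux]; first exact: inner_approx_sub.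
have [e e0 eU] := open_enorm_ball oU Ux.
have [n _ /(_ n (leqnn n)) /= ne] := near_infty_natSinv_lt (PosNum e0).
exists n => // y nUy; rewrite leNgt; apply/negP => h; apply: nUy; apply: eU.
by rewrite enormB; apply: lt_trans h ne.
Qed.

(** The sets that can be approximated from both sides form a sigma-algebra that contains the open
    sets. Complements exchange the roles of [C] and [U]. *)
Lemma finite_measure_regular (m : {measure set 'rV[R]_d -> \bar R}) : m setT < +oo ->
  forall A, measurable A -> forall e : R, (0 < e)%R ->
  exists C U, [/\ closed C, open U, C `<=` A, A `<=` U & m (U `\` C) < e%:E].
Proof.
move=> moo; apply: smallest_sub; last first.
  move=> U oU e e0.
  have [n|n k nk||N mN] := @nonincreasing_measure_lt _ _ _ m (fun n => U `\` inner_approx U n) e%:E moo.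
  - apply: measurableD; first exact: open_measurable_rV.
    by apply: closed_measurable_rV; exact: inner_approx_closed.
  - by apply: setDS; exact: inner_approx_mono.
  - rewrite (_ : \bigcap_n _ = set0) ?measure0 ?lte_fin//.
    apply/seteqP; split=> // x H; have [Ux _] := H 0%N I.
    move: Ux; rewrite -{1}(bigcup_inner_approx oU) => -[n _ xn].
    by have [] := H n I.
  exists (inner_approx U N), U; split=> //; first exact: inner_approx_closed.
  exact: inner_approx_sub.
split.
- move=> e e0; exists set0, set0; split=> //; try exact: closed0; try exact: open0.
  by rewrite setD0 measure0 lte_fin.
- move=> A HA e /HA[C [U [cC oU CA AU mUC]]].
  exists (~` U), (~` C); split.
  + exact: open_closedC.
  + exact: closed_openC.
  + by rewrite setTD; exact: subsetC.
  + by rewrite setTD; exact: subsetC.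
  + by rewrite setDE setCK setIC -setDE.
- move=> A HA e e0.
  have e20 : (0 < e / 2)%R by rewrite divr_gt0.
  have /choice[CU CUP] (i : nat) : exists CU : set 'rV[R]_d * set 'rV[R]_d,
      [/\ closed CU.1, open CU.2, CU.1 `<=` A i, A i `<=` CU.2 &
      m (CU.2 `\` CU.1) < (e / 2 / (2 ^ i.+1)%:R)%:E].
    have [|C [U ?]] := HA i (e / 2 / (2 ^ i.+1)%:R)%R; last by exists (C, U).
    by rewrite divr_gt0// ltr0n expn_gt0.
  have mC i : measurable (CU i).1 by apply: closed_measurable_rV; have [] := CUP i.
  have mU i : measurable (CU i).2 by apply: open_measurable_rV; have [] := CUP i.
  pose V := \bigcup_i (CU i).2.
  have mV : measurable V by exact: bigcupT_measurable.
  have mB n : measurable (\bigcup_(i in `I_n) (CU i).1).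
    exact: bigcup_measurable.
  (* A countable union of closed sets may fail to be closed; continuity from above allows keeping
     only the first [N] of them. *)
  have [n|n k nk||N mN] := @nonincreasing_measure_lt _ _ _ m
    (fun n => V `\` \bigcup_(i in `I_n) (CU i).1) e%:E moo.
  - exact: measurableD.
  - by apply: setDS => x [i /= ik xi]; exists i => //=; exact: leq_trans nk.
  - apply: (@le_lt_trans _ _ (e / 2)%:E); last by rewrite lte_fin ltr_pdivrMr// ltr_pMr// ltr1n.
    apply: (@le_trans _ _ (\sum_(0 <= i <oo) m ((CU i).2 `\` (CU i).1))).
      apply: measure_sigma_subadditive => [i||x H]; first exact: measurableD.
        by apply: bigcap_measurableType => // n _; exact: measurableD.
      have [[i _ xi] _] := H 0%N I; exists i => //; split=> // xC.
      by have [_ nx] := H i.+1 I; apply: nx; exists i => /=.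
    apply: (@le_trans _ _ (\sum_(0 <= i <oo) (0 + (e / 2 / (2 ^ i.+1)%:R)%:E))).
      by apply: lee_nneseries => // i _; rewrite add0e; apply: ltW; have [] := CUP i.
    apply: le_trans (epsilon_trick xpredT (fun=> lexx 0) (ltW e20)) _.
    by rewrite eseries0// add0e.
  exists (\bigcup_(i in `I_N) (CU i).1), V; split=> //.
  + by apply: closed_bigcup => [|i _]; [exact: finite_II|have [] := CUP i].
  + by apply: bigcup_open => i _; have [] := CUP i.
  + move=> x [i _ xi]; exists i => //.
    by have [_ _ + _ _] := CUP i; exact.
  + move=> x [i _ xi]; exists i => //.
    by have [_ _ _ + _] := CUP i; exact.
Qed.

End regularity.

(** * Grids of cubes and comparison with Lebesgue measure *)

Section cells.
Context {R : realType} {d : nat}.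
Local Open Scope ereal_scope.
Local Notation leb := (lebesgue_rV (R := R) d).

Lemma box_measurable (A : 'I_d -> set R) : (forall i, measurable (A i)) ->
  measurable [set v : 'rV[R]_d | forall i, A i (v ord0 i)].
Proof.
move=> mA.
have -> : [set v : 'rV[R]_d | forall i, A i (v ord0 i)] = \bigcap_(i in [set: 'I_d])
    ((fun v : 'rV[R]_d => v ord0 i) @^-1` A i).
  by apply/seteqP; split=> t /= h i; [move=> _|]; exact: h.
apply: fin_bigcap_measurable => // i _; rewrite -[X in measurable X]setTI.
exact: measurable_coord_rV.
Qed.

(** The boolean sides cover both the half-open cells of the grids and the closed cubes. *)
Lemma lebesgue_cube (a : 'I_d -> R) (rho : R) (b0 b1 : bool) : (0 <= rho)%R ->
  leb [set v | forall i, v ord0 i \in Interval (BSide b0 (a i)) (BSide b1 (a i + rho)%R)] =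
  (rho ^+ d)%:E.
Proof.
move=> rho0.
rewrite (lebesgue_rV_box (A := fun i => [set` Interval (BSide b0 (a i)) (BSide b1 (a i + rho)%R)]))//.
rewrite (eq_bigr (fun=> rho%:E)) => [|i _].
  by rewrite prodEFin prodr_const card_ord.
rewrite lebesgue_measure_itv /= lte_fin; case: ltP => [_|].
  by rewrite -EFinB addrAC subrr add0r.
rewrite -[X in (_ <= X)%R]addr0 lerD2l => h.
by congr EFin; apply/eqP; rewrite eq_le rho0 h.
Qed.

Lemma lebesgue_bounded_lty (A : set 'rV[R]_d) : measurable A -> bounded_set A -> leb A < +oo.
Proof.
move=> mA [M [_ /(_ (M + 1)%R)]]; rewrite ltrDl ltr01 => /(_ isT) AM.
have M0 : (0 <= `|M| + 1)%R by rewrite addr_ge0.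
have := @lebesgue_cube (fun=> - (`|M| + 1))%R ((`|M| + 1) + (`|M| + 1))%R true false (addr_ge0 M0 M0).
move=> H; apply: (@le_lt_trans _ _ ((`|M| + 1 + (`|M| + 1)) ^+ d)%:E); last exact: ltry.
rewrite -H; apply: le_measure; rewrite ?inE//.
  exact: (box_measurable (A := fun i => [set` Interval _ _])).
move=> v /AM /= vM i; rewrite in_itv /= addKr -ler_norml.
apply: le_trans (coord_le_norm _ _) _; apply: le_trans vM _.
by rewrite lerD2r ler_norm.
Qed.

Definition cell (n : nat) (k : {ffun 'I_d -> int}) : set 'rV[R]_d :=
  [set v | forall i, v ord0 i \in `[((k i)%:~R / n.+1%:R)%R, ((k i)%:~R / n.+1%:R + n.+1%:R^-1)%R[].

Definition cell_index (n : nat) (v : 'rV[R]_d) : {ffun 'I_d -> int} :=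
  [ffun i => Num.floor (v ord0 i * n.+1%:R)].

Lemma mem_cellP n k v : cell n k v <-> k = cell_index n v.
Proof.
split=> [vk|->].
  apply/ffunP => i; rewrite ffunE; apply/esym/floor_def; have := vk i; rewrite in_itv /=.
  by rewrite -[X in (_ + X)%R]div1r -mulrDl ler_pdivrMr// ltr_pdivlMr// intrD.
move=> i; rewrite ffunE in_itv /= -[X in (_ + X)%R]div1r -mulrDl ler_pdivrMr// ltr_pdivlMr//.
by have := floor_itv (v ord0 i * n.+1%:R); rewrite intrD.
Qed.

Lemma cell_measurable n k : measurable (cell n k).
Proof. exact: (box_measurable (A := fun i => [set` Interval _ _])). Qed.

Lemma lebesgue_cell n k : leb (cell n k) = (n.+1%:R^-1 ^+ d)%:E.
Proof. by apply: lebesgue_cube; rewrite invr_ge0. Qed.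

Lemma cell_dist n k v w : cell n k v -> cell n k w ->
  (enorm (v - w) <= d%:R * n.+1%:R^-1)%R.
Proof.
move=> vk wk; apply: enorm_le_coords => [|i]; first by rewrite invr_ge0.
have := vk i; have := wk i; rewrite !in_itv /= !mxE ler_norml.
move=> /andP[h1 h2] /andP[h3 h4]; apply/andP; split.
  by rewrite lerBrDr addrC lerBlDr (le_trans (ltW h2))// lerD2r.
by rewrite lerBlDr addrC (le_trans (ltW h4))// lerD2r.
Qed.

(** The cells indexed by natural numbers, for countable sums. The test rejects a number that decodes
    to [k] without being its code, so that each cell occurs once. *)
Definition cellN (n m : nat) : set 'rV[R]_d :=
  if (unpickle m : option {ffun 'I_d -> int}) is Some k then
    if pickle k == m then cell n k else set0
  else set0.

Lemma cellN_measurable n m : measurable (cellN n m).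
Proof.
by rewrite /cellN; case: unpickle => [k|//]; case: ifP => // _; exact: cell_measurable.
Qed.

Lemma cellN_trivIset n D : trivIset D (cellN n).
Proof.
apply/trivIsetP => m1 m2 _ _; apply: contraNeq => /set0P[v []]; rewrite /cellN.
case: unpickle => [k1|//]; case: ifP => // /eqP <- /mem_cellP ->.
by case: unpickle => [k2|//]; case: ifP => // /eqP <- /mem_cellP ->.
Qed.

Lemma cellN_index n v : cellN n (pickle (cell_index n v)) v.
Proof. by rewrite /cellN pickleK eqxx; apply/mem_cellP. Qed.

Lemma cellN_dist n m v w : cellN n m v -> cellN n m w ->
  (enorm (v - w) <= d%:R * n.+1%:R^-1)%R.
Proof. by rewrite /cellN; case: unpickle => [k|//]; case: ifP => // _; exact: cell_dist. Qed.

Variables (nu : {measure set 'rV[R]_d -> \bar R}) (K : R).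
Hypotheses (K0 : (0 <= K)%R) (nuK : forall n k, nu (cell n k) <= K%:E * leb (cell n k)).

(** The open set is exhausted by the grid cells that it contains, and the cells of one grid are
    disjoint. *)
Lemma measure_le_open (U : set 'rV[R]_d) : open U -> nu U <= K%:E * leb U.
Proof.
move=> oU; have mU := open_measurable_rV oU.
pose D n : set nat := [set m | cellN n m `<=` U].
pose V n := \bigcup_(m in D n) cellN n m.
have mV n : measurable (V n) by apply: bigcup_measurable => m _; exact: cellN_measurable.
have VU n : V n `<=` U by move=> v [m Dm]; exact: Dm.
have VK n : nu (V n) <= K%:E * leb U.
  apply: (@le_trans _ _ (K%:E * leb (V n))); last first.
    by rewrite lee_wpmul2l ?lee_fin//; apply: le_measure; rewrite ?inE.
  rewrite /V (measure_bigcup nu _ _ (fun i _ => cellN_measurable n i) (@cellN_trivIset n (D n))).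
  rewrite (measure_bigcup leb _ _ (fun i _ => cellN_measurable n i) (@cellN_trivIset n (D n))).
  rewrite -nneseriesZl//; apply: lee_nneseries => // m _.
  rewrite /cellN; case: unpickle => [k|]; last by rewrite !measure0 mule0.
  by case: ifP => _; [exact: nuK|rewrite !measure0 mule0].
(* Grids of sides [1 / (n + 1)] are not nested and [V] need not be monotone; the intersections of
   its tails are. *)
pose W n := \bigcap_(k in [set k | (n <= k)%N]) V k.
have mW n : measurable (W n) by apply: bigcap_measurableType.
have WU : \bigcup_n W n = U.
  apply/seteqP; split=> [v [n _ /(_ n (leqnn n))]|v Uv]; first exact: VU.
  have [e e0 eU] := open_enorm_ball oU Uv.
  have d0 : (0 < d%:R + 1 :> R)%R by rewrite ltr_wpDl.
  have [N _ NP] := near_infty_natSinv_lt (PosNum (divr_gt0 e0 d0)).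
  exists N => // n Nn; exists (pickle (cell_index n v)); last exact: cellN_index.
  move=> w vw; apply: eU; apply: le_lt_trans (cellN_dist vw (cellN_index n v)) _.
  have := NP n Nn; rewrite /= ltr_pdivlMr// mulrC; apply: le_lt_trans.
  by rewrite ler_wpM2r ?invr_ge0// lerDl.
have cvW : (nu \o W) x @[x --> \oo] --> nu (\bigcup_n W n).
  apply: nondecreasing_cvg_mu => //; first by rewrite WU.
  move=> n k nk; apply/subsetPset => v H j kj; apply: H; exact: leq_trans kj.
rewrite -[in leLHS]WU; apply: (cvge_le _ cvW); apply: nearW => n /=.
apply: le_trans (VK n); apply: le_measure; rewrite ?inE//.
by move=> v; apply => /=.
Qed.

(** Outer regularity passes from open sets to Borel sets. It is applied to Lebesgue measure on the
    bounded set [W], which is finite and carries all the mass of [nu]. *)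
Lemma measure_le_lebesgue (W : set 'rV[R]_d) : open W -> bounded_set W -> nu (~` W) = 0 ->
  forall A, measurable A -> nu A <= K%:E * leb A.
Proof.
move=> oW bW nuW A mA; have mW := open_measurable_rV oW.
have leW : leb W < +oo by exact: lebesgue_bounded_lty.
pose m : {measure set 'rV[R]_d -> \bar R} := [the measure _ _ of mrestr leb mW].
have moo : m setT < +oo by rewrite /m /= /mrestr setTI.
apply/lee_addgt0Pr => e e0.
have e1 : (0 < e / (K + 1))%R by rewrite divr_gt0// ltr_wpDl.
have [C [U [cC oU CA AU mUC]]] := finite_measure_regular moo mA e1.
have mU := open_measurable_rV oU; have mC := closed_measurable_rV cC.
apply: (@le_trans _ _ (nu (U `&` W))).
  apply: (@le_trans _ _ (nu ((A `&` W) `|` ~` W))).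
    apply: le_measure; rewrite ?inE//.
      by apply: measurableU; [exact: measurableI|exact: measurableC].
    by move=> v Av; have [Wv|Wv] := pselect (W v); [left|right].
  apply: (@le_trans _ _ (nu (A `&` W) + nu (~` W))).
    by apply: measureU2; [exact: measurableI|exact: measurableC].
  rewrite nuW adde0; apply: le_measure; rewrite ?inE; try exact: measurableI.
  exact: setSI.
apply: le_trans (measure_le_open (openI oU oW)) _.
apply: (@le_trans _ _ (K%:E * (leb A + (e / (K + 1))%:E))).
  rewrite lee_wpmul2l ?lee_fin//.
  apply: (@le_trans _ _ (leb (A `|` ((U `\` C) `&` W)))).
    have mUCW : measurable ((U `\` C) `&` W) by apply: measurableI => //; exact: measurableD.
    apply: le_measure; rewrite ?inE; [exact: measurableI|exact: measurableU|].
    move=> v [Uv Wv]; have [Cv|Cv] := pselect (C v); first by left; exact: CA.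
    by right.
  apply: le_trans (measureU2 _ _ _) _ => //.
    by apply: measurableI => //; exact: measurableD.
  rewrite leeD2l// ltW//.
rewrite muleDr ?ge0_adde_def ?inE ?lee_fin ?(ltW e1)// leeD2l// -EFinM lee_fin.
rewrite mulrA ler_pdivrMr ?ltr_wpDl// mulrC ler_wpM2l ?(ltW e0)//.
by rewrite lerDl.
Qed.

End cells.

Lemma restricted_pushforward (R : realType) dX dY (X : measurableType dX)
    (Y : measurableType dY) (mu : {measure set X -> \bar R}) (E : set X) (S : X -> Y) :
  measurable E -> measurable_fun setT S ->
  exists nu : {measure set Y -> \bar R}, forall A, nu A = mu (E `&` S @^-1` A).
Proof.
move=> mE mS.
have mSA A : measurable A -> measurable (S @^-1` A).
  by move=> mA; rewrite -[X in measurable X]setTI; exact: mS.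
apply: (measure_of_sigma_additive (mu := fun A => mu (E `&` S @^-1` A))) => [|A|F mF tF mUF].
- by rewrite preimage_set0 setI0 measure0.
- exact: measure_ge0.
rewrite preimage_bigcup setI_bigcupr; apply: measure_semi_sigma_additive.
- by move=> i; apply: measurableI => //; exact: mSA.
- by apply/trivIsetP => i j _ _ ij; rewrite setIACA setIid -preimage_setI;
    move/trivIsetP : tF => /(_ _ _ I I ij) ->; rewrite preimage_set0 setI0.
- by rewrite -setI_bigcupr -preimage_bigcup; apply: measurableI => //; exact: mSA.
Qed.

(** * Measurability of vector-valued maps *)

Section measurable_rV.
Context {R : realType} {d : nat} {dX : measure_display} {X : measurableType dX}.
Implicit Types (f g : X -> 'rV[R]_d) (a : X -> R).

Lemma measurable_rV_coord f i : measurable_fun setT f ->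
  measurable_fun setT (fun t => f t ord0 i).
Proof. by move=> mf; exact: (measurableT_comp (measurable_coord_rV i) mf). Qed.

Lemma measurable_rV_add f g : measurable_fun setT f -> measurable_fun setT g ->
  measurable_fun setT (fun t => f t + g t).
Proof.
move=> mf mg; apply: measurable_fun_rVP => i; under eq_fun do rewrite mxE.
by apply: measurable_funD; exact: measurable_rV_coord.
Qed.

Lemma measurable_rV_scale a f : measurable_fun setT a -> measurable_fun setT f ->
  measurable_fun setT (fun t => a t *: f t).
Proof.
move=> ma mf; apply: measurable_fun_rVP => i; under eq_fun do rewrite mxE.
by apply: measurable_funM => //; exact: measurable_rV_coord.
Qed.

Lemma measurable_rV_sub f g : measurable_fun setT f -> measurable_fun setT g ->
  measurable_fun setT (fun t => f t - g t).
Proof.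
move=> mf mg; under eq_fun do rewrite -scaleN1r.
by apply: measurable_rV_add => //; apply: measurable_rV_scale.
Qed.

Lemma continuous_measurable_rV (phi : 'rV[R]_d -> R) :
  continuous phi -> measurable_fun setT phi.
Proof.
move=> cphi; apply: (measurability _ (RGenOInfty.measurableE R)).
move=> _ [_ [a ->] <-]; rewrite setTI; apply: open_measurable_rV.
by apply: open_comp; last exact: interval_open.
Qed.

Lemma measurable_enorm f : measurable_fun setT f -> measurable_fun setT (fun t => enorm (f t)).
Proof.
move=> mf; apply: (measurableT_comp _ mf); apply: continuous_measurable_rV.
apply: (@lipschitz_enorm_continuous _ _ _ 1) => x y.
by rewrite mul1r enorm_lipschitz.
Qed.

Lemma measurable_setlt a (b : X -> R) : measurable_fun setT a -> measurable_fun setT b ->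
  measurable [set t | a t < b t].
Proof.
move=> ma mb; rewrite -[X in measurable X]setTI.
by apply: (measurable_fun_ltr ma mb measurableT (Y := [set true])).
Qed.

Lemma measurable_preimage_rV f (A : set 'rV[R]_d) : measurable_fun setT f -> measurable A ->
  measurable (f @^-1` A).
Proof. by move=> mf mA; rewrite -[X in measurable X]setTI; exact: mf. Qed.

End measurable_rV.

(** * Preimages under expanding maps *)

Section expanding.
Context {R : realType} {d : nat}.
Local Notation leb := (lebesgue_rV (R := R) d).
Implicit Types (E P A W : set 'rV[R]_d) (S : 'rV[R]_d -> 'rV[R]_d).

(** Expansion bounds the diameter of [E] by [rho = d / ((n + 1) c)], so [E] lies in the cube of side
    [2 rho] centered at any of its points. *)
Lemma lebesgue_preimage_cell E S (c : R) n k : 0 < c -> measurable E ->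
  (forall x z, E x -> E z -> c * enorm (x - z) <= enorm (S x - S z)) ->
  E `<=` S @^-1` cell n k -> (leb E <= ((2 * d%:R / c) ^+ d)%:E * leb (cell n k))%E.
Proof.
move=> c0 mE Sc ES; have [[x0 Ex0]|/set0P/negP] := pselect (E !=set0); last first.
  rewrite negbK => /eqP ->; rewrite measure0; apply: mule_ge0 => //.
  by rewrite lee_fin exprn_ge0// divr_ge0 ?mulr_ge0// ltW.
have [rho rhoE] : exists rho : R, rho = d%:R * n.+1%:R^-1 / c by eexists.
have rho0 : 0 <= rho by rewrite rhoE divr_ge0 ?mulr_ge0 ?invr_ge0// ltW.
have cub := @lebesgue_cube R d (fun i => x0 ord0 i - rho) (rho + rho) true false (addr_ge0 rho0 rho0).
rewrite lebesgue_cell -EFinM -exprMn (_ : 2 * d%:R / c / n.+1%:R = rho + rho); last first.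
  by rewrite rhoE; ring.
rewrite -cub; apply: le_measure; rewrite ?inE//.
  exact: (box_measurable (A := fun i => [set` Interval _ _])).
move=> x Ex i; have : `|(x - x0) ord0 i| <= rho.
  apply: le_trans (coord_le_enorm _ _) _; rewrite rhoE ler_pdivlMr// mulrC.
  apply: le_trans (Sc _ _ Ex Ex0) _; exact: cell_dist (ES _ Ex) (ES _ Ex0).
rewrite !mxE ler_norml in_itv /= => /andP[h1 h2].
by apply/andP; split; lra.
Qed.

Lemma lebesgue_preimage_expanding E S W (c : R) : 0 < c -> measurable E ->
  measurable_fun setT S -> open W -> bounded_set W -> E `<=` S @^-1` W ->
  (forall x z, E x -> E z -> c * enorm (x - z) <= enorm (S x - S z)) ->
  forall A, measurable A -> (leb (E `&` S @^-1` A) <= ((2 * d%:R / c) ^+ d)%:E * leb A)%E.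
Proof.
move=> c0 mE mS oW bW EW Sc A mA; have [nu nuE] := restricted_pushforward leb mE mS.
rewrite -nuE; apply: (measure_le_lebesgue _ _ oW bW) => //.
- by rewrite exprn_ge0// divr_ge0 ?mulr_ge0// ltW.
- move=> n k; rewrite nuE; apply: lebesgue_preimage_cell => //.
  + by apply: measurableI => //; apply: measurable_preimage_rV => //; exact: cell_measurable.
  + by move=> x z [Ex _] [Ez _]; exact: Sc.
- rewrite nuE (_ : _ `&` _ = set0) ?measure0//.
  by apply/seteqP; split=> // x [/EW].
Qed.

End expanding.

(** * Countable covering by convex boxes *)

Section rat_boxes.
Context {R : realType} {d : nat}.
Variable (U : set 'rV[R]_d).

Definition rat_boxN (m : nat) : set 'rV[R]_d :=
  if (unpickle m : option ('rV[rat]_d * nat)) is Some qk then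
    if `[< rat_box (R := R) qk `<=` U >] then rat_box qk else set0
  else set0.

Lemma rat_boxN_measurable m : measurable (rat_boxN m).
Proof.
rewrite /rat_boxN; case: unpickle => [qk|//]; case: ifP => // _.
apply: (box_measurable (A := fun i => ball (ratr (qk.1 ord0 i) : R) qk.2.+1%:R^-1)) => i.
exact: measurable_ball.
Qed.

Lemma rat_boxN_sub m : rat_boxN m `<=` U.
Proof.
move=> v; rewrite /rat_boxN; case: unpickle => [qk|//].
by case: ifPn => [/asboolP H /H|].
Qed.

Lemma bigcup_rat_boxN : open U -> \bigcup_m rat_boxN m = U.
Proof.
move=> oU; apply/seteqP; split=> [v [m _ /rat_boxN_sub//]|v].
rewrite {1}(open_bigcup_rat_box oU) => -[qk qkU vqk].
by exists (pickle qk) => //; rewrite /rat_boxN pickleK asboolT.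
Qed.

(** Supplies the segments inside [Omega] that [flow_expansion] asks for. *)
Lemma rat_boxN_convex m x z (t : R) : 0 <= t <= 1 -> rat_boxN m x -> rat_boxN m z ->
  rat_boxN m (x + t *: (z - x)).
Proof.
move=> /andP[t0 t1]; rewrite /rat_boxN; case: unpickle => [qk|//]; case: ifP => // _.
move=> xb zb i; have := xb i; have := zb i; rewrite -!ball_normE /= !mxE.
move: (ratr _) (_^-1) => q e; rewrite !ltr_distl => /andP[h1 h2] /andP[h3 h4].
have [xz|zx] := leP (x ord0 i) (z ord0 i).
  have : 0 <= t * (z ord0 i - x ord0 i) by rewrite mulr_ge0// subr_ge0.
  have : t * (z ord0 i - x ord0 i) <= 1 * (z ord0 i - x ord0 i) by rewrite ler_wpM2r// subr_ge0.
  by move=> h5 h6; apply/andP; split; lra.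
have : 0 <= t * (x ord0 i - z ord0 i) by rewrite mulr_ge0// subr_ge0 ltW.
have : t * (x ord0 i - z ord0 i) <= 1 * (x ord0 i - z ord0 i).
  by rewrite ler_wpM2r// subr_ge0 ltW.
by move=> h5 h6; apply/andP; split; lra.
Qed.

End rat_boxes.

(** * Volume distortion of the flow *)

Section flow_measure.
Context {R : realType} {d : nat}.
Local Notation leb := (lebesgue_rV (R := R) d).
Variables (Omega : set 'rV[R]_d) (g : 'rV[R]_d -> R) (lam r : R)
  (T : 'rV[R]_d -> 'rV[R]_d).
Hypotheses (r0 : 0 < r) (rp : round_polyhedron r Omega) (gC2 : C2_closure Omega g)
  (gL : elipschitz_on lam (closure Omega) g) (lam1 : lam < 1)
  (Tsel : forall x, Omega x -> argmin_boundary Omega g x (T x))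
  (mT : measurable_fun setT T).
Local Notation len := (len T).
Local Notation dir := (dir T).
Local Notation flow := (flow T).

Implicit Types (h t : R) (x z : 'rV[R]_d) (A E : set 'rV[R]_d).

Let oO : open Omega. Proof. by case: rp => -[]. Qed.
Let bO : bounded_set Omega. Proof. by case: rp. Qed.

Lemma measurable_len : measurable_fun setT len.
Proof. by apply: measurable_enorm; apply: measurable_rV_sub. Qed.

Lemma measurable_dir : measurable_fun setT dir.
Proof.
apply: measurable_rV_scale; last exact: measurable_rV_sub.
have -> : (fun x => (len x)^-1) = (fun a => a `^ (-1)) \o len.
  by apply/funext => x /=; rewrite powR_inv1// enorm_ge0.
exact: measurableT_comp (measurable_powR _) measurable_len.
Qed.

Lemma measurable_flow2 : measurable_fun setT (fun hx : R * 'rV[R]_d => flow hx.1 hx.2).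
Proof.
apply: measurable_rV_sub; first exact: measurable_snd.
apply: measurable_rV_scale; first exact: measurable_fst.
exact: measurableT_comp measurable_dir measurable_snd.
Qed.

Lemma measurable_flow h : measurable_fun setT (flow h).
Proof.
apply: measurable_rV_sub => //; apply: measurable_rV_scale => //.
exact: measurable_dir.
Qed.

Definition flow_preimage E h A : set 'rV[R]_d :=
  [set x | [/\ E x, h < len x & A (flow h x)]].

Lemma flow_preimage_measurable E h A : measurable E -> measurable A ->
  measurable (flow_preimage E h A).
Proof.
move=> mE mA.
rewrite (_ : flow_preimage E h A = E `&` ([set x | cst h x < len x] `&` flow h @^-1` A)); last first.
  by apply/seteqP; split=> x /= [] // ? [].
apply: measurableI => //; apply: measurableI.
  by apply: measurable_setlt => //; exact: measurable_len.
by apply: measurable_preimage_rV => //; exact: measurable_flow.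
Qed.

(* [z + h dir z] recovers [x] from [z = flow h x]; hence the images of disjoint
   sets lie in disjoint measurable sets. *)
Lemma lebesgue_flow_step : exists2 h0 : R, 0 < h0 & exists2 K : R, 0 <= K &
  forall h, 0 <= h -> h <= h0 -> forall A, measurable A ->
  (leb (flow_preimage Omega h A) <= K%:E * leb A)%E.
Proof.
have [C C0 exC] := flow_expansion r0 rp gC2 gL lam1 Tsel.
(* For such [h] the factor [1 - C h] is at least [1 / 2], which exceeds the square of the expansion
   rate [1 / 2] used below. *)
exists (2 * C)^-1; first by rewrite invr_gt0 mulr_gt0.
have c0 : (0 : R) < 1 / 2 by rewrite divr_gt0.
exists ((2 * d%:R / (1 / 2)) ^+ d) => [|h h_ge0 hh0 A mA].
  by rewrite exprn_ge0// divr_ge0 ?mulr_ge0// ltW.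
have mOmega := open_measurable_rV oO.
pose P m := rat_boxN Omega m.
have mP m : measurable (P m) by exact: rat_boxN_measurable.
have PO m : P m `<=` Omega by exact: rat_boxN_sub.
(* Expansion holds on the convex box [P m]; its part in [seqDU P] inherits it, and these parts are
   disjoint. *)
pose E m := flow_preimage (seqDU P m) h setT.
have mE m : measurable (E m).
  by apply: flow_preimage_measurable => //; exact: seqDU_measurable.
have mPhi : measurable_fun setT (fun z => z + h *: dir z).
  apply: measurable_rV_add => //; apply: measurable_rV_scale => //; exact: measurable_dir.
pose B m := A `&` (fun z => z + h *: dir z) @^-1` seqDU P m.
have mB m : measurable (B m).
  by apply: measurableI => //; apply: measurable_preimage_rV => //; exact: seqDU_measurable.
have sPP m : seqDU P m `<=` P m by exact: subDsetl.
have tB : trivIset setT B.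
  apply/trivIsetP => i j _ _ ij; rewrite setIACA setIid -preimage_setI.
  by move/trivIsetP : (trivIset_seqDU P) => /(_ _ _ I I ij) ->; rewrite preimage_set0 setI0.
have EB m : (leb (E m `&` flow h @^-1` B m) <= ((2 * d%:R / (1 / 2)) ^+ d)%:E * leb (B m))%E.
  apply: (lebesgue_preimage_expanding c0 _ _ oO bO) => //; first exact: measurable_flow.
    by move=> x [/sPP/PO Ox hx _]; exact: (flow_interior rp gL lam1 Tsel).
  move=> x z [/sPP xP _ _] [/sPP zP _ _].
  have seg t : 0 <= t <= 1 -> Omega (x + t *: (z - x)).
    by move=> t01; apply: (PO m); exact: rat_boxN_convex.
  rewrite -ler_sqr ?nnegrE ?mulr_ge0 ?enorm_ge0 ?(ltW c0)//.
  apply: le_trans (exC x z h h_ge0 seg).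
  rewrite exprMn ler_wpM2r ?sqr_ge0//.
  have := ler_wpM2l (ltW C0) hh0.
  rewrite (_ : C * (2 * C)^-1 = 1 / 2); first by lra.
  by field; rewrite gt_eqF.
apply: (@le_trans _ _ (\sum_(0 <= m <oo) leb (E m `&` flow h @^-1` B m))%E).
  apply: measure_sigma_subadditive.
  - by move=> m; apply: measurableI => //; apply: measurable_preimage_rV => //; exact: measurable_flow.
  - exact: flow_preimage_measurable.
  - move=> x [Ox hx Ax].
    have [m _ xm] : (\bigcup_m seqDU P m) x by rewrite -seqDU_bigcup_eq bigcup_rat_boxN.
    exists m => //; split=> //; split=> //=.
    rewrite (flow_dir rp gL lam1 Tsel Ox hx h_ge0) (_ : _ + _ = x)//.
    by rewrite /flow subrK.
apply: (@le_trans _ _ (\sum_(0 <= m <oo) ((2 * d%:R / (1 / 2)) ^+ d)%:E * leb (B m))%E).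
  exact: lee_nneseries.
rewrite nneseriesZl// lee_wpmul2l ?lee_fin ?exprn_ge0 ?divr_ge0 ?mulr_ge0//.
have := measure_bigcup leb setT B (fun m _ => mB m) tB.
rewrite (eq_eseriesl (Q := xpredT)) => [<-|m]; last by rewrite in_setT.
apply: le_measure; rewrite ?inE//; first exact: bigcupT_measurable.
by move=> z [m _ []].
Qed.

Lemma len_bounded : exists D : R, forall x, Omega x -> len x <= D.
Proof.
have [M [_ /(_ (M + 1))]] := bO; rewrite ltrDl ltr01 => /(_ isT) OM.
(* The last 1 pays for replacing [T x] by a point of [Omega] near it. *)
exists (d%:R * ((M + 1) + (M + 1)) + 1) => x Ox.
have [[Tc _] _] := Tsel Ox.
have [a Oa aT] := closure_enormP Tc (@ltr01 R).
apply: le_trans (enormDB x a (T x)) _; apply: lerD; last exact: ltW.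
apply: le_trans (enorm_le_norm _) _; rewrite ler_wpM2l//.
by apply: le_trans (ler_normB _ _) _; apply: lerD; exact: OM.
Qed.

(** The time [h] is cut into [N] steps of length at most [h0]. [N] depends only on the bound for
    [len], because for larger [h] the preimage is empty; the constant [K ^+ N] is thus uniform in
    [h]. *)
Lemma lebesgue_flow : exists2 K : R, 0 <= K &
  forall h, 0 <= h -> forall A, measurable A ->
  (leb (flow_preimage Omega h A) <= K%:E * leb A)%E.
Proof.
have [h0 h00 [K K0 step]] := lebesgue_flow_step; have [D lenD] := len_bounded.
have [N [N0 ND]] : exists N : nat, (0 < N)%N /\ `|D| / N%:R <= h0.
  exists (Num.bound (`|D| / h0)).+1; split=> //.
  rewrite ler_pdivrMr// mulrC -ler_pdivrMr//.
  have : 0 <= `|D| / h0 by rewrite divr_ge0// ltW.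
  by move=> /archi_boundP/ltW/le_trans; apply; rewrite ler_nat.
have mOmega := open_measurable_rV oO.
exists (K ^+ N) => [|h h_ge0 A mA]; first by rewrite exprn_ge0.
have [hD|Dh] := leP h `|D|; last first.
  rewrite (_ : flow_preimage _ _ _ = set0).
    by rewrite measure0 mule_ge0// lee_fin exprn_ge0.
  apply/seteqP; split=> // x [/lenD xD hx _]; move: Dh; rewrite ltNge => /negP; apply.
  by apply: le_trans (ltW hx) _; apply: le_trans xD (ler_norm _).
have [k [k0 kh kE]] : exists k : R, [/\ 0 <= k, k <= h0 & N%:R * k = h].
  exists (h / N%:R); rewrite divr_ge0// mulrCA divff ?mulr1 ?pnatr_eq0 -?lt0n//.
  by split=> //; apply: le_trans ND; rewrite ler_wpM2r// invr_ge0.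
rewrite -kE; elim: (N) A mA => [|n IH] A mA.
  rewrite mul0r expr0 mul1e; apply: le_measure; rewrite ?inE//.
    exact: flow_preimage_measurable.
  by move=> x [_ _]; rewrite /flow scale0r subr0.
apply: (@le_trans _ _ (leb (flow_preimage Omega (n%:R * k) (flow_preimage Omega k A)))).
  apply: le_measure; rewrite ?inE.
  - exact: flow_preimage_measurable.
  - by apply: flow_preimage_measurable => //; exact: flow_preimage_measurable.
  move=> x [Ox]; rewrite -natr1 mulrDl mul1r => hx Ax.
  have nk0 : 0 <= n%:R * k by rewrite mulr_ge0.
  have hx' : n%:R * k < len x by lra.
  split=> //; split.
  - exact: (flow_interior rp gL lam1 Tsel).
  - by rewrite (flow_len rp gL lam1 Tsel Ox hx' nk0) ltrBrDl.
  - have -> : flow k (flow (n%:R * k) x) = flow (n%:R * k) x - k *: dir (flow (n%:R * k) x) by [].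
    rewrite (flow_dir rp gL lam1 Tsel Ox hx' nk0).
    by move: Ax; rewrite /flow scalerDl opprD addrA.
apply: le_trans (IH _ _) _; first exact: flow_preimage_measurable.
rewrite exprSr EFinM -muleA lee_wpmul2l ?lee_fin ?exprn_ge0//.
exact: step.
Qed.

End flow_measure.

(** By uniqueness of Lebesgue measure, since both sides agree on the intervals []a, b]]. *)
Lemma lebesgue_scale (R : realType) (s : R) (B : set R) : 0 < s -> measurable B ->
  (lebesgue_measure B = s%:E * lebesgue_measure ((fun t : R => (t * s)%R) @^-1` B))%E.
Proof.
move=> s0 mB; pose m : measurableTypeR R -> measurableTypeR R := fun t : R => t * s.
have mm : measurable_fun setT m by apply: measurable_funM.
have [nu nuE] := restricted_pushforward (@lebesgue_measure R) measurableT mm.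
pose s' : {nonneg R} := NngNum (ltW s0).
rewrite (@lebesgue_measure_unique R [the measure _ _ of mscale s' nu])//.
  by rewrite /= /mscale /= nuE setTI.
move=> X [[a b] _ <-]; rewrite /= /mscale /= nuE setTI.
have mE : m @^-1` `]a, b] = (`]a / s, b / s]%classic : set R).
  by apply/seteqP; split=> t /=; rewrite !in_itv /= ltr_pdivrMr// ler_pdivlMr.
have h2 : lebesgue_measure (m @^-1` `]a, b]) = (if a < b then (b / s - a / s)%:E else 0%E).
  rewrite mE; apply: etrans (lebesgue_measure_itv _) _.
  by rewrite /= lte_fin ltr_pdivrMr// divfK ?gt_eqF.
apply: etrans (congr1 (fun z => s%:E * z)%E (esym h2)).
apply: etrans (lebesgue_measure_itv _) _; rewrite /= lte_fin.
case: ifP => _; last by rewrite mule0.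
by rewrite -EFinB -EFinM; congr EFin; field; rewrite gt_eqF.
Qed.

(** * The transport kernel *)

Section ray_kernel.
Context {R : realType} {d : nat}.
Variables (T : 'rV[R]_d -> 'rV[R]_d).
Hypotheses (mT : measurable_fun setT T).
Local Notation leb := (lebesgue_rV (R := R) d).
Implicit Types (x : 'rV[R]_d) (t : R) (A : set 'rV[R]_d).

Definition ray x t : 'rV[R]_d := (1 - t) *: x + t *: T x.

Lemma measurable_ray : measurable_fun setT (fun xt : 'rV[R]_d * R => ray xt.1 xt.2).
Proof.
apply: measurable_rV_add; apply: measurable_rV_scale.
- by apply: measurable_funB => //; exact: measurable_snd.
- exact: measurable_fst.
- exact: measurable_snd.
- exact: measurableT_comp mT measurable_fst.
Qed.

Definition ray_preimage A : set ('rV[R]_d * R) :=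
  [set xt | xt.2 \in `[0, 1] /\ A (ray xt.1 xt.2)].

Lemma ray_preimage_measurable A : measurable A -> measurable (ray_preimage A).
Proof.
move=> mA; have -> : ray_preimage A = (snd @^-1` `[0, 1]) `&`
    ((fun xt : 'rV[R]_d * R => ray xt.1 xt.2) @^-1` A) by [].
apply: measurableI; rewrite -[X in measurable X]setTI.
  exact: measurable_snd.
exact: measurable_ray.
Qed.

(** The length of the part of the segment from [x] to [T x] that lies in [A]. The transport density
    of [f] is the integral of this kernel against [f]. *)
Definition kap x A : \bar R :=
  ((len T x)%:E * lebesgue_measure (xsection (ray_preimage A) x))%E.

Local Open Scope ereal_scope.

Lemma kap_ge0 x A : 0 <= kap x A.
Proof. by rewrite mule_ge0// lee_fin enorm_ge0. Qed.

Lemma measurable_kap A : measurable A -> measurable_fun setT (kap ^~ A).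
Proof.
move=> mA; apply: emeasurable_funM.
  by apply/measurable_EFinP; exact: measurable_len.
exact: (measurable_fun_xsection lebesgue_measure (ray_preimage_measurable mA)).
Qed.

Lemma kap_le_len x A : measurable A -> kap x A <= (len T x)%:E.
Proof.
move=> mA; rewrite -[leRHS]mule1 lee_wpmul2l ?lee_fin ?enorm_ge0//.
apply: (@le_trans _ _ (lebesgue_measure (`[0%R, 1%R]%classic : set R))).
  apply: le_measure; rewrite ?inE//.
    exact: measurable_xsection (ray_preimage_measurable mA).
  by move=> t /xsectionP[].
by rewrite lebesgue_measure_itv /= lte_fin ltr01 oppr0 adde0.
Qed.

Lemma kap0 x : kap x set0 = 0.
Proof.
rewrite /kap (_ : ray_preimage set0 = set0) ?xsection0 ?measure0 ?mule0//.
by apply/seteqP; split=> // xt [].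
Qed.

Lemma kap_bigcup x (F : (set 'rV[R]_d)^nat) : (forall n, measurable (F n)) ->
  trivIset setT F -> kap x (\bigcup_n F n) = \sum_(0 <= n <oo) kap x (F n).
Proof.
move=> mF tF; rewrite /kap nneseriesZl//; congr (_ * _).
have -> : ray_preimage (\bigcup_n F n) = \bigcup_n ray_preimage (F n).
  by apply/seteqP; split=> [xt [h [n _ Fn]]|xt [n _ [h Fn]]]; [exists n|split=> //; exists n].
rewrite xsection_bigcup measure_bigcup.
- by apply: eq_eseriesl => n; rewrite in_setT.
- by move=> n _; exact: measurable_xsection (ray_preimage_measurable (mF n)).
apply/trivIsetP => i j _ _ ij; apply/seteqP; split=> // t [/xsectionP[_ Fi] /xsectionP[_ Fj]].
have : (F i `&` F j) (ray x t) by [].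
by move/trivIsetP : tF => /(_ _ _ I I ij) ->.
Qed.

End ray_kernel.

(** * Integrated bound on the kernel *)

Section kernel_bound.
Context {R : realType} {d : nat}.
Local Notation leb := (lebesgue_rV (R := R) d).
Variables (Omega : set 'rV[R]_d) (g : 'rV[R]_d -> R) (lam r : R)
  (T : 'rV[R]_d -> 'rV[R]_d).
Hypotheses (r0 : 0 < r) (rp : round_polyhedron r Omega) (gC2 : C2_closure Omega g)
  (gL : elipschitz_on lam (closure Omega) g) (lam1 : lam < 1)
  (Tsel : forall x, Omega x -> argmin_boundary Omega g x (T x))
  (mT : measurable_fun setT T).
Implicit Types (x : 'rV[R]_d) (t h : R) (A : set 'rV[R]_d).
Local Notation len := (len T).
Local Notation flow := (flow T).

Let mOmega : measurable Omega.
Proof. by apply: open_measurable_rV; case: rp => -[]. Qed.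

Lemma ray_flow x t : 0 < len x -> ray T x t = flow (t * len x) x.
Proof.
move=> lx; rewrite /ray /flow /dir scalerA mulfK ?gt_eqF//.
by vec.
Qed.

Definition flow_graph A : set ('rV[R]_d * R) :=
  [set xh | [/\ Omega xh.1, 0 <= xh.2 & xh.2 < len xh.1] /\ A (flow xh.2 xh.1)].

Lemma flow_graph_measurable A : measurable A -> measurable (flow_graph A).
Proof.
move=> mA.
have mfl : measurable_fun setT (fun xh : 'rV[R]_d * R => flow xh.2 xh.1).
  apply: (measurableT_comp (measurable_flow2 mT) (f := fun hx : R * 'rV[R]_d => flow hx.1 hx.2)
    (g := fun xh : 'rV[R]_d * R => (xh.2, xh.1))).
  by apply: measurable_fun_pair; [exact: measurable_snd|exact: measurable_fst].
have -> : flow_graph A = (fst @^-1` Omega `&` snd @^-1` `[0%R, +oo[) `&`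
    ([set xh | xh.2 < len xh.1] `&` (fun xh : 'rV[R]_d * R => flow xh.2 xh.1) @^-1` A).
  apply/seteqP; split=> xh /=; rewrite in_itv /= andbT.
    by move=> [[? ? ?] ?].
  by move=> [[? ?] [? ?]].
apply: measurableI; apply: measurableI.
- by rewrite -[X in measurable X]setTI; exact: measurable_fst.
- by rewrite -[X in measurable X]setTI; exact: measurable_snd.
- apply: measurable_setlt; first exact: measurable_snd.
  exact: measurableT_comp (measurable_len mT) measurable_fst.
- by rewrite -[X in measurable X]setTI; exact: mfl.
Qed.

(** The substitution [h = t * len x] turns the parameter of the segment into the time of the
    flow. *)
Lemma kap_le_flow x A : measurable A -> Omega x ->
  (kap T x A <= lebesgue_measure (xsection (flow_graph A) x))%E.
Proof.
move=> mA Ox; have lx := len_gt0 rp Tsel Ox.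
have mx := measurable_xsection x (flow_graph_measurable mA).
rewrite (lebesgue_scale lx mx) lee_wpmul2l ?lee_fin ?(ltW lx)//.
have mp : measurable ((fun t : R => t * len x) @^-1` xsection (flow_graph A) x).
  rewrite -[X in measurable X]setTI.
  have mm : measurable_fun setT (fun t : measurableTypeR R => t * len x : measurableTypeR R).
    by apply: measurable_funM.
  exact: mm.
have [B BE] : exists B : set R, B = (fun t : R => t * len x) @^-1` xsection (flow_graph A) x.
  by eexists.
(* The flow is considered only before arrival, so the endpoint [t = 1] is added as a null set. *)
rewrite -BE in mp *; have [S1 S1E] : exists S : set R, S = [set 1] by eexists.
have mS1 : measurable S1 by rewrite S1E.
apply: (@le_trans _ _ (lebesgue_measure (B `|` S1))).
  apply: le_measure; rewrite ?inE.
  - exact: measurable_xsection (ray_preimage_measurable mT mA).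
  - exact: measurableU.
  move=> t /xsectionP[/= ]; rewrite in_itv /= => /andP[t0 t1] At.
  have [->|t1'] := eqVneq t 1; first by right; rewrite S1E.
  left; rewrite BE; apply/xsectionP; split => /=; last by rewrite -ray_flow.
  split=> //; first by rewrite mulr_ge0// ltW.
  by rewrite -ltr_pdivlMr// divff ?gt_eqF// lt_neqAle t1'.
apply: (@le_trans _ _ (lebesgue_measure B + lebesgue_measure S1)%E); first exact: measureU2.
have -> : lebesgue_measure S1 = 0%E by rewrite S1E lebesgue_measure_set1.
by rewrite adde0.
Qed.

(** After Tonelli the inner integral is the volume of a flow preimage, at most [K leb A], and the
    times that contribute lie in [[0, |D|]]. *)
Lemma integral_kap_le : exists2 C : R, 0 <= C & forall A, measurable A ->
  (\int[leb]_(x in Omega) kap T x A <= C%:E * leb A)%E.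
Proof.
have [K K0 flowK] := lebesgue_flow r0 rp gC2 gL lam1 Tsel mT.
have [D lenD] := len_bounded rp Tsel.
exists (`|D| * K) => [|A mA]; first by rewrite mulr_ge0.
have mG := flow_graph_measurable mA.
have mxG := measurable_fun_xsection (@lebesgue_measure R) mG.
apply: (@le_trans _ _ (\int[leb]_x lebesgue_measure (xsection (flow_graph A) x))%E).
  apply: (@le_trans _ _ (\int[leb]_(x in Omega) lebesgue_measure (xsection (flow_graph A) x))%E).
    apply: ge0_le_integral => //.
    - by move=> x _; exact: kap_ge0.
    - by apply: measurable_funTS; exact: measurable_kap.
    - exact: measurable_funTS.
    - by move=> x Ox; exact: kap_le_flow.
  exact: ge0_subset_integral.
have mI : measurable_fun setT (fun z : 'rV[R]_d * R => (\1_(flow_graph A) z : R)%:E).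
  by apply/measurable_EFinP; exact: measurable_indic.
have I0 z : (0 <= (\1_(flow_graph A) z : R)%:E)%E by rewrite lee_fin.
have FT := @fubini_tonelli _ _ _ _ R leb lebesgue_measure _ mI I0.
have xs x : (\int[lebesgue_measure]_y (\1_(flow_graph A) (x, y) : R)%:E =
    lebesgue_measure (xsection (flow_graph A) x))%E.
  rewrite -(setIT (xsection (flow_graph A) x)) -integral_indic//; last exact: measurable_xsection.
  by apply: eq_integral => y _; rewrite !indicE mem_xsection.
have ys y : (\int[leb]_x (\1_(flow_graph A) (x, y) : R)%:E = leb (ysection (flow_graph A) y))%E.
  rewrite -(setIT (ysection (flow_graph A) y)) -integral_indic//; last exact: measurable_ysection.
  by apply: eq_integral => x _; rewrite !indicE mem_ysection.
under eq_integral do rewrite -xs.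
rewrite FT; under eq_integral do rewrite ys.
have my := measurable_fun_ysection leb mG.
apply: (@le_trans _ _ (\int[lebesgue_measure]_(y in `[0%R, `|D|%R]) leb (ysection (flow_graph A) y))%E).
  rewrite [leRHS]integral_mkcond; apply: ge0_le_integral => //.
  - have mI' : measurable (`[0%R, `|D|%R]%classic : set (measurableTypeR R)) by [].
    by move/(measurable_restrictT _ mI').1 : (measurable_funTS (D := `[0%R, `|D|%R]%classic) my).
  - move=> y _; rewrite /patch; case: ifPn => // /negP yD.
    rewrite (_ : ysection _ _ = set0) ?measure0//.
    apply/seteqP; split=> // x /ysectionP[/= [Ox y0 yx] _]; apply: yD.
    rewrite inE /= in_itv /= y0 /=.
    by apply: le_trans (ltW yx) _; apply: le_trans (lenD _ Ox) (ler_norm _).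
apply: (@le_trans _ _ (\int[lebesgue_measure]_(y in `[0%R, `|D|%R]) cst (K%:E * leb A) y)%E).
  apply: ge0_le_integral => //; first exact: measurable_funTS.
  move=> y; rewrite /= in_itv /= => /andP[y0 _].
  apply: le_trans (flowK y y0 A mA); apply: le_measure; rewrite ?inE.
  - exact: measurable_ysection.
  - by apply: flow_preimage_measurable.
  - by move=> x /ysectionP[/= [? ? ?] ?].
have lI : lebesgue_measure (`[0, `|D|]%classic : set R) = `|D|%:E.
  apply: etrans (lebesgue_measure_itv _) _; rewrite /= lte_fin oppr0 adde0.
  case: ltP => // D0; congr EFin; apply/eqP; by rewrite eq_le D0 normr_ge0.
apply: (@le_trans _ _ (K%:E * leb A * lebesgue_measure (`[0%R, `|D|%R]%classic : set R))%E).
  by rewrite integral_cst.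
by rewrite lI EFinM [leLHS]muleC muleA.
Qed.

End kernel_bound.

(** * From integral to pointwise inequalities *)

Section ae_comparison.
Context {R : realType} {dX : measure_display} {X : measurableType dX}.
Variable mu : {measure set X -> \bar R}.
Local Open Scope ereal_scope.

(** The integral inequality is tested on the set where [h < f]. *)
Lemma ae_le_of_integral_le (D : set X) (f h : X -> R) : measurable D ->
  mu.-integrable D (EFin \o f) -> mu.-integrable D (EFin \o h) ->
  (forall A, measurable A -> A `<=` D ->
    \int[mu]_(x in A) (f x)%:E <= \int[mu]_(x in A) (h x)%:E) ->
  {ae mu, forall x, D x -> (f x <= h x)%R}.
Proof.
move=> mD iF iH le_fh.
have mf := measurable_int _ iF; have mh := measurable_int _ iH.
have mE : measurable (D `&` [set x | (h x < f x)%R]).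
  move/measurable_EFinP : mf => mf; move/measurable_EFinP : mh => mh.
  by have := measurable_fun_ltr mh mf mD (Y := [set true]) I.
have [E EE] : exists E, E = D `&` [set x | (h x < f x)%R] by eexists.
rewrite -EE in mE.
have ED : E `<=` D by rewrite EE; exact: subIsetl.
have iFE := integrableS mD mE ED iF; have iHE := integrableS mD mE ED iH.
have mfh : measurable_fun E (fun x => (f x)%:E - (h x)%:E).
  by apply: emeasurable_funB; [exact: measurable_int iFE|exact: measurable_int iHE].
have I0 : \int[mu]_(x in E) `|(f x)%:E - (h x)%:E| = 0.
  transitivity (\int[mu]_(x in E) ((f x)%:E - (h x)%:E)).
    apply: eq_integral => x; rewrite inE EE => -[_ hf].
    by rewrite -EFinB /= ger0_norm// subr_ge0 ltW.
  apply/eqP; rewrite eq_le; apply/andP; split.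
    rewrite integralB_EFin// sube_le0; exact: le_fh.
  by apply: integral_ge0 => x; rewrite EE => -[_ hf]; rewrite -EFinB lee_fin subr_ge0 ltW.
move/(ae_eq_integral_abs _ mE mfh) : I0; apply: filterS => x H Dx.
rewrite leNgt; apply/negP => hf.
have /H : E x by rewrite EE.
by rewrite -EFinB => -[/eqP]; rewrite subr_eq0 gt_eqF.
Qed.

End ae_comparison.

(** * Transported measures and their densities *)

Section transported.
Context {R : realType} {d : nat}.
Local Notation leb := (lebesgue_rV (R := R) d).
Variables (Omega : set 'rV[R]_d) (g : 'rV[R]_d -> R) (lam r : R)
  (T : 'rV[R]_d -> 'rV[R]_d).
Hypotheses (r0 : 0 < r) (rp : round_polyhedron r Omega) (gC2 : C2_closure Omega g)
  (gL : elipschitz_on lam (closure Omega) g) (lam1 : lam < 1)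
  (Tsel : forall x, Omega x -> argmin_boundary Omega g x (T x))
  (mT : measurable_fun setT T).
Implicit Types (x : 'rV[R]_d) (A : set 'rV[R]_d) (w v : 'rV[R]_d -> R).

Let oO : open Omega. Proof. by case: rp => -[]. Qed.
Let mOmega : measurable Omega. Proof. exact: open_measurable_rV. Qed.

Definition transported w A : \bar R :=
  (\int[leb]_(x in Omega) ((w x)%:E * kap T x A))%E.

Lemma measurable_weighted_kap w A : measurable_fun setT w -> measurable A ->
  measurable_fun Omega (fun x => (w x)%:E * kap T x A)%E.
Proof.
move=> mw mA; apply: measurable_funTS; apply: emeasurable_funM.
  exact/measurable_EFinP.
exact: measurable_kap.
Qed.

Lemma weighted_kap_ge0 w A x : (forall x, 0 <= w x) -> (0 <= (w x)%:E * kap T x A)%E.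
Proof. by move=> w0; rewrite mule_ge0 ?lee_fin// kap_ge0. Qed.

Lemma transported_measure w : (forall x, 0 <= w x) -> measurable_fun setT w ->
  exists nu : {measure set 'rV[R]_d -> \bar R}, forall A, nu A = transported w A.
Proof.
move=> w0 mw; apply: measure_of_sigma_additive.
- by rewrite /transported integral0_eq// => x _; rewrite kap0 mule0.
- by move=> A; apply: integral_ge0 => x _; exact: weighted_kap_ge0.
move=> F mF tF mUF.
have -> : transported w (\bigcup_n F n) = (\sum_(0 <= n <oo) transported w (F n))%E.
  rewrite /transported -integral_nneseries//.
  - by apply: eq_integral => x _; rewrite kap_bigcup// -nneseriesZl// => n _; exact: kap_ge0.
  - by move=> n; exact: measurable_weighted_kap.
  - by move=> n x _; exact: weighted_kap_ge0.
apply: is_cvg_nneseries => n _ _; apply: integral_ge0 => x _; exact: weighted_kap_ge0.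
Qed.

Lemma transported_lty w A : (forall x, 0 <= w x) -> measurable_fun setT w ->
  (\int[leb]_(x in Omega) (w x)%:E < +oo)%E -> measurable A -> (transported w A < +oo)%E.
Proof.
move=> w0 mw iw mA; have [D lenD] := len_bounded rp Tsel.
have D0 : 0 <= `|D| by [].
apply: (@le_lt_trans _ _ (\int[leb]_(x in Omega) (`|D|%:E * (w x)%:E))%E).
  apply: ge0_le_integral => //.
  - by move=> x _; exact: weighted_kap_ge0.
  - exact: measurable_weighted_kap.
  - apply: measurable_funTS; apply: emeasurable_funM => //; exact/measurable_EFinP.
  move=> x Ox; rewrite muleC lee_wpmul2r ?lee_fin//.
  apply: le_trans (kap_le_len mT x mA) _; rewrite lee_fin.
  exact: le_trans (lenD _ Ox) (ler_norm _).
rewrite ge0_integralZl//.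
- by rewrite lte_mul_pinfty.
- by apply: measurable_funTS; exact/measurable_EFinP.
- by move=> x _; rewrite lee_fin.
Qed.

(** The bound for the weight 1 forces the kernel at [A] to vanish for almost every [x], and then
    every weight gives zero. *)
Lemma transported_dominated w A : (forall x, 0 <= w x) -> measurable_fun setT w ->
  measurable A -> leb A = 0%E -> transported w A = 0%E.
Proof.
move=> w0 mw mA A0.
have [C C0 kapC] := integral_kap_le r0 rp gC2 gL lam1 Tsel mT.
have mk : measurable_fun Omega (kap T ^~ A) by apply: measurable_funTS; exact: measurable_kap.
have k0 : (\int[leb]_(x in Omega) `|kap T x A| = 0)%E.
  apply/eqP; rewrite eq_le integral_ge0// andbT.
  under eq_integral do rewrite gee0_abs ?kap_ge0//.
  by have := kapC A mA; rewrite A0 mule0.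
move/(ae_eq_integral_abs _ mOmega mk) : k0 => k0.
rewrite /transported (ge0_ae_eq_integral (g := cst 0%E))//; first exact: integral0.
- exact: measurable_weighted_kap.
- by move=> x _; exact: weighted_kap_ge0.
- by apply: filterS k0 => x H /H /= ->; rewrite mule0.
Qed.

Lemma transported_density w : (forall x, 0 <= w x) -> measurable_fun setT w ->
  (\int[leb]_(x in Omega) (w x)%:E < +oo)%E ->
  exists h : 'rV[R]_d -> R, [/\ forall x, 0 <= h x, leb.-integrable setT (EFin \o h) &
    forall A, measurable A -> transported w A = (\int[leb]_(x in A) (h x)%:E)%E].
Proof.
move=> w0 mw iw; have [nu nuE] := transported_measure w0 mw.
have nufin : (nu setT < +oo)%E by rewrite nuE; exact: transported_lty.
(* The restriction to the whole space only records finiteness. *)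
pose fnu : {finite_measure set 'rV[R]_d -> \bar R} :=
  [the {finite_measure set _ -> \bar R} of mfrestr measurableT nufin].
have fnuE A : fnu A = nu A by rewrite /fnu /= /mfrestr /mrestr setIT.
have dom : fnu `<< leb.
  apply/null_content_dominatesP => A mA A0; rewrite fnuE nuE.
  exact: transported_dominated.
have [h [h0 hfin ih hE]] := radon_nikodym_sigma_finite dom.
exists (fine \o h); split=> [x||A mA].
- exact: fine_ge0.
- by apply: eq_integrable ih => // x _; rewrite /= fineK.
- by rewrite -nuE -fnuE hE//; apply: eq_integral => x _; rewrite /= fineK.
Qed.

(** Only the endpoint [t = 1] of the segment can be outside [Omega]. *)
Lemma kap_outside x : Omega x -> kap T x (~` Omega) = 0%E.
Proof.
move=> Ox; have lx := len_gt0 rp Tsel Ox.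
suff S0 : lebesgue_measure (xsection (ray_preimage T (~` Omega)) x) = 0%E.
  by rewrite /kap S0 mule0.
have [S SE] : exists S : set R, S = [set 1] by eexists.
have mS : measurable S by rewrite SE.
have S0 : lebesgue_measure S = 0%E by rewrite SE lebesgue_measure_set1.
apply: (@subset_measure0 _ _ _ lebesgue_measure _ S) => //.
  by apply: measurable_xsection; apply: ray_preimage_measurable => //; exact: measurableC.
move=> t /xsectionP[/=]; rewrite in_itv /= => /andP[t0 t1] nO; rewrite SE /=.
apply: contrapT => t1'; apply: nO; rewrite ray_flow//.
apply: (flow_interior rp gL lam1 Tsel) => //; last by rewrite mulr_ge0// ltW.
rewrite gtr_pMl// lt_neqAle t1 andbT; exact/eqP.
Qed.

Lemma transported_interior w A : (forall x, 0 <= w x) -> measurable_fun setT w ->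
  measurable A -> transported w A = transported w (A `&` Omega).
Proof.
move=> w0 mw mA; have [nu nuE] := transported_measure w0 mw.
rewrite -!nuE; apply/eqP; rewrite eq_le; apply/andP; split; last first.
  by apply: le_measure; rewrite ?inE//; exact: measurableI.
have mC : measurable (~` Omega) by exact: measurableC.
have nuC : nu (~` Omega) = 0%E.
  by rewrite nuE /transported integral0_eq// => x Ox; rewrite kap_outside// mule0.
apply: (@le_trans _ _ (nu (A `&` Omega) + nu (~` Omega))%E); last by rewrite nuC adde0.
apply: (@le_trans _ _ (nu ((A `&` Omega) `|` ~` Omega))).
  apply: le_measure; rewrite ?inE//; first by apply: measurableU => //; exact: measurableI.
  by move=> x Ax; have [Ox|Ox] := pselect (Omega x); [left|right].
by apply: measureU2 => //; exact: measurableI.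
Qed.

Lemma transported_le : exists2 C : R, 0 <= C & forall w v (a b : R),
  (forall x, 0 <= w x) -> (forall x, 0 <= v x) ->
  measurable_fun setT w -> measurable_fun setT v -> 0 <= a -> 0 <= b ->
  {ae leb, forall x, Omega x -> w x <= a + b * v x} ->
  forall A, measurable A ->
  (transported w A <= (a * C)%:E * leb A + b%:E * transported v A)%E.
Proof.
have [C C0 kapC] := integral_kap_le r0 rp gC2 gL lam1 Tsel mT.
exists C => // w v a b w0 v0 mw mv a0 b0 wv A mA.
have mk : measurable_fun Omega (kap T ^~ A) by apply: measurable_funTS; exact: measurable_kap.
have mvk := measurable_weighted_kap mv mA.
apply: (@le_trans _ _ (\int[leb]_(x in Omega)
    (a%:E * kap T x A + b%:E * ((v x)%:E * kap T x A)))%E).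
  apply: ae_ge0_le_integral => //.
  - by move=> x _; exact: weighted_kap_ge0.
  - exact: measurable_weighted_kap.
  - by move=> x _; rewrite adde_ge0// mule_ge0 ?lee_fin ?kap_ge0// weighted_kap_ge0.
  - by apply: emeasurable_funD; exact: emeasurable_funM.
  apply: filterS wv => x H Ox.
  have [k kE] : exists k, k = kap T x A by eexists.
  have k0 : (0 <= k)%E by rewrite kE kap_ge0.
  rewrite -kE [(b%:E * _)%E]muleA -EFinM -ge0_muleDl ?lee_fin ?mulr_ge0//.
  rewrite -EFinD lee_wpmul2r// lee_fin; exact: H.
rewrite ge0_integralD//; last 4 first.
- by move=> x _; rewrite mule_ge0 ?lee_fin ?kap_ge0.
- exact: emeasurable_funM.
- by move=> x _; rewrite mule_ge0 ?lee_fin ?weighted_kap_ge0.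
- exact: emeasurable_funM.
rewrite !ge0_integralZl ?lee_fin//; last 2 first.
- by move=> x _; exact: weighted_kap_ge0.
- by move=> x _; exact: kap_ge0.
by rewrite leeD2r// EFinM -muleA lee_wpmul2l ?lee_fin// kapC.
Qed.

Definition density_of w (h : 'rV[R]_d -> R) :=
  [/\ forall x, 0 <= h x, leb.-integrable setT (EFin \o h) &
    forall A, measurable A -> transported w A = (\int[leb]_(x in A) (h x)%:E)%E].

(** Serves all exponents: [v = w^p] and [b = a^(1 - p)] for finite [p], and [b = 0] for
    [p = +oo]. *)
Lemma density_le : exists2 C : R, 0 <= C & forall w v (a b : R) hw hv,
  (forall x, 0 <= w x) -> (forall x, 0 <= v x) ->
  measurable_fun setT w -> measurable_fun setT v -> 0 <= a -> 0 <= b ->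
  density_of w hw -> density_of v hv ->
  {ae leb, forall x, Omega x -> w x <= a + b * v x} ->
  {ae leb, forall x, Omega x -> hw x <= a * C + b * hv x}.
Proof.
have [C C0 CP] := transported_le; exists C => // w v a b hw hv w0 v0 mw mv a0 b0.
move=> [hw0 iw hwE] [hv0 iv hvE] wv.
have lO : (leb Omega < +oo)%E by apply: lebesgue_bounded_lty => //; case: rp.
have iC : leb.-integrable Omega (EFin \o cst (a * C)).
  apply: measurable_bounded_integrable => //.
  by exists (a * C); split=> [|M hM x _ /=]; [exact: num_real|rewrite ger0_norm ?mulr_ge0// ltW].
have ivO : leb.-integrable Omega (EFin \o (fun x => b * hv x)).
  have -> : EFin \o (fun x => b * hv x) = (fun x => b%:E * (EFin \o hv) x)%E by [].
  by apply: integrableZl => //; apply: integrableS iv.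
apply: (ae_le_of_integral_le (h := fun x => a * C + b * hv x)) => //.
- exact: integrableS iw.
- have -> : EFin \o (fun x => a * C + b * hv x) =
    ((EFin \o cst (a * C)%R) \+ (EFin \o (fun x => b * hv x)%R))%E by [].
  exact: integrableD.
move=> A mA AO; rewrite -hwE//; apply: le_trans (CP w v a b w0 v0 mw mv a0 b0 wv A mA) _.
have mhv : measurable_fun A (EFin \o hv).
  by apply: measurable_funTS; exact: measurable_int iv.
rewrite hvE// -ge0_integralZl//; last by move=> x _; rewrite lee_fin.
rewrite -integral_cst// -ge0_integralD//.
- by move=> x _; rewrite lee_fin mulr_ge0.
- by move=> x _; rewrite -EFinM lee_fin mulr_ge0.
- exact: emeasurable_funM.
Qed.

End transported.

(** * Distance to the complement and cutoff functions *)

Section set_distance.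
Context {R : realType} {d : nat}.
Variable U : set 'rV[R]_d.
Hypotheses (oU : open U) (nU : exists y, ~ U y).
Implicit Types x y z : 'rV[R]_d.

Definition codist x : R := inf [set enorm (x - y) | y in ~` U].

Lemma codist_has_inf x : has_inf [set enorm (x - y) | y in ~` U].
Proof.
split; first by have [y Uy] := nU; exists (enorm (x - y)), y.
by exists 0 => _ [y _ <-]; exact: enorm_ge0.
Qed.

Lemma codist_ge0 x : 0 <= codist x.
Proof.
by apply: lb_le_inf; [case: (codist_has_inf x)|move=> _ [y _ <-]; exact: enorm_ge0].
Qed.

Lemma codist_le x y : ~ U y -> codist x <= enorm (x - y).
Proof. by move=> Uy; apply: ge_inf; [case: (codist_has_inf x)|exists y]. Qed.

Lemma codist_lipschitz x z : `|codist x - codist z| <= enorm (x - z).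
Proof.
have half x' z' : codist x' <= enorm (x' - z') + codist z'.
  rewrite -lerBlDl; apply: lb_le_inf; first by case: (codist_has_inf z').
  move=> _ [y Uy <-]; rewrite lerBlDl; apply: le_trans (codist_le _ Uy) _.
  exact: enormDB.
have := half x z; have := half z x; rewrite (enormB z) ler_norml => h1 h2.
by apply/andP; split; lra.
Qed.

Lemma codist_outside x : ~ U x -> codist x = 0.
Proof.
move=> Ux; apply/eqP; rewrite eq_le codist_ge0 andbT.
by apply: le_trans (codist_le _ Ux) _; rewrite subrr enorm0.
Qed.

Lemma codist_gt0 x : U x -> 0 < codist x.
Proof.
move=> Ux; have [e e0 eU] := open_enorm_ball oU Ux; apply: lt_le_trans e0 _.
apply: lb_le_inf; first by case: (codist_has_inf x).
move=> _ [y Uy <-]; rewrite leNgt; apply/negP => h; apply: Uy; apply: eU.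
by rewrite enormB.
Qed.

End set_distance.

Section open_cutoff.
Context {R : realType} {d : nat}.
Implicit Types (U : set 'rV[R]_d).

(** The functions [min(1, n dist(x, ~U))] are continuous, increase with [n], and at each point are
    eventually equal to the indicator. *)
Lemma open_cutoff U : open U -> exists phi : nat -> 'rV[R]_d -> R,
  [/\ forall n, continuous (phi n), forall n x, 0 <= phi n x,
    forall x n m, (n <= m)%N -> phi n x <= phi m x &
    forall x, \forall n \near \oo, phi n x = \1_U x].
Proof.
(* For the whole space the infimum that defines [codist] is over the empty set; the constant 1 is
   used instead. *)
move=> oU; have [nU|nU] := pselect (exists y, ~ U y); last first.
  have UT x : U x by apply: contrapT => Ux; apply: nU; exists x.
  exists (fun _ _ => 1); split=> // [n x|x]; first exact: cst_continuous.
  by apply: nearW => n; rewrite indicE mem_set.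
exists (fun n x => Num.min 1 (n%:R * codist U x)); split.
- move=> n; apply: (@lipschitz_enorm_continuous _ _ _ n%:R) => x y.
  have := codist_lipschitz nU x y; move=> /(ler_wpM2l (ler0n R n)); apply: le_trans.
  rewrite (_ : n%:R * `|_| = `|n%:R * codist U x - n%:R * codist U y|); last first.
    by rewrite -mulrBr normrM ger0_norm.
  move: (n%:R * _) (n%:R * _) => a b; rewrite /Num.min.
  by case: ltP => h1; case: ltP => h2; rewrite ?subrr ?normr0//;
    rewrite ler_norml; have := ler_norm (b - a); have := ler_norm (- (b - a));
    rewrite normrN => h3 h4; apply/andP; split; lra.
- by move=> n x; rewrite le_min ler01 mulr_ge0// codist_ge0.
- move=> x n m nm; rewrite le_min2// ler_wpM2r ?codist_ge0// ler_nat//.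
- move=> x; rewrite indicE; have [Ux|Ux] := pselect (U x); last first.
    by apply: nearW => n; rewrite memNset// codist_outside// mulr0 min_r.
  have c0 := codist_gt0 oU nU Ux.
  exists (Num.bound (codist U x)^-1) => // n /= bn; rewrite mem_set// min_l//.
  have ci : 0 <= (codist U x)^-1 by rewrite invr_ge0 ltW.
  rewrite -ler_pdivrMr// div1r; apply: le_trans (ltW (archi_boundP ci)) _.
  by rewrite ler_nat.
Qed.

End open_cutoff.

Lemma ge0_cvg_integral (R : realType) dX (X : measurableType dX) (mu : {measure set X -> \bar R})
    (D : set X) (h : nat -> X -> \bar R) (k : X -> \bar R) : measurable D ->
  (forall n, measurable_fun D (h n)) -> (forall n x, D x -> (0 <= h n x)%E) ->
  (forall x, D x -> forall n m, (n <= m)%N -> (h n x <= h m x)%E) ->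
  (forall x, D x -> h n x @[n --> \oo] --> k x) ->
  (\int[mu]_(x in D) h n x)%E @[n --> \oo] --> (\int[mu]_(x in D) k x)%E.
Proof.
move=> mD mh h0 ndh hk.
have := cvg_monotone_convergence mD mh h0 ndh (mu := mu).
rewrite (eq_integral k)// => x; rewrite inE => Dx.
by apply/cvg_lim => //; exact: hk.
Qed.

(** * Identification of [sigma] with the kernel measure *)

Section identification.
Context {R : realType} {d : nat}.
Local Notation leb := (lebesgue_rV (R := R) d).
Variables (Omega : set 'rV[R]_d) (g : 'rV[R]_d -> R) (lam r : R)
  (T : 'rV[R]_d -> 'rV[R]_d).
Hypotheses (r0 : 0 < r) (rp : round_polyhedron r Omega) (gC2 : C2_closure Omega g)
  (gL : elipschitz_on lam (closure Omega) g) (lam1 : lam < 1)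
  (Tsel : forall x, Omega x -> argmin_boundary Omega g x (T x))
  (mT : measurable_fun setT T).
Implicit Types (x : 'rV[R]_d) (A U : set 'rV[R]_d) (phi : 'rV[R]_d -> R).

Let mOmega : measurable Omega.
Proof. by apply: open_measurable_rV; case: rp => -[]. Qed.

Definition ray_integral phi x : \bar R :=
  (\int[lebesgue_measure]_(t in `[0%R, 1%R]) (len T x * phi (ray T x t))%:E)%E.

Lemma measurable_ray_integrand phi : measurable_fun setT phi ->
  measurable_fun setT (fun xt : 'rV[R]_d * R => (len T xt.1 * phi (ray T xt.1 xt.2))%:E).
Proof.
move=> mphi; apply/measurable_EFinP; apply: measurable_funM.
  exact: measurableT_comp (measurable_len mT) measurable_fst.
exact: measurableT_comp mphi (measurable_ray mT).
Qed.

Lemma measurable_ray_section phi x : measurable_fun setT phi ->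
  measurable_fun setT (fun t : measurableTypeR R => (len T x * phi (ray T x t))%:E).
Proof.
move=> mphi; have := measurableT_comp (measurable_ray_integrand mphi) (measurable_pair1 x).
exact.
Qed.

Lemma measurable_ray_integral phi : measurable_fun setT phi -> (forall x, 0 <= phi x) ->
  measurable_fun setT (ray_integral phi).
Proof.
move=> mphi phi0.
pose F (xt : 'rV[R]_d * R) := ((len T xt.1 * phi (ray T xt.1 xt.2))%:E *
  (\1_(`[0, 1]%classic : set R) xt.2 : R)%:E)%E.
have mF : measurable_fun setT F.
  apply: emeasurable_funM; first exact: measurable_ray_integrand.
  apply/measurable_EFinP.
  by apply: (measurableT_comp (measurable_indic _)) => //; exact: measurable_snd.
have F0 xt : (0 <= F xt)%E by rewrite mule_ge0// lee_fin// mulr_ge0// enorm_ge0.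
have := @measurable_fun_fubini_tonelli_F _ _ _ _ R lebesgue_measure _ mF F0.
rewrite (_ : fubini_F _ _ = ray_integral phi)//.
apply/funext => x; rewrite /fubini_F /ray_integral [RHS]integral_mkcond.
by apply: eq_integral => t _; rewrite /F /= patchE indicE; case: ifP; rewrite ?mule1 ?mule0.
Qed.

Lemma ray_integral_ge0 phi x : (forall x, 0 <= phi x) -> (0 <= ray_integral phi x)%E.
Proof.
by move=> phi0; apply: integral_ge0 => t _; rewrite lee_fin mulr_ge0// enorm_ge0.
Qed.

Lemma ray_integral_indic U x : measurable U -> ray_integral (\1_U) x = kap T x U.
Proof.
move=> mU; rewrite /ray_integral /kap.
have mS : measurable (xsection (ray_preimage T U) x).
  exact: measurable_xsection (ray_preimage_measurable mT mU).
under eq_integral do rewrite EFinM.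
have mI : measurable (`[0, 1]%classic : set (measurableTypeR R)) by [].
rewrite (@ge0_integralZl _ (measurableTypeR R) R lebesgue_measure _ mI
  (fun t => (\1_U (ray T x t))%:E))//; last 2 first.
- apply: measurable_funTS; apply/measurable_EFinP.
  have := measurableT_comp (measurableT_comp (measurable_indic mU) (measurable_ray mT)) (measurable_pair1 x).
  exact.
- by rewrite lee_fin enorm_ge0.
congr (_ * _)%E; rewrite integral_mkcond -(setIT (xsection _ _)) -integral_indic//.
apply: eq_integral => t _; rewrite patchE !indicE mem_xsection.
case: ifPn => tI.
  rewrite (_ : (_ \in ray_preimage T U) = (ray T x t \in U))//.
  by apply/idP/idP; rewrite !inE; [case|move=> h; split=> //; rewrite inE in tI].
rewrite (_ : (_ \in ray_preimage T U) = false)//.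
by apply/negbTE; apply: contra tI; rewrite !inE => -[].
Qed.

(** [c] will be a value of [f], which is nonnegative only almost everywhere; for negative [c] the
    sign is moved outside the integral first. *)
Lemma scaled_ray_integral phi x (c : R) : measurable_fun setT phi -> (forall x, 0 <= phi x) ->
  (\int[lebesgue_measure]_(t in `[0%R, 1%R]) (len T x * phi (ray T x t) * c)%:E =
   c%:E * ray_integral phi x)%E.
Proof.
move=> mphi phi0; have mI : measurable (`[0, 1]%classic : set (measurableTypeR R)) by [].
have mf := measurable_funTS (D := (`[0, 1]%classic : set (measurableTypeR R))) (measurable_ray_section x mphi).
have f0 t : (0 <= (len T x * phi (ray T x t))%:E)%E by rewrite lee_fin mulr_ge0// enorm_ge0.
have [c0|c0] := leP 0 c.
  rewrite /ray_integral -(ge0_integralZl _ mI mf)//.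
  by apply: eq_integral => t _; rewrite mulrC EFinM.
have c0' : (0 <= (- c)%:E)%E by rewrite lee_fin oppr_ge0 ltW.
rewrite -[c]opprK EFinN mulNe /ray_integral -(ge0_integralZl _ mI mf)//.
rewrite -integral_ge0N//; last by move=> t _; rewrite mule_ge0.
by apply: eq_integral => t _; rewrite mulrC opprK -EFinM -EFinN mulNr opprK.
Qed.

Variables (f : 'rV[R]_d -> R) (sigma : {measure set 'rV[R]_d -> \bar R}).
Hypotheses (f_ge0 : {ae leb, forall x, Omega x -> 0 <= f x})
  (mf : measurable_fun setT (f \_ Omega))
  (f_int : (\int[leb]_(x in Omega) `|(f \_ Omega) x|%:E < +oo)%E)
  (sigma_td : transport_density Omega f T sigma).

(** A version of [f] that is nonnegative everywhere, as the kernel lemmas require; it agrees with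
    [f] almost everywhere on [Omega]. *)
Definition weight x : R := `|(f \_ Omega) x|.

Lemma weight_ge0 x : 0 <= weight x. Proof. exact: normr_ge0. Qed.

Lemma measurable_weight : measurable_fun setT weight.
Proof. exact: measurableT_comp mf. Qed.

Lemma integral_sigma_continuous phi : continuous phi -> (forall x, 0 <= phi x) ->
  (\int[sigma]_(x in closure Omega) (phi x)%:E =
   \int[leb]_(x in Omega) ((weight x)%:E * ray_integral phi x))%E.
Proof.
move=> cphi phi0; have mphi := continuous_measurable_rV cphi.
have [_ ->] := sigma_td; last exact: continuous_subspaceT.
transitivity (\int[leb]_(x in Omega) (((f \_ Omega) x)%:E * ray_integral phi x))%E.
  apply: eq_integral => x Ox; rewrite -(scaled_ray_integral x _ mphi phi0).
  by apply: eq_integral => t _; rewrite patchE Ox.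
have mri := measurable_ray_integral mphi phi0.
apply: ae_eq_integral => //.
- by apply: measurable_funTS; apply: emeasurable_funM => //; exact/measurable_EFinP.
- apply: measurable_funTS; apply: emeasurable_funM => //; apply/measurable_EFinP.
  exact: measurable_weight.
apply: filterS f_ge0 => x H Ox; rewrite /weight ger0_norm//.
by rewrite patchE mem_set//; exact: H.
Qed.

(** Monotone convergence along the cutoffs of [U], on both sides of the defining identity. On the
    left it yields the mass of [U] in the closure, which is all of it. *)
Lemma sigma_open U : open U -> sigma U = transported Omega T weight U.
Proof.
move=> oU; have mU := open_measurable_rV oU.
have mcl : measurable (closure Omega) by apply: closed_measurable_rV; exact: closed_closure.
have [phi [cphi phi0 ndphi limphi]] := open_cutoff oU.
have mphi n := continuous_measurable_rV (cphi n).
have phicvg x : (phi n x)%:E @[n --> \oo] --> (\1_U x : R)%:E.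
  by apply: cvg_near_cst; apply: filterS (limphi x) => n ->.
have L : (\int[sigma]_(x in closure Omega) (phi n x)%:E)%E @[n --> \oo] --> sigma U.
  have -> : sigma U = (\int[sigma]_(x in closure Omega) (\1_U x : R)%:E)%E.
    rewrite integral_indic//; have [sC _] := sigma_td.
    apply/eqP; rewrite eq_le; apply/andP; split; last first.
      by apply: le_measure; rewrite ?inE//; exact: measurableI.
    have mC := measurableC mcl.
    apply: (@le_trans _ _ (sigma (U `&` closure Omega) + sigma (~` closure Omega))%E).
      apply: (@le_trans _ _ (sigma ((U `&` closure Omega) `|` ~` closure Omega))).
        apply: le_measure; rewrite ?inE//; first by apply: measurableU => //; exact: measurableI.
        by move=> x Ux; have [cx|cx] := pselect (closure Omega x); [left|right].
      by apply: measureU2 => //; exact: measurableI.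
    by rewrite sC adde0.
  apply: ge0_cvg_integral => //.
  - by move=> n; apply: measurable_funTS; exact/measurable_EFinP.
  - by move=> n x _; rewrite lee_fin.
  - by move=> x _ n m nm; rewrite lee_fin ndphi.
have Rn n : (\int[sigma]_(x in closure Omega) (phi n x)%:E =
    \int[leb]_(x in Omega) ((weight x)%:E * ray_integral (phi n) x))%E.
  exact: integral_sigma_continuous.
have Rl : (\int[leb]_(x in Omega) ((weight x)%:E * ray_integral (phi n) x))%E @[n --> \oo] -->
    transported Omega T weight U.
  apply: ge0_cvg_integral => //.
  - move=> n; apply: measurable_funTS; apply: emeasurable_funM.
      by apply/measurable_EFinP; exact: measurable_weight.
    exact: measurable_ray_integral.
  - by move=> n x _; rewrite mule_ge0 ?lee_fin ?weight_ge0// ray_integral_ge0.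
  - move=> x _ n m nm; rewrite lee_wpmul2l ?lee_fin ?weight_ge0//.
    apply: ge0_le_integral => //.
    + by move=> t _; rewrite lee_fin mulr_ge0// enorm_ge0.
    + exact: measurable_funTS (measurable_ray_section x (mphi n)).
    + exact: measurable_funTS (measurable_ray_section x (mphi m)).
    + by move=> t _; rewrite lee_fin ler_wpM2l ?enorm_ge0// ndphi.
  - move=> x _; rewrite -(ray_integral_indic x mU); apply: cvgeZl => //.
    apply: ge0_cvg_integral => //.
    + by move=> n; exact: measurable_funTS (measurable_ray_section x (mphi n)).
    + by move=> n t _; rewrite lee_fin mulr_ge0// enorm_ge0.
    + by move=> t _ n m nm; rewrite lee_fin ler_wpM2l ?enorm_ge0// ndphi.
    + by move=> t _; under eq_fun do rewrite EFinM; rewrite EFinM; apply: cvgeZl.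
rewrite -(cvg_lim (@ereal_hausdorff R) L) -(cvg_lim (@ereal_hausdorff R) Rl).
by apply: (congr1 (fun F : nat -> \bar R => limn F)); apply/funext => n; exact: Rn.
Qed.

(** The open sets are stable under intersection and generate the Borel sets, and the total mass is
    finite. *)
Lemma sigma_transported A : measurable A -> sigma A = transported Omega T weight A.
Proof.
move=> mA; have [nu nuE] := transported_measure rp mT weight_ge0 measurable_weight.
rewrite -nuE; apply: (@measure_unique _ R _ (@open 'rV[R]_d) (fun=> setT) erefl _ _ _ sigma nu) => //.
- by move=> U V; exact: openI.
- by move=> _; exact: openT.
- exact: bigcup_const.
- by move=> U oU; rewrite nuE sigma_open.
- move=> _; rewrite sigma_open; last exact: openT.
  apply: (transported_lty rp Tsel mT) => //; first exact: weight_ge0.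
  exact: measurable_weight.
Qed.

End identification.

(** * Inequalities between powers *)

Section power_estimates.
Context {R : realType}.
Implicit Types a w p : R.

(** If [w > a] then [w <= w (w / a)^(p - 1)], which is the second term. *)
Lemma le_add_powR a w p : 0 < a -> 0 <= w -> 1 <= p -> w <= a + a `^ (1 - p) * w `^ p.
Proof.
move=> a0 w0 p1; have [wa|aw] := leP w a.
  by rewrite -[w in leLHS]addr0 lerD// mulr_ge0 ?powR_ge0.
have {}w0 : 0 < w by apply: lt_trans aw.
have wp : w `^ p = w * w `^ (p - 1).
  rewrite -{2}(powRr1 (ltW w0)) -powRD ?(gt_eqF w0) ?implybT//.
  by rewrite addrC subrK.
have ap : a `^ (1 - p) = (a `^ (p - 1))^-1 by rewrite -powRN opprB.
have le_p : a `^ (p - 1) <= w `^ (p - 1).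
  by rewrite ge0_ler_powR ?nnegrE ?subr_ge0 ?(ltW a0) ?(ltW w0) ?(ltW aw).
have app : 0 < a `^ (p - 1) by exact: powR_gt0.
rewrite wp ap mulrCA; apply: (@le_trans _ _ (w * ((a `^ (p - 1))^-1 * w `^ (p - 1)))).
  by rewrite ler_peMr ?(ltW w0)// ler_pdivlMl// mulr1.
by rewrite lerDr ltW.
Qed.

(** Each parameter [a] has its own null set, so only countably many may be used at once; these
    fractions are enough. *)
Lemma rational_between (c : R) : 0 < c ->
  exists k m : nat, c <= k.+1%:R / m.+1%:R <= 2 * c.
Proof.
move=> c0; have ci0 : 0 <= c^-1 by rewrite invr_ge0 ltW.
pose m := Num.bound c^-1.
have mc : 1 <= c * m.+1%:R.
  rewrite -ler_pdivrMl// mulr1; apply: le_trans (ltW (archi_boundP ci0)) _.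
  by rewrite ler_nat.
have cm0 : 0 <= c * m.+1%:R by rewrite mulr_ge0// ltW.
exists (Num.truncn (c * m.+1%:R)), m.
have /andP[h1 h2] := truncn_itv cm0.
rewrite ler_pdivlMr// ler_pdivrMr// (ltW h2) /= -natr1; lra.
Qed.

(* The optimal [a] is [G `^ p^-1]; a rational within a factor 2 of it is enough. *)
Lemma powR_le_of_rationals (H G C p : R) : 0 <= H -> 0 <= G -> 0 <= C -> 1 <= p ->
  (forall k m : nat, H <= k.+1%:R / m.+1%:R * C + (k.+1%:R / m.+1%:R) `^ (1 - p) * G) ->
  H `^ p <= (2 * C + 1) `^ p * G.
Proof.
move=> H0 G0 C0 p1 HG; have p0 : 0 < p by apply: lt_le_trans p1.
move: G0; rewrite le_eqVlt => /orP[/eqP G0|G0].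
  (* Here the optimal parameter would be 0; letting the fractions tend to 0 gives [H = 0]. *)
  suff -> : H = 0 by rewrite powR0 ?gt_eqF// -G0 mulr0.
  apply/eqP; rewrite eq_le H0 andbT; apply/ler_addgt0Pr => e e0.
  have C1 : 0 < C + 1 by rewrite ltr_wpDl.
  have [k [m /andP[_ h]]] := rational_between (divr_gt0 (divr_gt0 e0 (ltr0n R 2)) C1).
  apply: le_trans (HG k m) _; rewrite -G0 mulr0 addr0 add0r.
  apply: (@le_trans _ _ (2 * (e / 2 / (C + 1)) * (C + 1))).
    by apply: ler_pM => //; rewrite lerDl.
  rewrite -mulrA divfK ?gt_eqF// mulrC divfK//.
(* A fraction [a] between [c] and [2 c] gives [a C <= 2 C c] and [a^(1 - p) G <= c], whence the
   factor [2 C + 1]. *)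
have [c cE] : exists c, c = G `^ p^-1 by eexists.
have c0 : 0 < c by rewrite cE powR_gt0.
have cp : c `^ p = G by rewrite cE -powRrM mulVf ?gt_eqF// powRr1// ltW.
have [k [m /andP[ca ac]]] := rational_between c0.
have [a aE] : exists a : R, a = k.+1%:R / m.+1%:R by eexists.
have := HG k m; rewrite -aE => Ha; rewrite -aE in ca ac.
have a0 : 0 < a by apply: lt_le_trans ca.
have aG : a `^ (1 - p) * G <= c.
  rewrite -opprB powRN mulrC ler_pdivrMr ?powR_gt0//.
  rewrite -cp (_ : c `^ p = c * c `^ (p - 1)).
    by rewrite ler_pM2l// ge0_ler_powR ?nnegrE ?subr_ge0 ?(ltW a0) ?(ltW c0).
  rewrite -{2}(powRr1 (ltW c0)) -powRD ?(gt_eqF c0) ?implybT//.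
  by rewrite addrC subrK.
have HC : H <= (2 * C + 1) * c.
  apply: le_trans Ha _; have := ler_wpM2r C0 ac; lra.
rewrite -cp -powRM ?addr_ge0 ?mulr_ge0 ?(ltW c0)//.
by rewrite ge0_ler_powR ?nnegrE ?(ltW p0)// mulr_ge0 ?addr_ge0 ?mulr_ge0 ?(ltW c0).
Qed.

End power_estimates.

(** * Membership in [Lfun] by integrals and bounds *)

Section Lp_membership.
Context {R : realType} {dX : measure_display} {X : measurableType dX}.
Variable mu : {measure set X -> \bar R}.
Implicit Types (F : X -> R) (p : R).

Lemma LfunE F (p : \bar R) :
  F \in Lfun mu p <-> measurable_fun setT F /\ finite_norm mu p F.
Proof.
by split=> [/andP[]|[h1 h2]]; [rewrite !inE|apply/andP; rewrite !inE].
Qed.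

Lemma finite_normE F p : 0 < p -> finite_norm mu p%:E F <->
  (\int[mu]_x (`|F x| `^ p)%:E < +oo)%E.
Proof.
move=> p0; rewrite /finite_norm unlock /Lnorm.
have -> : (\int[mu]_x `|(EFin \o F) x| `^ p = \int[mu]_x (`|F x| `^ p)%:E)%E.
  by apply: eq_integral => x _ /=.
split=> [|Ioo]; last by apply: poweR_lty.
move=> h; rewrite ltey; apply: contraTneq h => ->.
by rewrite poweRyr ?ltxx// invr_eq0 gt_eqF.
Qed.

Lemma finite_norm_pinfty F : finite_norm mu +oo%E F <->
  exists2 M : R, 0 <= M & {ae mu, forall x, `|F x| <= M}.
Proof.
rewrite /finite_norm unlock /Lnorm; case: ifPn => [mu0|mu0].
  split=> [|[M M0 FM]].
    have := ess_sup_inf.ess_sup_ge mu (abse \o (EFin \o F)).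
    case: (ess_sup_inf.ess_sup _ _) => [M|//|] H //= _.
      exists (Num.max 0 M); rewrite ?le_max ?lexx//.
      by apply: filterS H => x; rewrite /= lee_fin => h; rewrite le_max h orbT.
    by exists 0 => //; apply: filterS H => x; rewrite leeNy_eq.
  apply: (@le_lt_trans _ _ M%:E); last exact: ltry.
  by apply/ess_sup_inf.ess_supP; apply: filterS FM => x; rewrite /= lee_fin.
(* On a space of measure zero the norm is 0 by convention, and any bound holds almost everywhere. *)
split=> // _; exists 0 => //.
exists setT; split=> //.
by apply/eqP; rewrite eq_le measure_ge0 andbT leNgt.
Qed.

End Lp_membership.

Section Lp_integrable.
Context {R : realType} {dX : measure_display} {X : measurableType dX}.
Variable mu : {measure set X -> \bar R}.

Lemma Lfun_normr (F : X -> R) (p : \bar R) :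
  F \in Lfun mu p -> (fun x => `|F x|) \in Lfun mu p.
Proof.
move=> /LfunE[mF Fp]; apply/LfunE; split; first exact: measurableT_comp.
rewrite /finite_norm; under [X in 'N[_]__[X]%E]eq_fun => x do rewrite -abse_EFin.
by rewrite Lnorm_abse.
Qed.

(** For finite [p] the domination is [|F| <= 1 + |F|^p] on a set of finite measure. *)
Lemma Lfun_integral_lty (D : set X) (F : X -> R) (p : \bar R) :
  measurable D -> (mu D < +oo)%E -> (1 <= p)%E -> F \in Lfun mu p ->
  (\int[mu]_(x in D) `|F x|%:E < +oo)%E.
Proof.
move=> mD Doo p1 /LfunE[mF]; have mnF : measurable_fun setT (fun x => `|F x|).
  exact: measurableT_comp mF.
have mFD : measurable_fun D (fun x => `|F x|%:E).
  by apply: measurable_funTS; exact/measurable_EFinP.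
case: p p1 => [p| |//]; rewrite ?lee_fin => p1.
- have p0 : 0 < p by apply: lt_le_trans p1.
  move=> /(finite_normE _ _ p0) Fp.
  have mFp : measurable_fun setT (fun x => `|F x| `^ p).
    exact: measurableT_comp (measurable_powR _) mnF.
  have mFpD : measurable_fun D (fun x => (`|F x| `^ p)%:E).
    by apply: measurable_funTS; exact/measurable_EFinP.
  apply: (@le_lt_trans _ _ (\int[mu]_(x in D) (1 + (`|F x| `^ p)%:E))%E).
    apply: ge0_le_integral => //; first exact: emeasurable_funD.
    move=> x _; rewrite -EFinD lee_fin.
    by have := le_add_powR ltr01 (normr_ge0 (F x)) p1; rewrite powR1 mul1r.
  rewrite ge0_integralD// integral_cst// mul1e.
  apply: lte_add_pinfty => //; apply: le_lt_trans Fp.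
  by apply: ge0_subset_integral => //; exact/measurable_EFinP.
- move=> /finite_norm_pinfty[M M0 FM].
  apply: (@le_lt_trans _ _ (\int[mu]_(x in D) (cst M%:E x))%E).
    apply: ae_ge0_le_integral => //.
    by apply: filterS FM => x h _; rewrite /= lee_fin.
  by rewrite integral_cst// lte_mul_pinfty// ?lee_fin.
Qed.

End Lp_integrable.

(** * Integrability of the transported density *)

Section transported_Lp.
Context {R : realType} {d : nat}.
Local Notation leb := (lebesgue_rV (R := R) d).
Variables (Omega : set 'rV[R]_d) (g : 'rV[R]_d -> R) (lam r : R)
  (T : 'rV[R]_d -> 'rV[R]_d).
Hypotheses (r0 : 0 < r) (rp : round_polyhedron r Omega) (gC2 : C2_closure Omega g)
  (gL : elipschitz_on lam (closure Omega) g) (lam1 : lam < 1)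
  (Tsel : forall x, Omega x -> argmin_boundary Omega g x (T x))
  (mT : measurable_fun setT T).

Let oO : open Omega. Proof. by case: rp => -[]. Qed.
Let mOmega : measurable Omega. Proof. exact: open_measurable_rV. Qed.

Lemma density_Lfun (p : \bar R) (w h : 'rV[R]_d -> R) : (1 <= p)%E ->
  (forall x, 0 <= w x) -> w \in Lfun leb p -> density_of Omega T w h ->
  h \_ Omega \in Lfun leb p.
Proof.
move=> p1 w0 /LfunE[mw wp] hw.
have [h0 ih _] := hw.
have mh : measurable_fun setT h by case/integrableP: ih => /measurable_EFinP.
have mhO : measurable_fun setT (h \_ Omega).
  by apply/(measurable_restrictT _ mOmega); exact: measurable_funTS.
have [C C0 HC] := density_le r0 rp gC2 gL lam1 Tsel mT.
apply/LfunE; split => //; case: p p1 wp => [p| |//]; rewrite ?lee_fin => p1 wp.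
- have p0 : 0 < p by apply: lt_le_trans p1.
  move/(finite_normE _ _ p0) : wp => wp; apply/(finite_normE _ _ p0).
  pose v x := w x `^ p.
  have v0 x : 0 <= v x by exact: powR_ge0.
  have mv : measurable_fun setT v by exact: measurableT_comp (measurable_powR _) mw.
  have vlty : (\int[leb]_(x in Omega) (v x)%:E < +oo)%E.
    apply: le_lt_trans wp; under [leRHS]eq_integral do rewrite ger0_norm//.
    apply: ge0_subset_integral => //; first exact/measurable_EFinP.
    by move=> x _; rewrite lee_fin.
  have [hv [hv0 ihv hvE]] := transported_density r0 rp gC2 gL lam1 Tsel mT v0 mv vlty.
  have mhv : measurable_fun setT hv by case/integrableP: ihv => /measurable_EFinP.
  have bound : {ae leb, forall x, Omega x -> h x `^ p <= (2 * C + 1) `^ p * hv x}.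
    (* One null set for all fractions, so that the parameter may then be chosen depending on [x]. *)
    have : {ae leb, forall x, forall k m : nat, Omega x ->
        h x <= k.+1%:R / m.+1%:R * C + (k.+1%:R / m.+1%:R) `^ (1 - p) * hv x}.
      apply: ae_foralln => k; apply: ae_foralln => m.
      have a0 : 0 < k.+1%:R / m.+1%:R :> R by rewrite divr_gt0.
      apply: (HC w v) => //.
      by apply: filterE => x _; exact: le_add_powR.
    apply: filterS => x H Ox; apply: powR_le_of_rationals => // k m.
    exact: H.
  apply: (@le_lt_trans _ _ (\int[leb]_x (((2 * C + 1) `^ p)%:E * (hv x)%:E))%E).
    apply: ae_ge0_le_integral => //.
    + apply/measurable_EFinP; apply: measurableT_comp (measurable_powR _) _.
      exact: measurableT_comp mhO.
    + by move=> x _; rewrite -EFinM lee_fin mulr_ge0// powR_ge0.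
    + by apply: emeasurable_funM => //; exact/measurable_EFinP.
    apply: filterS bound => x H _; rewrite -EFinM lee_fin patchE.
    case: ifPn => [/set_mem Ox|_]; first by rewrite ger0_norm//; exact: H.
    by rewrite normr0 powR0 ?gt_eqF// mulr_ge0// powR_ge0.
  rewrite ge0_integralZl_EFin ?powR_ge0//; last exact/measurable_EFinP.
  rewrite lte_mul_pinfty ?lee_fin ?powR_ge0//.
    have /integrableP[_ hvoo] := ihv; apply: le_lt_trans hvoo.
    by under [leRHS]eq_integral do rewrite gee0_abs ?lee_fin//.
  by move=> x _; rewrite lee_fin.
- move/finite_norm_pinfty : wp => [M M0 wM]; apply/finite_norm_pinfty.
  exists (M * C); first exact: mulr_ge0.
  (* With [b = 0] the second weight is immaterial, and [w] itself is taken. *)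
  have : {ae leb, forall x, Omega x -> h x <= M * C + 0 * h x}.
    apply: (HC w w) => //; apply: filterS wM => x H _.
    by rewrite mul0r addr0 -[w x]ger0_norm.
  apply: filterS => x H; rewrite patchE; case: ifPn => [/set_mem Ox|_].
    by rewrite ger0_norm//; have := H Ox; rewrite mul0r addr0.
  by rewrite normr0 mulr_ge0.
Qed.

End transported_Lp.

(* A selector is only measurable on the closure; truncating it outside gives a
   globally measurable map with the same transport density. *)
Lemma transport_density_patch (R : realType) (d : nat) (Omega : set 'rV[R]_d)
    (f : 'rV[R]_d -> R) (T : 'rV[R]_d -> 'rV[R]_d) (D : set 'rV[R]_d)
    (sigma : {measure set 'rV[R]_d -> \bar R}) : Omega `<=` D ->
  transport_density Omega f T sigma -> transport_density Omega f (T \_ D) sigma.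
Proof.
move=> OD [s0 sE]; split; first exact: s0.
move=> phi cphi; rewrite (sE _ cphi).
by apply: eq_integral => x /set_mem Ox; rewrite patchE mem_set//; exact: OD.
Qed.

Theorem proposition3p8 (R : realType) (d : nat) (r lambda : R) (p : \bar R)
    (Omega : set 'rV[R]_d) (g f : 'rV[R]_d -> R) (T : 'rV[R]_d -> 'rV[R]_d)
    (sigma : {measure set 'rV[R]_d -> \bar R})
    (r_gt0 : 0 < r)
    (Omega_rp : round_polyhedron r Omega)
    (g_C2 : C2_closure Omega g)
    (g_lip : elipschitz_on lambda (closure Omega) g)
    (lambda_lt1 : lambda < 1)
    (p_ge1 : (1 <= p)%E)
    (f_ge0 : {ae lebesgue_rV d, forall x, Omega x -> 0 <= f x})
    (f_Lp : Lp_on p Omega f)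
    (T_sel : borel_selector Omega g T)
    (sigma_td : transport_density Omega f T sigma) :
  has_density_Lp p Omega sigma.
Proof.
have OcO : Omega `<=` closure Omega by exact: subset_closure.
have oO : open Omega by case: Omega_rp => -[].
have mO : measurable Omega by exact: open_measurable_rV.
have mcl : measurable (closure Omega).
  by apply: closed_measurable_rV; exact: closed_closure.
have [mT aT] := T_sel; have {}sigma_td := transport_density_patch OcO sigma_td.
have mT' : measurable_fun setT (T \_ (closure Omega)).
  by apply/(measurable_restrictT _ mcl).
have T'sel x : Omega x -> argmin_boundary Omega g x ((T \_ (closure Omega)) x).
  by move=> Ox; rewrite patchE mem_set; [apply: aT|]; exact: OcO.
have /LfunE[mf _] := f_Lp.
have wLp : weight Omega f \in Lfun (lebesgue_rV d) p by exact: (Lfun_normr f_Lp).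
have wO : (lebesgue_rV d Omega < +oo)%E by apply: lebesgue_bounded_lty => //; case: Omega_rp.
have f_int := Lfun_integral_lty mO wO p_ge1 f_Lp.
have [h hd] := transported_density r_gt0 Omega_rp g_C2 g_lip lambda_lt1 T'sel mT'
  (weight_ge0 Omega f) (measurable_weight mf) f_int.
have [h0 _ hE] := hd; exists h; split=> [||A mA].
- exact: (density_Lfun r_gt0 Omega_rp g_C2 g_lip lambda_lt1 T'sel mT' p_ge1
    (weight_ge0 Omega f) wLp hd).
- exact: h0.
rewrite (sigma_transported Omega_rp T'sel mT' f_ge0 mf f_int sigma_td mA).
(* The measure does not charge the boundary, since each segment meets it only at its endpoint. *)
rewrite (transported_interior Omega_rp g_lip lambda_lt1 T'sel mT'
  (weight_ge0 Omega f) (measurable_weight mf) mA).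
by apply: hE; exact: measurableI.
Qed.
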